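(* Let $\mathcal{M}\subset\mathbb{R}^{n+k}$ be an embedded $n$-dimensional submanifold with the induced metric, and let $p\in\mathcal{M}$. For a generic $\mathbb{V}\in\mathrm{Gr}(n,n+k)$, such that $\mathbb{V}^\perp\cap T_p\mathcal{M}=\{\mathbf 0\}$, the $n$-dimensional volume of the cylindrical component $\mathrm{Cyl}_p(\varepsilon,\mathbb{V})$ is to leading order, as $\varepsilon\to0$, the volume of the ellipsoid of intersection between the $\mathbb{V}$-cylinder and $T_p\mathcal{M}$: $$V(\mathrm{Cyl}_p(\varepsilon,\mathbb{V}))=V_n(1)\prod_{\mu=1}^n\ell_\mu+\mathcal{O}(\varepsilon^{n+1}),$$ where $\ell_\mu$ are the principal semi-axes of the ellipsoid $\{\mathbf v\in T_p\mathcal{M}:\|\mathrm{proj}_{\mathbb{V}}(\mathbf v)\|\le\varepsilon\}$. When $\mathbb{V}=T_p\mathcal{M}$, the volume is $$V(\mathrm{Cyl}_p(\varepsilon))=V_n(\varepsilon)\left[1+\frac{\varepsilon^2}{2(n+2)}\,\mathrm{tr}\,\mathbf{III}+\mathcal{O}(\varepsilon^4)\right],$$ where $\mathrm{tr}\,\mathbf{III}=\|\mathbf H\|^2-\mathcal R$.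
   Context: $V_n(\varepsilon)=\pi^{n/2}\varepsilon^n/\Gamma(\tfrac n2+1)$ is the volume of the ball of radius $\varepsilon$ in $\mathbb{R}^n$. For an $n$-dimensional linear subspace $\mathbb{V}\in\mathrm{Gr}(n,n+k)$, the cylindrical component is $\mathrm{Cyl}_p(\varepsilon,\mathbb{V})=\mathcal{M}\cap\{q\in\mathbb{R}^{n+k}:\|\mathrm{proj}_{\mathbb{V}}(q-p)\|\le\varepsilon\}$, with $\mathrm{proj}_{\mathbb{V}}$ the orthogonal projection, and $\mathrm{Cyl}_p(\varepsilon)=\mathrm{Cyl}_p(\varepsilon,T_p\mathcal{M})$; $V(\cdot)$ is its volume for the induced Riemannian measure. $\mathbf{II}$ is the (normal-space valued) second fundamental form, $\{\mathbf e_\mu\}$ any orthonormal basis of $T_p\mathcal{M}$, $\mathbf H=\sum_\mu\mathbf{II}(\mathbf e_\mu,\mathbf e_\mu)$ the mean curvature vector at $p$ (no factor $1/n$), $\mathcal R$ the scalar curvature of $\mathcal{M}$ at $p$ (trace of the Ricci tensor, positive for round spheres of dimension at least 2). The third fundamental form is $\langle\mathbf{III}(\mathbf x,\mathbf y)\mathbf n,\mathbf m\rangle=\langle\hat{\mathbf S}_{\mathbf m}\mathbf x,\hat{\mathbf S}_{\mathbf n}\mathbf y\rangle$, where the Weingarten map satisfies $\langle\hat{\mathbf S}_{\mathbf n}\mathbf x,\mathbf y\rangle=\langle\mathbf{II}(\mathbf x,\mathbf y),\mathbf n\rangle$; its total trace (over orthonormal bases of $T_p\mathcal{M}$ and of $N_p\mathcal{M}$)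 is $\mathrm{tr}\,\mathbf{III}=\sum_{\alpha,\beta}\|\mathbf{II}(\mathbf e_\alpha,\mathbf e_\beta)\|^2$. Throughout one works inside a fixed sufficiently small neighborhood of $p$ in $\mathbb{R}^{n+k}$ in which $\mathcal{M}$ is the graph of a smooth map $\mathbf f:T_p\mathcal{M}\to N_p\mathcal{M}$ with $p$ at the origin, $\mathbf f(\mathbf 0)=\mathbf 0$, $\nabla\mathbf f(\mathbf 0)=\mathbf 0$. *)

(* Defs.v *)
From HB Require Import structures.
From mathcomp Require Import all_boot all_order all_algebra.
From mathcomp Require Import all_classical all_reals all_analysis.

Set Implicit Arguments.
Unset Strict Implicit.
Unset Printing Implicit Defensive.

Import Order.TTheory GRing.Theory Num.Theory.
Import numFieldNormedType.Exports.

Local Open Scope classical_set_scope.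
Local Open Scope ring_scope.

Section Euclidean.
Variables (R : realType) (m : nat).
Implicit Types (u v w q : 'rV[R]_m) (V : {vspace 'rV[R]_m}).

Definition dot u v : R := \sum_i u 0 i * v 0 i.

(* The library norm on matrices is the sup norm; this is the Euclidean one. *)
Definition enorm u : R := Num.sqrt (dot u u).

Definition orthocomp V : set 'rV[R]_m :=
  [set v | forall w, w \in V -> dot v w = 0].

Definition oproj V q : 'rV[R]_m := get [set w | w \in V /\ orthocomp V (q - w)].

Definition orthonormal_basis d (B : 'M[R]_(d, m)) (S : set 'rV[R]_m) : Prop :=
  B *m B^T = 1%:M /\ forall v, (v <= B)%MS <-> S v.

(* Principal semi-axes, listed in some order and with multiplicity, of an
   ellipsoid S centred at the origin of the d-dimensional subspace T. *)
Definition principal_semiaxes d (T : {vspace 'rV[R]_m}) (S : set 'rV[R]_m)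
    (l : 'I_d -> R) : Prop :=
  exists u : 'M[R]_(d, m),
    [/\ orthonormal_basis u [set` T], forall i, 0 < l i &
        S = [set v | v \in T /\ \sum_i (dot v (row i u) / l i) ^+ 2 <= 1]].

Definition ellipsoid (T V : {vspace 'rV[R]_m}) (e : R) : set 'rV[R]_m :=
  [set v | v \in T /\ enorm (oproj V v) <= e].

End Euclidean.

Section Smooth.
Variables (R : realType) (X Y : normedModType R).

(* C^j on an open subset D of a finite-dimensional space. *)
Fixpoint Ck (j : nat) (D : set X) (f : X -> Y) : Prop :=
  (forall x, D x -> {for x, continuous f}) /\
  (if j is i.+1 then
     forall v, (forall x, D x -> derivable f x v) /\ Ck i D ('D_v f)
   else True).

Definition smooth_on (D : set X) (f : X -> Y) : Prop := forall j, Ck j D f.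

End Smooth.

Section LebesgueRn.
Variable R : realType.

Fixpoint lebesgue_Rn (n : nat) :
    set (n.-tuple (measurableTypeR R)) -> \bar R :=
  match n with
  | 0 => \d_([tuple] : 0.-tuple (measurableTypeR R))
  | j.+1 => fun A =>
      ((@lebesgue_measure R \x @lebesgue_Rn j)%E
        [set z : measurableTypeR R * j.-tuple (measurableTypeR R) |
           A [tuple of z.1 :: z.2]])
  end.

Definition row_of_tuple n (t : n.-tuple (measurableTypeR R)) : 'rV[R]_n :=
  \row_i (tnth t i : R).

(* Euler's Gamma function, for x > 0. *)
Definition Gamma (x : R) : R :=
  (\int[@lebesgue_measure R]_(t in `]0%R, +oo[) (t `^ (x - 1) * expR (- t)))%R.

Definition ball_volume (n : nat) (e : R) : R :=
  pi `^ (n%:R / 2) * e ^+ n / Gamma (n%:R / 2 + 1).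

End LebesgueRn.

Section Submanifolds.
Variables (R : realType) (m n : nat).
Implicit Types (M U : set 'rV[R]_m) (D : set 'rV[R]_n).
Implicit Types (phi : 'rV[R]_n -> 'rV[R]_m).

Record local_parametrization M U D phi : Prop := {
  lp_open_dom : open D;
  lp_open_nbh : open U;
  lp_smooth : smooth_on D phi;
  lp_image : phi @` D = M `&` U;
  lp_immersion : forall y a, D y -> 'D_a phi y = 0 -> a = 0;
  lp_homeo : exists2 psi : 'rV[R]_m -> 'rV[R]_n,
    {within M `&` U, continuous psi} & forall y, D y -> psi (phi y) = y
}.

Definition embedded_submanifold M : Prop :=
  forall q, M q -> exists U D phi, U q /\ local_parametrization M U D phi.

Definition tangent_vector M (p v : 'rV[R]_m) : Prop :=
  exists (d : R) (c : R -> 'rV[R]_m),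
    [/\ 0 < d, smooth_on `]- d, d[%classic c,
        forall t, `]- d, d[%classic t -> M (c t), c 0 = p & derive1 c 0 = v].

Definition is_tangent_space M p (T : {vspace 'rV[R]_m}) : Prop :=
  forall v, v \in T <-> tangent_vector M p v.

Definition cyl M p (V : {vspace 'rV[R]_m}) (e : R) : set 'rV[R]_m :=
  M `&` [set q | enorm (oproj V (q - p)) <= e].

End Submanifolds.

Section LocalGeometry.
Variables (R : realType) (n : nat).

Definition coord_vec (i : 'I_n) : 'rV[R]_n := delta_mx 0 i.

Definition metric m (phi : 'rV[R]_n -> 'rV[R]_m) (y : 'rV[R]_n) : 'M[R]_n :=
  \matrix_(i, j) dot ('D_(coord_vec i) phi y) ('D_(coord_vec j) phi y).

(* Riemannian volume of A `&` phi @` D, for an injective immersion phi of D. *)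
Definition riemannian_volume m (phi : 'rV[R]_n -> 'rV[R]_m) (D : set 'rV[R]_n)
    (A : set 'rV[R]_m) : \bar R :=
  (\int[@lebesgue_Rn R n]_(t in
      [set t | D (row_of_tuple t) /\ A (phi (row_of_tuple t))])
    (Num.sqrt (\det (metric phi (row_of_tuple t))))%:E)%E.

Variable g : 'rV[R]_n -> 'M[R]_n.
Implicit Types (y : 'rV[R]_n) (i j l s : 'I_n).

(* Gamma^l_{ij} *)
Definition christoffel l i j y : R :=
  2^-1 * \sum_s invmx (g y) l s *
    ('D_(coord_vec i) (fun z => g z j s) y
     + 'D_(coord_vec j) (fun z => g z i s) y
     - 'D_(coord_vec s) (fun z => g z i j) y).

(* The component along d_l of R(d_i, d_j) d_s, where
   R(X, Y) = [nabla_X, nabla_Y] - nabla_[X, Y]. *)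
Definition riemann l s i j y : R :=
  'D_(coord_vec i) (christoffel l j s) y
  - 'D_(coord_vec j) (christoffel l i s) y
  + \sum_r (christoffel l i r y * christoffel r j s y
            - christoffel l j r y * christoffel r i s y).

Definition ricci s j y : R := \sum_i riemann i s i j y.

Definition scalar_curvature y : R :=
  \sum_j \sum_s invmx (g y) j s * ricci s j y.

End LocalGeometry.

Section GraphChart.
Variables (R : realType) (n k : nat).
Implicit Types (M U : set 'rV[R]_(n + k)) (p : 'rV[R]_(n + k)).
Implicit Types (T : {vspace 'rV[R]_(n + k)}).
Implicit Types (E : 'M[R]_(n, n + k)) (F : 'M[R]_(k, n + k)).
Implicit Types (f : 'rV[R]_n -> 'rV[R]_k) (D : set 'rV[R]_n).

Definition graph_map p E F f (y : 'rV[R]_n) : 'rV[R]_(n + k) :=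
  p + y *m E + f y *m F.

(* On U, M is the graph over T of a smooth map from T to the orthogonal
   complement of T; f is that map in the coordinates given by the rows of E
   and F, and D its domain. *)
Record graph_chart M p T E F f D U : Prop := {
  gc_tangent_basis : orthonormal_basis E [set` T];
  gc_normal_basis : orthonormal_basis F (orthocomp T);
  gc_open_dom : open D;
  gc_dom0 : D 0;
  gc_smooth : smooth_on D f;
  gc_f0 : f 0 = 0;
  gc_df0 : forall a, 'D_a f 0 = 0;
  gc_open_nbh : open U;
  gc_graph : M `&` U = graph_map p E F f @` D
}.

(* Normal part of the ambient derivative along x of the coordinate field that
   extends y; the tangent vector x has coordinates x *m E^T, because the
   differential at 0 of a graph chart is a |-> a *m E. *)
Definition second_form T E (phi : 'rV[R]_n -> 'rV[R]_(n + k))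
    (x y : 'rV[R]_(n + k)) : 'rV[R]_(n + k) :=
  let w := 'D_(x *m E^T) ('D_(y *m E^T) phi) 0 in w - oproj T w.

Variable II : 'rV[R]_(n + k) -> 'rV[R]_(n + k) -> 'rV[R]_(n + k).
Implicit Types (x y nu mu : 'rV[R]_(n + k)).

Definition mean_curvature_vector E : 'rV[R]_(n + k) :=
  \sum_i II (row i E) (row i E).

Definition weingarten T nu x : 'rV[R]_(n + k) :=
  get [set s | s \in T /\ forall y, y \in T -> dot s y = dot (II x y) nu].

(* < III(x, y) nu, mu > *)
Definition third_form T x y nu mu : R :=
  dot (weingarten T mu x) (weingarten T nu y).

Definition tr_third_form T E F : R :=
  \sum_(i < n) \sum_(a < k)
    third_form T (row i E) (row i E) (row a F) (row a F).

End GraphChart.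

(* Main.v *)
Require Import Defs.
From HB Require Import structures.
From mathcomp Require Import all_boot all_order all_algebra.
From mathcomp Require Import ring lra fingroup perm.
From mathcomp Require Import all_classical all_reals all_analysis measurable_realfun.

(* Write phi(y) = p + yE + f(y)F and rho = sqrt(det g) for the density of the
   chart.

   Tilted cylinder.  With B the matrix of proj_V restricted to T, the domain of
   the cylinder is {|yB + O(|y|^2)| <= e}, and |y| is bounded by a multiple of
   |yB| by transversality.  Since rho = 1 + O(|y|^2), the volume lies between
   (1 -/+ Ce) times the volumes of the ellipsoids {|yB| <= e(1 -/+ Ce)}, which
   are computed by a linear substitution.

   Tangent cylinder.  The domain is exactly the ball {|y| <= e}.  Folding the
   integral by y -> -y leaves rho(y) + rho(-y) = 2 + q(y) + O(|y|^4), where the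
   quadratic form q is the sum of the squares of all the entries of the vectors
   y Hess(f_a)(0); odd orders disappear.  The second moments of the ball turn q
   into its trace, which is tr III.

   Gauss equation.  At 0 the metric is the identity with vanishing first
   derivatives, so the curvature only involves the first derivatives of the
   Christoffel symbols, that is, products of entries of the Hessians of f.

   The constants of ball volumes come from evaluating the Gaussian integral both
   as a product of one-dimensional integrals and by layers. *)

Set Implicit Arguments.
Unset Strict Implicit.
Unset Printing Implicit Defensive.
Import Order.TTheory GRing.Theory Num.Theory.
Import numFieldNormedType.Exports.
Local Open Scope classical_set_scope.
Local Open Scope ring_scope.

(** * Lebesgue measure on R^n and linear substitution *)

(** [lebesgue_Rn] is given only as a recursively defined set function, so its measure structure,
    Fubini and the substitution rule are built up from dimension one. Integrands are nonnegative and
    extended-real on the whole space, the domain entering as a factor [chi]; finiteness of a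
    cylinder volume is read off from the upper half of a squeeze. The exponent 4 of the tangent case
    has two sources. Determinant and root are truncated after their linear terms, which costs order
    4 because the metric differs from the identity by order 2. What remains is a sum of squares of
    first derivatives of [f], and after folding each square is known up to order 4 from a
    second-order even part and a third-order odd part. In the tilted case a piece of the graph away
    from [p] may bend back into the cylinder and not shrink with [e]. Hence [U0], fixed before [e],
    on which the quadratic term is at most half of the linear one. For the tangent cylinder the
    projection of a graph point is its own parameter, so no such shrinking occurs. Semi-axes are
    chosen separately for each [e]; only their product matters, and the volume determines it. *)

Section ConsMeasure.
Variables (R : realType) (n : nat).
Local Notation mT := (measurableTypeR R).

Definition tcons (z : (mT * n.-tuple mT)%type) : n.+1.-tuple mT :=
  [tuple of z.1 :: z.2].

Lemma measurable_tcons : measurable_fun setT tcons.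
Proof.
by apply: (@measurable_cons _ _ _ mT fst n snd);
  [exact: measurable_fst|exact: measurable_snd].
Qed.

Variable m : {sigma_finite_measure set (n.-tuple mT) -> \bar R}.

(** Once the preimage is unfolded this is literally the successor clause of [lebesgue_Rn], so the
    identification below is a rewrite. *)
Definition cons_measure := pushforward (@lebesgue_measure R \x m)%E tcons.

Let cons_measure0 : cons_measure set0 = 0%E.
Proof. by rewrite /cons_measure /pushforward preimage_set0 measure0. Qed.

Let cons_measure_ge0 A : (0 <= cons_measure A)%E.
Proof. exact: measure_ge0 (@lebesgue_measure R \x m)%E _. Qed.

Let cons_measure_sigma_additive : semi_sigma_additive cons_measure.
Proof.
exact: (@measure_semi_sigma_additive _ _ _
  (measure_function_pushforward__canonical__measure_function_Measure
    (@lebesgue_measure R \x m)%E measurable_tcons)).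
Qed.

HB.instance Definition _ := isMeasure.Build _ _ _ cons_measure
  cons_measure0 cons_measure_ge0 cons_measure_sigma_additive.

Let cons_measure_sigma_finite : sigma_finite setT cons_measure.
Proof.
have /sigma_finiteP[A [AT ndA Aoo]] := sigma_finiteT (@lebesgue_measure R).
have /sigma_finiteP[B [BT ndB Boo]] := sigma_finiteT m.
pose g (t : n.+1.-tuple mT) := [tuple of behead t] : n.-tuple mT.
(* The exhausting sets are boxes, head in [A k] and tail in [B k]; both sequences increase, so the
   index [maxn i j] serves for both. *)
exists (fun k => (@thead _ _) @^-1` A k `&` g @^-1` B k).
  apply/esym/seteqP; split=> // t _.
  have [i _ Ai] : (\bigcup_i A i) (thead t) by rewrite -AT.
  have [j _ Bj] : (\bigcup_i B i) (g t) by rewrite -BT.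
  exists (maxn i j) => //; split.
  - by have /subsetPset := ndA _ _ (leq_maxl i j); apply.
  - by have /subsetPset := ndB _ _ (leq_maxr i j); apply.
move=> k; have [mA Akoo] := Aoo k; have [mB Bkoo] := Boo k; split.
  apply: measurableI; rewrite -[X in measurable X]setTI.
    exact: (@measurable_tnth _ mT).
  exact: measurable_behead.
rewrite /cons_measure /pushforward (_ : tcons @^-1` _ = A k `*` B k).
  by rewrite product_measure1E// lte_mul_pinfty// ge0_fin_numE.
have gK x t : g (tcons (x, t)) = t by exact: val_inj.
by apply/seteqP; split=> -[x t] /=; rewrite gK /tcons theadE.
Qed.

HB.instance Definition _ := Measure_isSigmaFinite.Build _ _ _ cons_measure
  cons_measure_sigma_finite.

End ConsMeasure.

Section LebesgueRnMeasure.
Variable R : realType.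
Local Notation mT := (measurableTypeR R).
Local Notation leb := (@lebesgue_measure R).

(** The measure properties of the product in the successor clause rest on those of its second
    factor. The induction therefore carries a bundled sigma-finite measure, from which the instances
    below are transported. *)
Lemma lebesgue_Rn_measure n :
  {m : {sigma_finite_measure set (n.-tuple mT) -> \bar R} |
     (m : set _ -> \bar R) = @lebesgue_Rn R n}.
Proof.
elim: n => [|n [m IH]].
  by exists [the {sigma_finite_measure set _ -> \bar R} of
    \d_([tuple] : 0.-tuple mT)].
exists [the {sigma_finite_measure set _ -> \bar R} of
   cons_measure m].
by rewrite /= -IH.
Qed.

Let leb_Rn n := sval (lebesgue_Rn_measure n).
Let leb_RnE n : (leb_Rn n : set _ -> \bar R) = @lebesgue_Rn R n :=
  svalP (lebesgue_Rn_measure n).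

Let lebesgue_Rn0 n : @lebesgue_Rn R n set0 = 0%E.
Proof. by rewrite -leb_RnE measure0. Qed.

Let lebesgue_Rn_ge0 n A : (0 <= @lebesgue_Rn R n A)%E.
Proof. by rewrite -leb_RnE measure_ge0. Qed.

Let lebesgue_Rn_sigma_additive n : semi_sigma_additive (@lebesgue_Rn R n).
Proof. by rewrite -leb_RnE; exact: measure_semi_sigma_additive. Qed.

HB.instance Definition _ n := isMeasure.Build _ _ _ (@lebesgue_Rn R n)
  (@lebesgue_Rn0 n) (@lebesgue_Rn_ge0 n) (@lebesgue_Rn_sigma_additive n).

Let lebesgue_Rn_sigma_finite n : sigma_finite setT (@lebesgue_Rn R n).
Proof. by rewrite -leb_RnE; exact: sigma_finiteT. Qed.

HB.instance Definition _ n := Measure_isSigmaFinite.Build _ _ _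
  (@lebesgue_Rn R n) (@lebesgue_Rn_sigma_finite n).

End LebesgueRnMeasure.

(** The measure lives on tuples and the geometry on row vectors; measurability of a function of row
    vectors is always tested through [row_of_tuple]. *)
Notation row_measurable G := (measurable_fun setT (G \o @row_of_tuple _ _)).

Section RowTuple.
Variable R : realType.
Local Notation mT := (measurableTypeR R).
Local Notation leb := (@lebesgue_measure R).

Definition tuple_of_row n (y : 'rV[R]_n) : n.-tuple mT := [tuple y 0 i | i < n].

Lemma tuple_of_rowK n : cancel (@tuple_of_row n) (@row_of_tuple R n).
Proof. by move=> y; apply/rowP => i; rewrite mxE tnth_mktuple. Qed.

Lemma row_of_tuple_cons n x (t : n.-tuple mT) :
  row_of_tuple (tcons (x, t)) =
  row_mx (x%:M : 'M[R]_1) (row_of_tuple t) :> 'rV[R]_(1 + n).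
Proof.
apply/rowP => i; rewrite !mxE; case: splitP => j.
  rewrite ord1 => i0; have -> : i = ord0 by apply: val_inj.
  by rewrite /tcons tnth0 mxE eqxx.
move=> ij; have -> : i = lift ord0 j :> 'I_(1 + n) by apply: val_inj.
by rewrite tnthS mxE; congr (tnth _ _); apply: val_inj.
Qed.


Lemma row_measurable_coord n i : row_measurable (fun y : 'rV[R]_n => (y 0 i : mT)).
Proof.
rewrite (_ : _ \o _ = (fun t => tnth t i)); last first.
  by apply/funext => t /=; rewrite mxE.
exact: measurable_tnth.
Qed.

Definition row_int n (G : 'rV[R]_n -> \bar R) : \bar R :=
  (\int[@lebesgue_Rn R n]_t G (row_of_tuple t))%E.

Lemma measurable_row_comp d (S : measurableType d) d' (S' : measurableType d') n
    (h : S' -> 'rV[R]_n) (G : 'rV[R]_n -> S) :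
  (forall i, measurable_fun setT (fun s => h s 0 i : mT)) ->
  row_measurable G -> measurable_fun setT (G \o h).
Proof.
move=> mh mG; rewrite (_ : G \o h =
  (G \o @row_of_tuple R n) \o (@tuple_of_row n \o h)); last first.
  by apply/funext => s /=; rewrite tuple_of_rowK.
apply: measurableT_comp => //; apply/measurable_fun_tnthP => i.
rewrite (_ : _ \o _ = fun s => h s 0 i : mT)//.
by apply/funext => s /=; rewrite tnth_mktuple.
Qed.

Lemma row_int0 (G : 'rV[R]_0 -> \bar R) : row_measurable G -> (forall y, 0 <= G y)%E ->
  row_int G = G 0.
Proof.
move=> mG G0; rewrite /row_int /= integral_dirac//.
  by rewrite diracT mul1e; congr G; apply/rowP => -[].
Qed.

Section Fubini.
Variables (n : nat) (G : 'rV[R]_(1 + n) -> \bar R).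
Hypotheses (mG : row_measurable G) (G0 : forall y, (0 <= G y)%E).

Let H (z : (mT * n.-tuple mT)%type) := G (row_mx (z.1%:M : 'M[R]_1) (row_of_tuple z.2)).

Lemma measurable_row_cons : measurable_fun setT H.
Proof.
rewrite (_ : H = (G \o @row_of_tuple R n.+1) \o @tcons R n).
  by apply: measurableT_comp => //; exact: measurable_tcons.
by apply/funext => -[x t] /=; rewrite (row_of_tuple_cons x t).
Qed.

Lemma row_intE : row_int G = (\int[leb \x @lebesgue_Rn R n]_z H z)%E.
Proof.
rewrite /row_int.
rewrite [@lebesgue_Rn R (1 + n)](_ : _ =
  pushforward (leb \x @lebesgue_Rn R n)%E (@tcons R n))//.
rewrite ge0_integral_pushforward//; last exact: measurable_tcons.
rewrite preimage_setT; apply: eq_integral => -[x t] _ /=.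
by rewrite (row_of_tuple_cons x t).
Qed.

(** The head coordinate is integrated last here and first in [row_intSr]; the two orders serve the
    upper and the lower block-triangular substitutions respectively. *)
Lemma row_intS : row_int G =
  (\int[leb]_x row_int (fun y => G (row_mx (x%:M : 'M[R]_1) y)))%E.
Proof.
by rewrite row_intE (fubini_tonelli1 _ measurable_row_cons)// => z; exact: G0.
Qed.

Lemma row_intSr : row_int G =
  row_int (fun y => (\int[leb]_x G (row_mx (x%:M : 'M[R]_1) y))%E).
Proof.
rewrite row_intE (fubini_tonelli2 _ measurable_row_cons)//.
by move=> z; exact: G0.
Qed.

Lemma row_measurable_cons x : row_measurable (fun y => G (row_mx (x%:M : 'M[R]_1) y)).
Proof.
exact: (measurableT_comp measurable_row_cons (pair1_measurable (x : mT))).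
Qed.

Lemma measurable_cons_head (y : 'rV_n) :
  measurable_fun setT (fun x : mT => G (row_mx (x%:M : 'M[R]_1) y)).
Proof.
have /= := measurableT_comp measurable_row_cons (pair2_measurable (tuple_of_row y)).
rewrite (_ : _ \o _ = fun x : mT => G (row_mx (x%:M : 'M[R]_1) y))//.
by apply/funext => x /=; rewrite /H /= tuple_of_rowK.
Qed.

End Fubini.
End RowTuple.

Section AffineLine.
Variable R : realType.
Local Notation mT := (measurableTypeR R).
Local Notation leb := (@lebesgue_measure R).
Variables a b : R.
Hypothesis a0 : a != 0.

Let h (x : mT) : mT := a * x + b.

Let mh : measurable_fun setT h.
Proof. by apply: measurable_funD => //; exact: measurable_funM. Qed.

(** By uniqueness of Lebesgue measure it is enough to compare on half-open intervals. For negative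
    [a] the preimage is half-open on the other side, which does not change its length. *)
Let leb_h A : measurable A -> leb A = (`|a|%:E * leb (h @^-1` A))%E.
Proof.
move=> mA; pose k : {nonneg R} := NngNum (normr_ge0 a).
pose q := measure_function_pushforward__canonical__measure_function_Measure leb mh.
suff /(_ A mA) -> : forall A, measurable A -> leb A = mscale k q A by [].
apply: lebesgue_measure_unique => _ [[u v]] _ <-.
rewrite lebesgue_measure_itv/= -[mscale _ _ _]/(`|a|%:E * leb (h @^-1` `]u, v]))%E.
have [a_gt0|a_lt0|/eqP] := ltgtP 0 a; last by rewrite eq_sym (negbTE a0).
- rewrite (_ : h @^-1` _ = `](u - b) / a, (v - b) / a]%classic); last first.
    apply/seteqP; split=> x; rewrite /= !in_itv/= /h ltr_pdivrMr// ler_pdivlMr//;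
    by rewrite ltrBlDr lerBrDr mulrC.
  rewrite lebesgue_measure_itv/= !lte_fin ltr_pM2r ?invr_gt0// ltrD2r.
  case: ifPn => _; last by rewrite mule0.
  by rewrite -EFinM gtr0_norm//; congr EFin; field.
- rewrite (_ : h @^-1` _ = `[(v - b) / a, (u - b) / a[%classic); last first.
    apply/seteqP; split=> x; rewrite /= !in_itv/= /h ltr_ndivlMr// ler_ndivrMr//;
    by rewrite ltrBlDr lerBrDr mulrC andbC.
  rewrite lebesgue_measure_itv/= !lte_fin ltr_nM2r ?invr_lt0// ltrD2r.
  case: ifPn => _; last by rewrite mule0.
  by rewrite -EFinM ltr0_norm//; congr EFin; field.
Qed.

Lemma integral_affine (g : mT -> \bar R) : measurable_fun setT g ->
  (forall x, 0 <= g x)%E ->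
  (\int[leb]_x g (a * x + b)%R = `|a|^-1%:E * \int[leb]_x g x)%E.
Proof.
move=> mg g0; pose k : {nonneg R} := NngNum (normr_ge0 a).
pose q := measure_function_pushforward__canonical__measure_function_Measure leb mh.
have -> : (\int[leb]_x g x = \int[mscale k q]_x g x)%E.
  by apply: eq_measure_integral => A mA _; exact: leb_h.
rewrite ge0_integral_mscale//= ge0_integral_pushforward//= preimage_setT.
by rewrite muleA -EFinM mulVf ?normr_eq0// mul1e.
Qed.

End AffineLine.

Section ChangeOfVariables.
Variable R : realType.
Local Notation mT := (measurableTypeR R).
Local Notation leb := (@lebesgue_measure R).

Lemma row_measurable_affine n n' (A : 'M[R]_(n, n')) v (G : 'rV[R]_n' -> \bar R) :
  row_measurable G -> row_measurable (fun y => G (y *m A + v)).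
Proof.
apply: (@measurable_row_comp R _ _ _ _ n' (fun t => row_of_tuple t *m A + v)) => i.
rewrite (_ : (fun s => _) = fun t : n.-tuple mT =>
    \sum_j (row_of_tuple t 0 j * A j i : R) + v 0 i); last first.
  by apply/funext => t; rewrite !mxE.
apply: measurable_funD => //; apply: measurable_sum => j.
by apply: measurable_funM => //; exact: row_measurable_coord.
Qed.

Lemma row_intZl n (G : 'rV[R]_n -> \bar R) c : row_measurable G ->
  (forall y, 0 <= G y)%E -> 0 <= c ->
  row_int (fun y => c%:E * G y)%E = (c%:E * row_int G)%E.
Proof. by move=> mG G0 c0; rewrite /row_int ge0_integralZl. Qed.

Lemma row_int_ge0 n (G : 'rV[R]_n -> \bar R) :
  (forall y, 0 <= G y)%E -> (0 <= row_int G)%E.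
Proof. by move=> G0; apply: integral_ge0. Qed.

Section Head.
Variables (n : nat) (G : 'rV[R]_(1 + n) -> \bar R).
Hypotheses (mG : row_measurable G) (G0 : forall y, (0 <= G y)%E).

Lemma row_measurable_integral_head :
  row_measurable (fun y : 'rV_n => \int[leb]_x G (row_mx (x%:M : 'M[R]_1) y))%E.
Proof.
exact: (measurable_fun_fubini_tonelli_G (m1 := leb) _ (measurable_row_cons mG)
  (fun z => G0 _)).
Qed.

Lemma measurable_row_int_tail : measurable_fun setT
  (fun x : mT => row_int (fun y : 'rV_n => G (row_mx (x%:M : 'M[R]_1) y))).
Proof.
exact: (measurable_fun_fubini_tonelli_F (m2 := @lebesgue_Rn R n) _
  (measurable_row_cons mG) (fun z => G0 _)).
Qed.
End Head.

(** The translation [v] belongs to the rule because, with one block of coordinates fixed, a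
    triangular map acts on the other block with a shift depending on the fixed one. *)
Definition substitution_rule n (A : 'M[R]_n) := forall v (G : 'rV[R]_n -> \bar R),
  row_measurable G -> (forall y, 0 <= G y)%E ->
  row_int (fun y => G (y *m A + v)) = (`|\det A|^-1%:E * row_int G)%E.

Lemma substitution_mul n (A B : 'M[R]_n) :
  substitution_rule A -> substitution_rule B -> substitution_rule (A *m B).
Proof.
move=> hA hB v G mG G0.
have := hA 0 (fun z => G (z *m B + v)) (row_measurable_affine _ _ mG) (fun=> G0 _).
rewrite hB// muleA -EFinM -invfM -normrM -det_mulmx => <-.
by congr row_int; apply/funext => y; rewrite addr0 mulmxA.
Qed.

Lemma scalar_addM (a b : R) : (a%:M : 'M[R]_1) + b%:M = (a + b)%:M.
Proof. by rewrite -raddfD. Qed.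

(** For a fixed tail [y] the new head is [a x] plus a shift depending on [y]. Integrating the head
    first absorbs [c], and only [d] is left for the tail. *)
Lemma substitution_lblock n (a : R) (c : 'cV[R]_n) (d : 'M[R]_n) : a != 0 ->
  substitution_rule d ->
  substitution_rule (block_mx (a%:M : 'M[R]_1) 0 c d : 'M[R]_(1 + n)).
Proof.
move=> a0 hd v G mG G0.
rewrite row_intSr//; last by exact: row_measurable_affine.
pose K (y : 'rV_n) : \bar R := (\int[leb]_x G (row_mx (x%:M : 'M[R]_1) y))%E.
have mK : row_measurable K := row_measurable_integral_head mG G0.
have K0 y : (0 <= K y)%E by apply: integral_ge0.
have -> : row_int G = row_int K by rewrite row_intSr.
transitivity (row_int (fun y => `|a|^-1%:E * K (y *m d + rsubmx v)%R)%E).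
  congr row_int; apply/funext => y.
  rewrite -(@integral_affine R a ((y *m c) 0 0 + lsubmx v 0 0) a0
    (fun x => G (row_mx (x%:M : 'M[R]_1) (y *m d + rsubmx v))))//; last first.
    exact: measurable_cons_head.
  apply: eq_integral => x _; congr G.
  rewrite -[v in LHS]hsubmxK mul_row_block mulmx0 add0r add_row_mx; congr row_mx.
  rewrite -scalar_mxM [y *m c]mx11_scalar [lsubmx v]mx11_scalar !scalar_addM.
  by rewrite !mxE eqxx mulr1n -addrA mulrC.
rewrite (@row_intZl _ (fun y => K (y *m d + rsubmx v))) ?invr_ge0//; last first.
  exact: row_measurable_affine.
by rewrite (hd _ _ mK K0) det_lblock det_scalar1 normrM invfM EFinM muleA.
Qed.

(** The mirror image: for a fixed head [x] the tail is moved by [d] and shifted by [x *: b], so the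
    tail is integrated first. *)
Lemma substitution_ublock n (a : R) (b : 'rV[R]_n) (d : 'M[R]_n) : a != 0 ->
  substitution_rule d ->
  substitution_rule (block_mx (a%:M : 'M[R]_1) b 0 d : 'M[R]_(1 + n)).
Proof.
move=> a0 hd v G mG G0.
rewrite row_intS//; last by exact: row_measurable_affine.
pose L x : \bar R := row_int (fun y : 'rV_n => G (row_mx (x%:M : 'M[R]_1) y)).
have mL : measurable_fun setT (L : mT -> _) by exact: measurable_row_int_tail.
have L0 x : (0 <= L x)%E by apply: row_int_ge0.
transitivity (\int[leb]_x (`|\det d|^-1%:E * L (a * x + lsubmx v 0 0)%R))%E.
  apply: eq_integral => x _; rewrite -(hd (x *: b + rsubmx v))//; last first.
    exact: row_measurable_cons.
  congr row_int; apply/funext => y; congr G.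
  rewrite -[v in LHS]hsubmxK mul_row_block mulmx0 addr0 add_row_mx; congr row_mx.
    rewrite -scalar_mxM [lsubmx v]mx11_scalar !scalar_addM.
    by rewrite !mxE eqxx mulr1n mulrC.
  by rewrite mul_scalar_mx (addrC (x *: b)) addrA.
have mh : measurable_fun setT (fun x : mT => a * x + lsubmx v 0 0 : mT).
  by apply: measurable_funD => //; exact: measurable_funM.
rewrite ge0_integralZl//; last exact: (measurableT_comp mL mh).
rewrite integral_affine// row_intS// det_ublock det_scalar1 normrM invfM EFinM.
by rewrite muleA [X in (X * _)%E]muleC.
Qed.

(** Gaussian elimination by induction on the dimension: after pivoting, the matrix is a product of
    three block-triangular factors whose lower right blocks are identities or an invertible matrix
    of smaller size. *)
Lemma substitution_unit n (A : 'M[R]_n) : A \in unitmx -> substitution_rule A.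
Proof.
elim: n A => [|n IH] A uA.
  move=> v G mG G0; rewrite det_mx00 normr1 invr1 mul1e !row_int0//.
    by congr G; apply/rowP => -[].
  exact: (row_measurable_affine A v mG).
pose A' : 'M[R]_(1 + n) := A.
pose a := ulsubmx A' 0 0; pose b := ursubmx A'.
pose c := dlsubmx A'; pose d := drsubmx A'.
have A'E : A' = block_mx (a%:M : 'M[R]_1) b c d.
  by rewrite -[LHS]submxK; congr block_mx; exact: mx11_scalar.
(* Pivoting: the first column of an invertible matrix is not zero, so if the corner entry vanishes,
   adding a suitable lower row to the first one makes it nonzero. *)
have [w aw0] : exists w : 'rV[R]_n, a + (w *m c) 0 0 != 0.
  have [a0|a0] := eqVneq a 0; last by exists 0; rewrite mul0mx mxE addr0.
  have [i ci0] : exists i, c i 0 != 0.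
    apply/existsP; apply: contraLR uA => /existsPn c0.
    have cE : c = 0 by apply/colP => i; rewrite [RHS]mxE; apply/eqP; rewrite -[_ == _]negbK c0.
    rewrite unitmxE -[\det A]/(\det A') A'E a0 cE det_ublock.
    by rewrite det_scalar1 mul0r unitr0.
  by exists (delta_mx 0 i); rewrite a0 add0r -rowE mxE.
set a' := a + _ in aw0; pose b' := b + w *m d; pose d' := d - a'^-1 *: (c *m b').
(* The first factor undoes the pivoting, the second restores the column below the pivot [a'], and
   [d'] is the Schur complement. *)
have AE : A' = block_mx (1%:M : 'M[R]_1) (- w) 0 1%:M *m
  (block_mx (1%:M : 'M[R]_1) 0 (a'^-1 *: c) 1%:M *m
   block_mx (a'%:M : 'M[R]_1) b' 0 d').
  rewrite A'E !mulmx_block !(mul1mx, mulmx1, mul0mx, mulmx0, addr0, add0r).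
  have -> : a'^-1 *: c *m (a'%:M : 'M[R]_1) = c.
    by rewrite mul_mx_scalar scalerA mulfV// scale1r.
  have -> : a'^-1 *: c *m b' + d' = d by rewrite -scalemxAl addrC subrK.
  congr block_mx; last by rewrite mulNmx addrK.
  rewrite /a' mulNmx -scalar_addM; apply/matrixP => i j; rewrite !ord1 !mxE eqxx.
  by rewrite !mulr1n addrK.
have ud' : d' \in unitmx.
  move: uA; rewrite -[_ \in _]/(A' \in unitmx) AE !unitmx_mul => /andP[_ /andP[_]].
  by rewrite !unitmxE det_ublock det_scalar1 unitrM => /andP[].
rewrite -[substitution_rule A]/(substitution_rule A') AE; apply: substitution_mul; last apply: substitution_mul.
- by apply: substitution_ublock; [exact: oner_neq0|apply/IH/unitmx1].
- by apply: substitution_lblock; [exact: oner_neq0|apply/IH/unitmx1].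
- by apply: substitution_ublock => //; exact: IH.
Qed.

End ChangeOfVariables.

(** * Volume and second moments of Euclidean balls *)

Section BallVolume.
Variable R : realType.
Local Notation mT := (measurableTypeR R).
Local Notation leb := (@lebesgue_measure R).

(** Indicators written as factors keep every integral over the whole space, so that Fubini and
    substitution apply without transforming domains. *)
Definition ereal_of_bool (b : bool) : \bar R := (b%:R)%:E.
Local Notation chi := ereal_of_bool.

Lemma measurable_natr_bool d (T : measurableType d) (b : T -> bool) :
  measurable_fun setT b -> measurable_fun setT (fun x => (b x)%:R : R).
Proof.
move=> mb; rewrite (_ : (fun x => _) = fun x => if b x then 1 else 0 : R).
  exact: measurable_fun_ifT.
by apply/funext => x; case: (b x).
Qed.

Lemma measurable_chi d (T : measurableType d) (b : T -> bool) :
  measurable_fun setT b -> measurable_fun setT (fun x => chi (b x)).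
Proof. by move=> mb; apply/measurable_EFinP; exact: measurable_natr_bool. Qed.

Lemma chi_ge0 b : (0 <= chi b)%E.
Proof. by rewrite lee_fin ler0n. Qed.

Lemma dot_ge0 m (u : 'rV[R]_m) : 0 <= dot u u.
Proof. by apply: sumr_ge0 => i _; rewrite -expr2 sqr_ge0. Qed.

Lemma dotE m (u v : 'rV[R]_m) : dot u v = (u *m v^T) 0 0.
Proof. by rewrite mxE; apply: eq_bigr => i _; rewrite mxE. Qed.

Lemma dot_row_mx m1 m2 (u u' : 'rV[R]_m1) (v v' : 'rV[R]_m2) :
  dot (row_mx u v) (row_mx u' v') = dot u u' + dot v v'.
Proof.
rewrite /dot big_split_ord /=; congr (_ + _); apply: eq_bigr => i _.
  by rewrite !row_mxEl.
by rewrite !row_mxEr.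
Qed.

Lemma enorm_ge0 m (u : 'rV[R]_m) : 0 <= enorm u.
Proof. exact: sqrtr_ge0. Qed.

Lemma enorm_sqr m (u : 'rV[R]_m) : enorm u ^+ 2 = dot u u.
Proof. by rewrite sqr_sqrtr// dot_ge0. Qed.

Lemma enorm_le m (u : 'rV[R]_m) e : 0 <= e -> (enorm u <= e) = (dot u u <= e ^+ 2).
Proof. by move=> e0; rewrite -enorm_sqr ler_sqr ?nnegrE ?enorm_ge0. Qed.

Lemma enormZ m (u : 'rV[R]_m) c : enorm (c *: u) = `|c| * enorm u.
Proof.
rewrite /enorm -sqrtr_sqr -sqrtrM ?sqr_ge0//; congr Num.sqrt.
by rewrite !dotE linearZ -scalemxAl -scalemxAr scalerA mxE -expr2.
Qed.

Lemma row_measurable_dot n : row_measurable (fun y : 'rV[R]_n => dot y y : mT).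
Proof.
apply: measurable_sum => i.
by apply: measurable_funM; exact: row_measurable_coord.
Qed.

Lemma row_measurable_enorm n : row_measurable (fun y : 'rV[R]_n => enorm y : mT).
Proof. exact: (measurableT_comp (continuous_measurable_fun (@sqrt_continuous R)) (@row_measurable_dot n)). Qed.

(** A layer-cake formula with weight [W]. It is used with the exponential weight and [q = dot y y]
    for the Gaussian, and with the weight [2 r] on the unit interval and [q = enorm y] for the
    second moment. *)
Lemma row_int_layer n (q : 'rV[R]_n -> mT) (W : mT -> R) :
  row_measurable q -> measurable_fun setT W -> (forall s, 0 <= W s) ->
  row_int (fun y => \int[leb]_s (W s * (q y <= s :> R)%R%:R)%:E)%E =
  (\int[leb]_s ((W s)%:E * row_int (fun y => chi (q y <= s :> R)%R)))%E.
Proof.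
move=> mq mW W0.
pose H (z : (mT * n.-tuple mT)%type) :=
  (W z.1 * (q (row_of_tuple z.2) <= z.1 :> R)%R%:R)%:E.
have mH : measurable_fun setT H.
  apply/measurable_EFinP; apply: measurable_funM.
    exact: measurableT_comp.
  apply: measurable_natr_bool; apply: measurable_fun_ler => //.
  exact: (measurableT_comp mq).
have H0 z : (0 <= H z)%E by rewrite lee_fin mulr_ge0.
have := fubini_tonelli (m1 := leb) (m2 := @lebesgue_Rn R n) _ mH H0.
rewrite -[RHS]/(row_int (fun y => \int[leb]_s (W s * (q y <= s :> R)%R%:R)%:E)%E).
move=> <-; apply: eq_integral => s _; rewrite /fubini_F /row_int -ge0_integralZl//=.
  by apply: measurable_chi; exact: measurable_fun_ler.
  by move=> t _; exact: chi_ge0.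
by rewrite lee_fin.
Qed.

Lemma row_measurable_layer n (q : 'rV[R]_n -> mT) (W : mT -> R) :
  row_measurable q -> measurable_fun setT W -> (forall s, 0 <= W s) ->
  row_measurable (fun y => \int[leb]_s (W s * (q y <= s :> R)%R%:R)%:E)%E.
Proof.
move=> mq mW W0; apply: (measurable_fun_fubini_tonelli_G (m1 := leb)
  (fun z : (mT * n.-tuple mT)%type =>
    (W z.1 * (q (row_of_tuple z.2) <= z.1 :> R)%R%:R)%:E)).
  apply/measurable_EFinP; apply: measurable_funM.
    exact: measurableT_comp.
  apply: measurable_natr_bool; apply: measurable_fun_ler => //.
  exact: (measurableT_comp mq).
by move=> z; rewrite lee_fin mulr_ge0.
Qed.

Lemma measurable_row_int_sublevel n (q : 'rV[R]_n -> mT) : row_measurable q ->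
  measurable_fun setT (fun s : mT => row_int (fun y => chi (q y <= s :> R))).
Proof.
move=> mq; apply: (measurable_fun_fubini_tonelli_F (m2 := @lebesgue_Rn R n)
  (fun z : (mT * n.-tuple mT)%type => chi (q (row_of_tuple z.2) <= z.1 :> R))).
  apply: measurable_chi; apply: measurable_fun_ler => //.
  exact: (measurableT_comp mq).
by move=> z; exact: chi_ge0.
Qed.

Definition unit_ball_measure n := row_int (fun y : 'rV[R]_n => chi (enorm y <= 1)).

Lemma row_measurable_ball n (e : R) :
  row_measurable (fun y : 'rV[R]_n => chi (enorm y <= e)).
Proof.
apply: measurable_chi; apply: measurable_fun_ler => //.
exact: row_measurable_enorm.
Qed.

Lemma row_int_dilation n (G : 'rV[R]_n -> \bar R) (e : R) : 0 < e ->
  row_measurable G -> (forall y, 0 <= G y)%E ->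
  row_int G = ((e ^+ n)%:E * row_int (fun y => G (e *: y)))%E.
Proof.
move=> e0 mG G0; have ue : (e%:M : 'M[R]_n) \in unitmx.
  by rewrite unitmxE det_scalar unitfE expf_neq0// gt_eqF.
have := substitution_unit ue 0 mG G0.
rewrite (_ : (fun y => _) = fun y => G (e *: y)); last first.
  by apply/funext => y; rewrite addr0 mul_mx_scalar.
move=> ->; rewrite det_scalar muleA -EFinM gtr0_norm ?exprn_gt0//.
by rewrite mulfV ?mul1e// expf_neq0// gt_eqF.
Qed.

Lemma ball_measure n (e : R) : 0 < e ->
  row_int (fun y : 'rV[R]_n => chi (enorm y <= e)) =
  ((e ^+ n)%:E * unit_ball_measure n)%E.
Proof.
move=> e0; rewrite (row_int_dilation e0 (@row_measurable_ball n e))//; last by move=> y; exact: chi_ge0.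
congr (_ * _)%E; congr row_int; apply/funext => y.
by rewrite enormZ gtr0_norm// ger_pMr.
Qed.

Lemma row_int_gauss n :
  row_int (fun y : 'rV[R]_n => (expR (- dot y y))%:E) = ((Num.sqrt pi) ^+ n)%:E.
Proof.
have mG m : row_measurable (fun y : 'rV[R]_m => (expR (- dot y y))%:E).
  apply/measurable_EFinP; apply: measurableT_comp => //.
  by apply: measurable_funN; exact: row_measurable_dot.
elim: n => [|n IH].
  by rewrite row_int0// ?big_ord0 /dot ?big_ord0 ?oppr0 ?expR0// => y; rewrite lee_fin expR_ge0.
have G0 m (y : 'rV[R]_m) : (0 <= (expR (- dot y y))%:E)%E by rewrite lee_fin expR_ge0.
rewrite (@row_intS R n _ (mG n.+1) (G0 n.+1)).
under eq_integral => x _.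
  rewrite (_ : (fun y => _) = fun y : 'rV_n =>
      ((expR (- x ^+ 2))%:E * (expR (- dot y y))%:E)%E); last first.
    apply/funext => y; rewrite -EFinM -expRD; congr (expR _)%:E.
    rewrite -opprD; congr (- _).
    transitivity (dot (x%:M : 'M[R]_1) x%:M + dot y y); first
      exact: (dot_row_mx (x%:M : 'M[R]_1) x%:M y y).
    by congr (_ + _); rewrite /dot big_ord1 mxE eqxx -expr2.
  rewrite (row_intZl (mG n) (G0 n)) ?expR_ge0//.
  rewrite IH; over.
rewrite ge0_integralZr//; first by rewrite integralT_gauss exprS EFinM.
by apply/measurable_EFinP; exact: measurable_gauss_fun.
Qed.

(** Shifting the variable by [c] factors out [expR (- c)], since the exponential law is memoryless,
    and leaves its total mass one. *)
Lemma integral_exp_tail (c : R) : 0 <= c ->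
  (\int[leb]_s (exponential_pdf 1 s * (c <= s :> R)%R%:R)%:E = (expR (- c))%:E)%E.
Proof.
move=> c0.
have m1 : measurable_fun setT
    (fun s : mT => (exponential_pdf 1 s * (c <= s :> R)%R%:R)%:E).
  apply/measurable_EFinP; apply: measurable_funM.
    exact: measurable_exponential_pdf.
  by apply: measurable_natr_bool; exact: measurable_fun_ler.
have p0 s : (0 <= (exponential_pdf 1 s * (c <= s :> R)%R%:R)%:E)%E.
  by rewrite lee_fin mulr_ge0// exponential_pdf_ge0.
have := integral_affine c (oner_neq0 R) m1 p0.
rewrite normr1 invr1 mul1e => <-.
transitivity (\int[leb]_s ((expR (- c))%:E * (exponential_pdf 1 s)%:E))%E.
  apply: eq_integral => s _; rewrite -EFinM; congr EFin; rewrite mul1r lerDr.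
  have [s0|s0] := leP 0 s; last by rewrite mulr0 lt0_exponential_pdf ?mulr0.
  rewrite !exponential_pdfE ?addr_ge0// mulr1 !mul1r -expRD; congr expR.
  by rewrite !mulN1r opprD addrC.
rewrite ge0_integralZl//.
- by rewrite integral_exponential_pdf// mule1.
- by apply/measurable_EFinP; exact: measurable_exponential_pdf.
- by move=> s _; rewrite lee_fin exponential_pdf_ge0.
Qed.
End BallVolume.

Section BallMoments.
Variable R : realType.
Local Notation mT := (measurableTypeR R).
Local Notation leb := (@lebesgue_measure R).
Local Notation chi := (ereal_of_bool R).

Lemma sqrt_exprn (s : R) n : 0 <= s -> Num.sqrt s ^+ n = s `^ (n%:R / 2).
Proof.
by move=> s0; rewrite -powR12_sqrt// -powR_mulrn ?powR_ge0// -powRrM mulrC.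
Qed.

(** Sliced by layers, the Gaussian integral reads [Num.sqrt pi ^+ n = I * w], where [I] is the Gamma
    integral at [n / 2 + 1] and [w] the unknown measure. The left side is positive and finite, which
    forces both factors to be so and then gives [w] by division. *)
Lemma unit_ball_measure_gt0 n :
  exists2 v : R, 0 < v & unit_ball_measure R n = v%:E /\ v = ball_volume n (1 : R).
Proof.
set w := unit_ball_measure R n.
pose I := (\int[leb]_(s in `]0%R, +oo[) (s `^ (n%:R / 2) * expR (- s))%:E)%E.
have mI : measurable_fun setT (fun s : mT => (s `^ (n%:R / 2) * expR (- s))%:E).
  apply/measurable_EFinP; apply: measurable_funM; first exact: measurable_powR.
  by apply: measurableT_comp => //; exact: measurable_funN.
have w0 : (0 <= w)%E by apply: row_int_ge0 => y; exact: chi_ge0.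
have I0 : (0 <= I)%E.
  by apply: integral_ge0 => s _; rewrite lee_fin mulr_ge0 ?powR_ge0 ?expR_ge0.
pose q (y : 'rV[R]_n) : mT := dot y y.
have mq : row_measurable q by exact: row_measurable_dot.
pose g s := ((exponential_pdf 1 s)%:E * row_int (fun y => chi (q y <= s)%R))%E.
(* The sublevel set of [dot] at [s > 0] is the ball of radius [Num.sqrt s], whose measure is [w]
   times the power [n / 2] of [s]; negative [s] have zero exponential density. *)
have key : ((Num.sqrt pi ^+ n)%:E = I * w)%E.
  have pi0 (s : R) : 0 <= exponential_pdf 1 s by exact: exponential_pdf_ge0.
  have := row_int_layer mq (measurable_exponential_pdf 1) pi0.
  rewrite (_ : (fun y => _) = fun y : 'rV[R]_n => (expR (- dot y y))%:E); last first.
    by apply/funext => y; rewrite integral_exp_tail ?dot_ge0.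
  rewrite row_int_gauss => ->.
  have g_neg s : s < 0 -> g s = 0%E.
    by move=> s0; rewrite /g lt0_exponential_pdf// mul0e.
  have mg : measurable_fun setT (g : mT -> _).
    apply: emeasurable_funM; last exact: measurable_row_int_sublevel.
    by apply/measurable_EFinP; exact: measurable_exponential_pdf.
  transitivity (\int[leb]_(s in `[0%R, +oo[) g s)%E.
    rewrite [RHS]integral_mkcond; apply: eq_integral => s _; rewrite patchE.
    case: ifPn => //; rewrite notin_setE/= in_itv/= andbT => /negP.
    by rewrite -ltNge => /g_neg.
  rewrite -integral_itv_obnd_cbnd; last exact: measurable_funTS.
  rewrite -ge0_integralZr//; last 2 first.
  - exact: measurable_funTS.
  - by move=> s _; rewrite lee_fin mulr_ge0 ?powR_ge0 ?expR_ge0.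
  apply: eq_integral => s; rewrite inE/= in_itv/= andbT => s0.
  rewrite /g exponential_pdfE ?ltW// mul1r mulN1r.
  rewrite (_ : (fun y => _) = fun y : 'rV[R]_n => chi (enorm y <= Num.sqrt s)).
    rewrite ball_measure ?sqrtr_gt0// muleA -EFinM -/w; congr (_%:E * _)%E.
    by rewrite sqrt_exprn ?ltW// mulrC.
  by apply/funext => y; rewrite enorm_le ?sqrtr_ge0// sqr_sqrtr ?(ltW s0).
have sp0 : 0 < Num.sqrt pi ^+ n :> R by rewrite exprn_gt0// sqrtr_gt0 pi_gt0.
(* An infinite factor would make the product zero or infinite, against [key]; the same argument
   follows for [I]. *)
have [v wE] : exists v, w = v%:E.
  case: w w0 key => [v| |//] _; [by exists v|].
  have [->|I1] := eqVneq I 0%E; first by rewrite mul0e => -[] /eqP; rewrite gt_eqF.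
  by rewrite gt0_muley// lt_neqAle eq_sym I1.
have [i IE] : exists i, I = i%:E.
  case: I I0 key => [i| |//] _; [by exists i|].
  have [->|w1] := eqVneq w 0%E; first by rewrite mule0 => -[] /eqP; rewrite gt_eqF.
  by rewrite gt0_mulye// lt_neqAle eq_sym w1.
move: key; rewrite wE IE -EFinM => -[key].
have v_ge0 : 0 <= v by rewrite -lee_fin -wE.
have v0 : 0 < v.
  rewrite lt_neqAle v_ge0 andbT eq_sym; apply: contraTneq sp0 => v0.
  by rewrite key v0 mulr0 ltxx.
exists v => //; split=> //; rewrite /ball_volume expr1n mulr1.
(* The exponent [x - 1] in [Gamma], taken at [n / 2 + 1], is exactly the power [n / 2] produced by
   the layers. *)
rewrite (_ : Gamma _ = i); last first.
  rewrite /Gamma /Rintegral addrK -[RHS]/(fine i%:E) -IE /I.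
  by [].
have i0 : i != 0 by apply: contraTneq sp0 => i0; rewrite key i0 mul0r ltxx.
apply: (mulfI i0); rewrite -key mulrCA mulfV// mulr1.
by rewrite sqrt_exprn ?pi_ge0.
Qed.

Lemma unit_ball_measureE n : unit_ball_measure R n = (ball_volume n (1 : R))%:E.
Proof. by have [v _ [-> ->]] := unit_ball_measure_gt0 n. Qed.

Lemma ball_volume_gt0 n : 0 < ball_volume n (1 : R).
Proof. by have [v v0 [_ <-]] := unit_ball_measure_gt0 n. Qed.

Lemma ball_volumeE n (e : R) : ball_volume n e = e ^+ n * ball_volume n (1 : R).
Proof. by rewrite /ball_volume expr1n mulr1 [_ * e ^+ n]mulrC mulrA. Qed.

Lemma integral_monomial k (a : R) : 0 <= a ->
  (\int[leb]_r (k.+1%:R * r ^+ k * ((a <= r) && (r <= 1))%R%:R)%:E =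
   (if (a <= 1)%R then 1 - a ^+ k.+1 else 0)%:E)%E.
Proof.
move=> a0; transitivity (\int[leb]_(r in `[a, 1%R]) (k.+1%:R * r ^+ k)%:E)%E.
  rewrite [RHS]integral_mkcond; apply: eq_integral => r _; rewrite patchE.
  case: ifPn; first by rewrite inE/= in_itv/= => ->; rewrite mulr1.
  by rewrite notin_setE/= in_itv/= => /negP/negbTE ->; rewrite mulr0.
have [a1|a1|->] := ltgtP a 1.
- rewrite (continuous_FTC2 (F := fun r => r ^+ k.+1))//.
  + by rewrite expr1n -EFinB.
  + apply: continuous_subspaceT => x; apply: cvgM; first exact: cvg_cst.
    exact: exprn_continuous.
  + split=> [x _||].
    * exact: exprn_derivable.
    * by apply: cvg_at_right_filter; exact: exprn_continuous.
    * by apply: cvg_at_left_filter; exact: exprn_continuous.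
  + by move=> x _; rewrite exp_derive1.
- by rewrite set_itv_ge ?integral_set0// bnd_simp -ltNge.
- by rewrite set_itv1 integral_set1 expr1n subrr.
Qed.

(** The weight [2 r] on the part of the unit interval above [enorm y] integrates to [1 - dot y y].
    By layers, the integral [J] of that function over the ball is [2 / (n + 2)] of the ball volume,
    and the second moment [K] is the complement. *)
Lemma ball_second_moment n :
  row_int (fun y : 'rV[R]_n => (dot y y)%:E * chi (enorm y <= 1)%R)%E =
  (n%:R / (n%:R + 2) * ball_volume n (1 : R))%:E.
Proof.
pose W (r : mT) : R := 2 * r * ((0 <= r) && (r <= 1))%R%:R.
have mW : measurable_fun setT W.
  apply: measurable_funM; first exact: measurable_funM.
  by apply: measurable_natr_bool; apply: measurable_and; exact: measurable_fun_ler.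
have W0 r : 0 <= W r.
  rewrite /W; case: (leP 0 r) => r0; last by rewrite mulr0.
  by rewrite mulr_ge0// mulr_ge0.
have := row_int_layer (@row_measurable_enorm R n) mW W0.
have n2 : (n%:R + 2 : R) != 0 by rewrite -natrD pnatr_eq0 addn2.
rewrite (_ : (\int[leb]_s _ = (2 / (n%:R + 2) * ball_volume n (1 : R))%:E)%E); last first.
  rewrite mulrC EFinM.
  have := @integral_monomial n.+1 0 (lexx _); rewrite ler01 exprS mul0r subr0 => m1.
  transitivity (\int[leb]_r ((ball_volume n (1 : R) * (2 / (n%:R + 2)))%:E *
     (n.+2%:R * r ^+ n.+1 * ((0 <= r) && (r <= 1))%R%:R)%:E))%E.
    apply: eq_integral => r _; rewrite /W.
    have [r0|r0|<-] := ltgtP 0 r.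
    - rewrite ball_measure// unit_ball_measureE -!EFinM; congr EFin.
      by rewrite (_ : n.+2%:R = n%:R + 2) -?natrD ?addn2// exprS; field.
    - by rewrite mulr0 mul0e !mulr0 mule0.
    - by rewrite mulr0 mul0r mul0e expr0n/= mulr0 mul0r mule0.
  rewrite ge0_integralZl//.
  - by rewrite m1 mule1.
  - apply/measurable_EFinP; apply: measurable_funM.
      by apply: measurable_funM => //; exact: measurable_funX.
    by apply: measurable_natr_bool; apply: measurable_and; exact: measurable_fun_ler.
  - move=> r _; rewrite lee_fin; case: (leP 0 r) => r0; last by rewrite mulr0.
    by rewrite mulr_ge0// mulr_ge0// exprn_ge0.
  - by rewrite lee_fin mulr_ge0 ?(ltW (ball_volume_gt0 _))// divr_ge0 ?addr_ge0.
set J := row_int _ => JE; set K := row_int _.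
have KJ : (K + J = unit_ball_measure R n)%E.
  rewrite /K /J /row_int -ge0_integralD//=.
  - apply: eq_integral => t _; set y := row_of_tuple t.
    rewrite (_ : (\int[leb]_s _ = ((1 - dot y y) * (enorm y <= 1)%R%:R)%:E)%E); last first.
      transitivity (\int[leb]_r (2%:R * r ^+ 1 * ((enorm y <= r) && (r <= 1))%R%:R)%:E)%E.
        apply: eq_integral => r _; congr EFin; rewrite /W expr1 -mulrA; congr (_ * _).
        rewrite -natrM mulnb andbAC; congr (_%:R); congr (nat_of_bool (_ && _)).
        have [er|] := boolP (enorm y <= r); last by rewrite andbF.
        by rewrite andbT (le_trans _ er) ?enorm_ge0.
      rewrite integral_monomial ?enorm_ge0// enorm_sqr.
      by case: ifP => _; rewrite ?mulr1 ?mulr0.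
    by rewrite /ereal_of_bool -EFinM -EFinD; congr EFin; ring.
  - by move=> t _; rewrite mule_ge0 ?chi_ge0// lee_fin dot_ge0.
  - apply: emeasurable_funM; first by apply/measurable_EFinP; exact: row_measurable_dot.
    exact: row_measurable_ball.
  - by move=> t _; apply: integral_ge0 => s _; rewrite lee_fin mulr_ge0.
  - exact: row_measurable_layer (@row_measurable_enorm R n) mW W0.
move: KJ; rewrite JE unit_ball_measureE.
case: K => [k| |//]; last by [].
rewrite -EFinD => -[] kE; congr EFin.
have -> : n%:R / (n%:R + 2) * ball_volume n 1 =
    ball_volume n 1 - 2 / (n%:R + 2) * ball_volume n 1 :> R by field.
by rewrite -[X in X - _]kE addrK.
Qed.
End BallMoments.

(** * Inner products, diagonalization, projections, determinants *)

Section EuclideanGeometry.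
Variable R : realType.

Lemma dotC m (u v : 'rV[R]_m) : dot u v = dot v u.
Proof. by apply: eq_bigr => i _; rewrite mulrC. Qed.

Lemma dotDl m (u v w : 'rV[R]_m) : dot (u + v) w = dot u w + dot v w.
Proof. by rewrite !dotE mulmxDl mxE. Qed.

Lemma dotDr m (u v w : 'rV[R]_m) : dot u (v + w) = dot u v + dot u w.
Proof. by rewrite dotC dotDl !(dotC u). Qed.

Lemma dotZl m c (u v : 'rV[R]_m) : dot (c *: u) v = c * dot u v.
Proof. by rewrite !dotE -scalemxAl mxE. Qed.

Lemma dotZr m c (u v : 'rV[R]_m) : dot u (c *: v) = c * dot u v.
Proof. by rewrite dotC dotZl dotC. Qed.

Lemma dotNl m (u v : 'rV[R]_m) : dot (- u) v = - dot u v.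
Proof. by rewrite -scaleN1r dotZl mulN1r. Qed.

Lemma dotBl m (u v w : 'rV[R]_m) : dot (u - v) w = dot u w - dot v w.
Proof. by rewrite dotDl dotNl. Qed.

Lemma dot0l m (u : 'rV[R]_m) : dot 0 u = 0.
Proof. by rewrite dotE mul0mx mxE. Qed.

Lemma dot_mxl m n (u : 'rV[R]_m) (A : 'M[R]_(m, n)) v :
  dot (u *m A) v = dot u (v *m A^T).
Proof. by rewrite !dotE trmx_mul trmxK mulmxA. Qed.

Lemma dot_eq0 m (u : 'rV[R]_m) : dot u u = 0 -> u = 0.
Proof.
move/eqP; rewrite psumr_eq0; last by move=> i _; rewrite -expr2 sqr_ge0.
move=> /allP u0; apply/rowP => i; rewrite mxE; apply/eqP.
by have := u0 i; rewrite mem_index_enum mulf_eq0 orbb => /(_ isT).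
Qed.

Lemma dot_gt0 m (u : 'rV[R]_m) : u != 0 -> 0 < dot u u.
Proof.
move=> u0; rewrite lt_neqAle dot_ge0 andbT eq_sym; apply: contra_neq u0.
exact: dot_eq0.
Qed.

(** The reflection along [h - e] exchanges [e] and [h]; when the two coincide the identity does. It
    splits off an eigenvector in the spectral theorem and later turns a direction into the first
    axis. *)
Lemma householder n (h : 'rV[R]_n.+1) : dot h h = 1 ->
  exists A : 'M[R]_n.+1, A *m A^T = 1%:M /\ row 0 A = h.
Proof.
move=> h1; pose e : 'rV[R]_n.+1 := delta_mx 0 0.
have ee : dot e e = 1 by rewrite dotE trmx_delta mul_delta_mx mxE !eqxx.
have he : dot h e = h 0 0.
  by rewrite /dot (bigD1 0)//= big1 ?mxE ?eqxx ?mulr1 ?addr0// => i /negbTE i0; rewrite mxE i0 andbF mulr0.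
have [->|hne] := eqVneq h e.
  by exists 1%:M; rewrite trmx1 mulmx1; split=> //; rewrite rowE mulmx1.
have [w wE] : {w | w = h - e} by exists (h - e).
have w0 : w != 0 by rewrite wE subr_eq0.
pose s := dot w w; have s0 : s != 0 by rewrite gt_eqF// dot_gt0.
have sE : s = 2 * (1 - h 0 0).
  by rewrite /s wE dotBl !(dotC _ (h - e)) !dotBl h1 ee (dotC e h) he; ring.
pose A : 'M[R]_n.+1 := 1%:M - (2 / s) *: (w^T *m w).
have At : A^T = A.
  by rewrite /A linearB linearZ /= trmx1 trmx_mul trmxK.
have ww : w *m w^T = s%:M by rewrite [LHS]mx11_scalar -dotE.
exists A; split.
  rewrite At /A mulmxBl mul1mx mulmxBr mulmx1 -scalemxAl -scalemxAr scalerA.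
  rewrite mulmxA -(mulmxA _ w) ww mul_mx_scalar -scalemxAl scalerA.
  rewrite (_ : 2 / s * (2 / s) * s = 2 / s + 2 / s); last by field.
  by rewrite scalerDl; set X := _ *: _; rewrite opprB addrK subrK.
rewrite rowE /A mulmxBr mulmx1 -scalemxAr mulmxA -/e.
have -> : e *m w^T = (- (s / 2))%:M.
  rewrite [LHS]mx11_scalar -dotE dotC wE dotBl he ee; congr (_%:M).
  by rewrite sE; field.
rewrite mul_scalar_mx scalerA (_ : 2 / s * - (s / 2) = -1); last by field.
by rewrite scaleN1r opprK wE addrC subrK.
Qed.
End EuclideanGeometry.

(** * Spectral theorem for real symmetric matrices *)

Section Spectral.
Variable R : realType.

Lemma continuous_sumr (T : topologicalType) I (r : seq I) (P : pred I)
    (f : I -> T -> R) x :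
  (forall i, P i -> {for x, continuous (f i)}) ->
  {for x, continuous (fun y => \sum_(i <- r | P i) f i y)}.
Proof. by move=> fl; apply: cvg_big => //; exact: add_continuous. Qed.

Lemma continuous_prodr (T : topologicalType) I (r : seq I) (P : pred I)
    (f : I -> T -> R) x :
  (forall i, P i -> {for x, continuous (f i)}) ->
  {for x, continuous (fun y => \prod_(i <- r | P i) f i y)}.
Proof. by move=> fl; apply: cvg_big => //; exact: mul_continuous. Qed.

Lemma mulmx_coord_continuous m n (A : 'M[R]_(m, n)) i :
  continuous (fun y : 'rV[R]_m => (y *m A) 0 i).
Proof.
move=> y; rewrite (_ : (fun y => _) = fun y : 'rV[R]_m => \sum_j y 0 j * A j i).
  apply: continuous_sumr => j _.
  exact: (cvgM (@coord_continuous _ _ _ 0 j y) (cvg_cst _)).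
by apply/funext => z; rewrite mxE.
Qed.

Lemma quadratic_continuous n (S : 'M[R]_n) :
  continuous (fun y : 'rV[R]_n => dot (y *m S) y).
Proof.
move=> y; rewrite /dot; apply: continuous_sumr => i _.
exact: (cvgM (@mulmx_coord_continuous _ _ S i y) (@coord_continuous _ _ _ 0 i y)).
Qed.

Lemma dot_continuous n : continuous (fun y : 'rV[R]_n => dot y y).
Proof.
move=> y; have := @quadratic_continuous n 1%:M y.
by rewrite (_ : (fun y => _) = fun y : 'rV[R]_n => dot y y) ?mulmx1//;
  apply/funext => z; rewrite mulmx1.
Qed.

Lemma coord_le_norm m n (A : 'M[R]_(m, n)) i j : `|A i j| <= `|A|.
Proof.
rewrite [leRHS]/Num.norm /= mx_normrE.
exact: (le_bigmax _ (fun ij : 'I_m * 'I_n => `|A ij.1 ij.2|) (i, j)).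
Qed.

Lemma norm_le_coord m n (A : 'M[R]_(m, n)) e : 0 <= e ->
  (forall i j, `|A i j| <= e) -> `|A| <= e.
Proof.
move=> e0 Ae; rewrite [leLHS]/Num.norm /= mx_normrE.
by apply: bigmax_le => // -[i j] _.
Qed.

Lemma coord_le_enorm n (y : 'rV[R]_n) i : `|y 0 i| <= enorm y.
Proof.
rewrite -(sqrtr_sqr (y 0 i)) ler_wsqrtr// /dot (bigD1 i)//= -expr2 lerDl.
by apply: sumr_ge0 => j _; rewrite -expr2 sqr_ge0.
Qed.

Lemma norm_le_enorm n (y : 'rV[R]_n) : `|y| <= enorm y.
Proof.
apply: norm_le_coord; first exact: enorm_ge0.
by move=> i j; rewrite (ord1 i) coord_le_enorm.
Qed.

Lemma unit_sphere_compact n : compact [set y : 'rV[R]_n | dot y y = 1].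
Proof.
apply: bounded_closed_compact.
  exists 1; split => // x x1 y /= y1; rewrite (le_trans (norm_le_enorm _))//.
  by rewrite /enorm y1 sqrtr1 ltW.
rewrite (_ : mkset _ = (fun y : 'rV[R]_n => dot y y) @^-1` [set 1])//.
by apply: preimage_closed => // y _; exact: dot_continuous.
Qed.

(** The eigenvector is a maximiser of the quadratic form on the unit sphere. With [l] the maximum,
    [l%:M - S] is positive semidefinite and its form vanishes at [h], which forces [h] into its
    kernel. *)
Lemma symmetric_eigenvector n (S : 'M[R]_n.+1) : S^T = S ->
  exists (h : 'rV[R]_n.+1) l, dot h h = 1 /\ h *m S = l *: h.
Proof.
move=> Ssym; have ne : [set y : 'rV[R]_n.+1 | dot y y = 1] !=set0.
  exists (delta_mx 0 0); rewrite /= dotE trmx_delta mul_delta_mx mxE.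
  by rewrite !eqxx.
have cq : {within [set y : 'rV[R]_n.+1 | dot y y = 1],
    continuous (fun y : 'rV[R]_n.+1 => dot (y *m S) y)}.
  by apply: continuous_subspaceT => y; exact: quadratic_continuous.
have [h] := EVT_max_rV ne (@unit_sphere_compact n.+1) cq.
rewrite inE /= => h1 hmax; exists h, (dot (h *m S) h); split=> //.
set l := dot (h *m S) h.
pose B := l%:M - S; have Bsym : B^T = B by rewrite linearB /= tr_scalar_mx Ssym.
have dB w : dot (w *m B) w = l * dot w w - dot (w *m S) w.
  by rewrite mulmxBr mul_mx_scalar dotBl dotZl.
have B_ge0 w : 0 <= dot (w *m B) w.
  rewrite dB subr_ge0; have [->|w0] := eqVneq w 0.
    by rewrite mul0mx !dot0l mulr0.
  have ww0 := dot_gt0 w0; pose c := (Num.sqrt (dot w w))^-1.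
  have c2 : c * c = (dot w w)^-1 by rewrite -expr2 exprVn sqr_sqrtr ?ltW.
  have := hmax (c *: w); rewrite inE /= dotZl dotZr mulrA c2 mulVf ?gt_eqF//.
  by move=> /(_ erefl); rewrite -scalemxAl dotZl dotZr mulrA c2 mulrC ler_pdivrMr.
have hB0 : dot (h *m B) h = 0 by rewrite dB h1 mulr1 subrr.
suff : h *m B = 0 by move/eqP; rewrite mulmxBr mul_mx_scalar subr_eq0 => /eqP.
set b := h *m B; pose c := dot (b *m B) b; have c0 : 0 <= c by exact: B_ge0.
apply: dot_eq0; apply/eqP; rewrite eq_le dot_ge0 andbT leNgt; apply/negP => b0.
(* h minimises w |-> w B w^T, but moving from h along -b decreases it *)
pose t := dot b b / (c + 1).
have := B_ge0 (h - t *: b).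
have -> : dot ((h - t *: b) *m B) (h - t *: b) = t ^+ 2 * c - 2 * t * dot b b.
  rewrite mulmxBl -/b -scalemxAl dotBl dotZl !(dotC _ (h - t *: b)) !dotBl !dotZl.
  rewrite (dotC h b) hB0 (dotC h (b *m B)) (dot_mxl b B h) Bsym -/b.
  by rewrite (dotC b (b *m B)) -/c; ring.
have c1 : 0 < c + 1 by rewrite ltr_wpDl.
have -> : t ^+ 2 * c - 2 * t * dot b b = - (dot b b ^+ 2 * ((c + 2) / (c + 1) ^+ 2)).
  by rewrite /t; field; rewrite gt_eqF.
rewrite oppr_ge0 leNgt => /negP; apply; rewrite mulr_gt0 ?exprn_gt0//.
by rewrite divr_gt0 ?exprn_gt0// ltr_wpDl.
Qed.

(** After a rotation whose first row is an eigenvector, the first row of the matrix is diagonal;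
    symmetry clears the first column too, and the induction applies to the remaining block. *)
Lemma symmetric_diagonalization n (S : 'M[R]_n) : S^T = S ->
  exists (Q : 'M[R]_n) d, Q *m Q^T = 1%:M /\ Q *m S *m Q^T = diag_mx d.
Proof.
elim: n S => [|n IH] S Ssym.
  by exists 1%:M, 0; split; apply/matrixP => -[].
have [h [l [h1 hS]]] := symmetric_eigenvector Ssym.
have [H [HH H0]] := householder h1.
have [S' S'E] : {S' : 'M[R]_(1 + n) | S' = H *m S *m H^T} by exists (H *m S *m H^T).
have S'sym : S'^T = S' by rewrite S'E !trmx_mul trmxK Ssym mulmxA.
have S'0 : row 0 S' = l *: delta_mx 0 0.
  by rewrite S'E !row_mul H0 hS -scalemxAl -H0 -row_mul HH row1.
have S'ur : ursubmx S' = 0.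
  apply/matrixP => i j; rewrite [RHS]mxE [LHS]mxE [LHS]mxE (ord1 i).
  rewrite (_ : lshift n 0 = 0); last exact: val_inj.
  have := congr1 (fun v : 'rV_(1 + n) => v 0 (rshift 1 j)) S'0.
  by rewrite [in LHS]mxE => ->; rewrite !mxE mulr0.
have S'dl : dlsubmx S' = 0 by rewrite -[S']S'sym -trmx_ursub S'ur trmx0.
have [|Q2 [d2 [QQ2 QS2]]] := IH (drsubmx S').
  by rewrite trmx_drsub S'sym.
pose B : 'M[R]_(1 + n) := block_mx (1%:M : 'M[R]_1) 0 0 Q2.
have BB : B *m B^T = 1%:M.
  rewrite /B tr_block_mx !trmx0 trmx1 mulmx_block.
  by rewrite !(mul1mx, mulmx0, mul0mx, addr0, add0r) QQ2 -scalar_mx_block.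
have BS : B *m S' *m B^T = diag_mx (row_mx (ulsubmx S') d2).
  rewrite -[in LHS](submxK S') S'ur S'dl /B tr_block_mx !trmx0 trmx1 !mulmx_block.
  rewrite !(mul1mx, mulmx1, mulmx0, mul0mx, addr0, add0r) QS2.
  rewrite diag_mx_row; congr block_mx.
  by apply/matrixP => i j; rewrite !ord1 [RHS]mxE eqxx mulr1n.
exists (B *m H), (row_mx (ulsubmx S') d2); split.
  by rewrite trmx_mul mulmxA -(mulmxA B) HH mulmx1.
rewrite trmx_mul !mulmxA -(mulmxA B) -(mulmxA B) mulmxA -(mulmxA B) -S'E.
exact: BS.
Qed.
End Spectral.

Section Projection.
Variables (R : realType) (m : nat).
Implicit Types (V : {vspace 'rV[R]_m}).

(** Uniqueness makes the choice in [oproj] computable: the difference of two candidates lies in [V]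
    and is orthogonal to [V], hence to itself. *)
Lemma oprojP V q w : w \in V -> orthocomp V (q - w) -> oproj V q = w.
Proof.
move=> wV qw; rewrite /oproj.
have : [set w | w \in V /\ orthocomp V (q - w)] w by [].
move=> /(getI (P := [set w | w \in V /\ orthocomp V (q - w)])) [w'V qw'].
set w' := get _ in w'V qw' *; apply/eqP; rewrite -subr_eq0; apply/eqP/dot_eq0.
have dV : w' - w \in V by rewrite rpredB.
rewrite -[X in dot X _](_ : (q - w) - (q - w') = _); last first.
  by rewrite opprB addrC subrKA.
by rewrite dotBl (qw _ dV) (qw' _ dV) subrr.
Qed.

Lemma gram_unit d (B : 'M[R]_(d, m)) : row_free B -> B *m B^T \in unitmx.
Proof.
move=> freeB; rewrite unitmxE unitfE; apply/det0P => -[v v0 vB].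
have : v *m B = 0 by apply: dot_eq0; rewrite dot_mxl -mulmxA vB dotC dot0l.
by move=> /eqP; rewrite mulmx_free_eq0// (negbTE v0).
Qed.

Lemma vspace_row_base V : exists2 B : 'M[R]_(\dim V, m), row_free B &
  forall v, v \in V <-> exists c, v = c *m B.
Proof.
pose B : 'M[R]_(\dim V, m) := \matrix_i (vbasis V)`_i.
have cB (c : 'rV_(\dim V)) : c *m B = \sum_i c 0 i *: (vbasis V)`_i.
  by rewrite mulmx_sum_row; apply: eq_bigr => i _; rewrite rowK.
exists B.
  rewrite -kermx_eq0; apply/rowV0P => c /sub_kermxP; rewrite cB => c0.
  apply/rowP => i; rewrite mxE.
  by have /freeP := basis_free (vbasisP V); apply.
move=> v; split=> [vV|[c ->]].
  exists (\row_i coord (vbasis V) i v); rewrite cB {1}(coord_vbasis vV).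
  by apply: eq_bigr => i _; rewrite mxE.
rewrite cB; apply: memv_suml => i _; apply/memvZ/vbasis_mem/mem_nth.
by rewrite size_tuple.
Qed.

(** For a row basis [B] of [V] the matrix is the Gram formula [B^T *m invmx (B *m B^T) *m B], acting
    from the right. *)
Lemma oproj_mx V : exists2 P : 'M[R]_m, P^T = P &
  forall q, [/\ oproj V q = q *m P, q *m P \in V & orthocomp V (q - q *m P)].
Proof.
have [B freeB VB] := vspace_row_base V.
have uBB := gram_unit freeB.
exists (B^T *m invmx (B *m B^T) *m B).
  by rewrite !trmx_mul trmxK trmx_inv trmx_mul trmxK mulmxA.
move=> q; set P := _ *m B.
have qPV : q *m P \in V by apply/VB; exists (q *m (B^T *m invmx (B *m B^T))); rewrite -mulmxA.
have qP : orthocomp V (q - q *m P).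
  move=> w /VB[c ->]; rewrite dotC dot_mxl mulmxBl /P -!mulmxA mulVmx//.
  by rewrite mulmx1 subrr dotC dot0l.
by split=> //; exact: oprojP.
Qed.

Lemma oproj_sub_ortho V v : orthocomp V v -> oproj V v = 0.
Proof. by move=> Vv; apply: oprojP; [exact: mem0v|rewrite subr0]. Qed.

End Projection.

(** * Determinant and square root near the identity, to first order *)

Section DetPerturbation.
Variable R : realType.

(** A new factor is at most 2 and so at most doubles the old error, while its product with the
    partial sum costs [size r] times [b ^+ 2]; a factor 4 per step covers both. *)
Lemma prod_perturbation I (r : seq I) (x : I -> R) (b : R) :
  0 <= b <= 1 -> (forall i, `|x i| <= b) ->
  `|\prod_(i <- r) (1 + x i) - 1 - \sum_(i <- r) x i| <= (4 ^ size r)%:R * b ^+ 2.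
Proof.
move=> /andP[b0 b1] xb; elim: r => [|i r IH].
  by rewrite !big_nil subrr subr0 normr0 mulr_ge0 ?sqr_ge0.
have sb : `|\sum_(i <- r) x i| <= (size r)%:R * b.
  rewrite -sum1_size natr_sum mulr_suml (le_trans (ler_norm_sum _ _ _))//.
  by apply: ler_sum => j _; rewrite mul1r.
rewrite !big_cons; set P := \prod_(_ <- _) _ in IH *; set S := \sum_(_ <- _) _ in IH sb *.
rewrite (_ : _ - _ = (1 + x i) * (P - 1 - S) + x i * S); last by ring.
have x1 : `|1 + x i| <= 2.
  by rewrite (le_trans (ler_normD _ _))// normr1 lerD2l (le_trans (xb i)).
rewrite (le_trans (ler_normD _ _))// !normrM.
rewrite (le_trans (lerD (ler_pM _ _ x1 IH) (ler_pM _ _ (xb i) sb)))//.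
rewrite mulrA -natrM [b * _]mulrCA -expr2 -mulrDl -natrD ler_wpM2r ?sqr_ge0//.
rewrite ler_nat expnS -[X in (_ <= X * _)%N]/(2 + 2)%N mulnDl leq_add2l.
rewrite (leq_trans (ltnW (ltn_expl (size r) (isT : 1 < 4)%N)))//.
by rewrite leq_pmull.
Qed.

(** In the Leibniz formula the identity permutation gives the product just estimated. Any other
    permutation moves some [i] and also [s i], so two factors are off-diagonal and at most [b], the
    others being at most 2. *)
Lemma det_perturbation n : exists2 C : R, 0 <= C &
  forall (G : 'M[R]_n) b, 0 <= b <= 1 -> (forall i j, `|G i j| <= b) ->
  `|\det (1%:M + G) - 1 - \tr G| <= C * b ^+ 2.
Proof.
pose K : R := (4 ^ n)%:R + \sum_(s : {perm 'I_n} | s != 1%g) 2 ^+ n.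
exists K; first by rewrite addr_ge0// sumr_ge0// => s _; rewrite exprn_ge0.
move=> G b b01 Gb; have /andP[b0 b1] := b01.
rewrite /determinant (bigD1 1%g)//= odd_perm1 expr0 mul1r.
rewrite (eq_bigr (fun i => 1 + G i i)); last first.
  by move=> i _; rewrite !mxE perm1 eqxx.
set D := \prod_i _; set X := \sum_(s | _) _.
rewrite (_ : _ - _ = (D - 1 - \sum_i G i i) + X); last by rewrite /mxtrace; ring.
rewrite (le_trans (ler_normD _ _))// /K mulrDl lerD//.
  have := prod_perturbation (index_enum 'I_n) b01 (fun i => Gb i i).
  by rewrite [in size _]/index_enum -enumT size_enum_ord.
rewrite mulr_suml (le_trans (ler_norm_sum _ _ _))//; apply: ler_sum => s s1.
rewrite normrM normrX normrN1 expr1n mul1r normr_prod.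
have [i si] : exists i, s i != i.
  apply/existsP; apply: contraR s1 => /existsPn sid; apply/eqP/permP => i.
  by rewrite perm1; apply/eqP; rewrite -[_ == _]negbK sid.
have ssi : s i != s (s i) by rewrite (inj_eq perm_inj) eq_sym.
have offd k : s k != k -> `|(1%:M + G) k (s k)| <= b.
  by move=> sk; rewrite !mxE eq_sym (negbTE sk) add0r.
rewrite (bigD1 i)//= (bigD1 (s i))//= mulrA [leRHS]mulrC expr2.
apply: ler_pM; rewrite ?mulr_ge0 ?prodr_ge0//.
  by apply: ler_pM => //; apply: offd => //; rewrite eq_sym.
have -> : (2 : R) ^+ n = \prod_(k : 'I_n) 2.
  by rewrite prodr_const card_ord.
rewrite [leRHS](bigD1 i)//= [X in _ * X](bigD1 (s i))//= mulrA.
rewrite -[leLHS]mul1r ler_pM ?prodr_ge0//; first by rewrite -natrM ler1n.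
apply: ler_prod => k _; rewrite normr_ge0/= !mxE.
rewrite (le_trans (ler_normD _ _))// -[2]/(1 + 1) lerD//; last exact: le_trans (Gb _ _) b1.
by case: (_ == _); rewrite ?normr1// normr0.
Qed.

(** With [s] the root, the error is exactly [-(s - 1)^2 / 2], while [x = (s - 1)(s + 1)] with
    [s + 1 >= 1]. *)
Lemma sqrt_perturbation (x : R) : -1 <= x -> `|Num.sqrt (1 + x) - 1 - x / 2| <= x ^+ 2.
Proof.
move=> x1; have x10 : 0 <= 1 + x by lra.
set s := Num.sqrt _; have s0 : 0 <= s by exact: sqrtr_ge0.
have s2 : s ^+ 2 = 1 + x by rewrite sqr_sqrtr.
have xE : x = (s - 1) * (s + 1) by rewrite -[LHS](addKr 1) -s2; ring.
rewrite (_ : _ - _ = - ((s - 1) ^+ 2 / 2)); last by rewrite xE; field.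
rewrite normrN ger0_norm ?divr_ge0 ?sqr_ge0// xE exprMn.
have : 0 <= (s - 1) ^+ 2 by exact: sqr_ge0.
have : 1 <= (s + 1) ^+ 2 by rewrite expr_ge1//; lra.
by nra.
Qed.

End DetPerturbation.

(** * Calculus near the origin *)

Section LineCalculus.
Variables (R : realType) (V : normedModType R).
Implicit Types (g : V -> R) (x u v : V) (D : set V).

Lemma is_derive_lineP g x v t d :
  is_derive t (1 : R) (fun s : R => g (x + s *: v)) d <-> is_derive (x + t *: v) v g d.
Proof.
have E : (fun h : R => h^-1 *: (((fun s : R => g (x + s *: v)) \o shift t) (h *: 1) -
      g (x + t *: v))) =
    (fun h : R => h^-1 *: ((g \o shift (x + t *: v)) (h *: v) - g (x + t *: v))).
  apply/funext => h /=; congr (_ *: (g _ - _)).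
  by rewrite [h *: 1]mulr1 scalerDl addrCA.
split=> -[dg dgE]; split.
- by move: dg; rewrite /derivable E.
- by move: dgE; rewrite /derive E.
- by rewrite /derivable E.
- by rewrite /derive E.
Qed.

Lemma is_derive_line g x v t : derivable g (x + t *: v) v ->
  is_derive t (1 : R) (fun s : R => g (x + s *: v)) ('D_v g (x + t *: v)).
Proof. by move=> dg; apply/is_derive_lineP; exact: derivableP. Qed.

Lemma is_derive_line_scale g x v s t : derivable g (x + (t * s) *: v) v ->
  is_derive t (1 : R) (fun t : R => g (x + (t * s) *: v))
    (s * 'D_v g (x + (t * s) *: v)).
Proof.
move=> /is_derive_line dg.
have ds : is_derive t (1 : R) (fun t : R => t * s) s.
  by apply: is_derive_eq; rewrite scaler0 add0r [_%:A]mulr1.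
have := @is_derive1_comp R (fun s : R => g (x + s *: v)) (fun t => t * s) t _ _ dg ds.
by rewrite mulrC.
Qed.

Lemma MVT01 (L dL : R -> R) :
  (forall t : R, 0 <= t <= 1 -> is_derive t 1 L (dL t)) ->
  exists2 t, 0 <= t <= 1 & L 1 - L 0 = dL t.
Proof.
move=> LdL; have [||c c01] := @MVT_segment R L dL 0 1 ler01.
- by move=> t t01; apply: LdL; rewrite !ltW ?(itvP t01).
- apply: derivable_within_continuous => t t01.
  by have [] : is_derive t 1 L _ := LdL t t01.
by rewrite subr0 mulr1 => cE; exists c => //; rewrite !(itvP c01).
Qed.

Lemma MVT_line g x v (s : R) :
  (forall t, 0 <= t <= 1 -> derivable g (x + (t * s) *: v) v) ->
  exists2 t, 0 <= t <= 1 &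
    g (x + s *: v) - g x = s * 'D_v g (x + (t * s) *: v).
Proof.
move=> dg; have [t t01|t t01] := MVT01 (L := fun t => g (x + (t * s) *: v))
    (dL := fun t => s * 'D_v g (x + (t * s) *: v)).
  by apply: is_derive_line_scale; exact: dg.
by rewrite mul1r mul0r scale0r addr0 => tE; exists t.
Qed.

(** Two parallel segments are treated with one and the same intermediate parameter; this is the
    first of the two mean-value steps on the mixed second difference in [schwarz]. *)
Lemma MVT_line2 g x x' v (s : R) :
  (forall t, 0 <= t <= 1 -> derivable g (x + (t * s) *: v) v) ->
  (forall t, 0 <= t <= 1 -> derivable g (x' + (t * s) *: v) v) ->
  exists2 t, 0 <= t <= 1 &
    (g (x + s *: v) - g (x' + s *: v)) - (g x - g x') =
    s * ('D_v g (x + (t * s) *: v) - 'D_v g (x' + (t * s) *: v)).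
Proof.
move=> dg dg'; have [t t01|t t01] := MVT01
    (L := fun t => g (x + (t * s) *: v) - g (x' + (t * s) *: v))
    (dL := fun t => s * 'D_v g (x + (t * s) *: v) - s * 'D_v g (x' + (t * s) *: v)).
  by apply: is_deriveB; apply: is_derive_line_scale; [exact: dg|exact: dg'].
by rewrite !mul1r !mul0r !scale0r !addr0 -mulrBr => tE; exists t.
Qed.

Lemma is_derive_dirZ g x v c : derivable g x v -> is_derive x (c *: v) g (c * 'D_v g x).
Proof.
move=> dg; rewrite -[X in is_derive X](addr0 x) -[X in _ + X](scale0r (c *: v)).
apply/is_derive_lineP.
have dg0 : derivable g (x + (0 * c) *: v) v by rewrite mul0r scale0r addr0.
have := is_derive_line_scale dg0; rewrite mul0r scale0r addr0.
by under eq_fun do rewrite -scalerA.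
Qed.

(** Directional derivatives need not be additive in the direction; continuity of ['D_v g] at [x]
    makes them so. The step along [u + v] is split into one along [u], handled by definition, and
    one along [v], handled by the mean value theorem. *)
Lemma is_derive_dirD g x u v : derivable g x u ->
  (\forall z \near x, derivable g z v) -> {for x, continuous ('D_v g)} ->
  is_derive x (u + v) g ('D_u g x + 'D_v g x).
Proof.
move=> du dv cv.
suff H : (fun h : R => h^-1 *: ((g \o shift x) (h *: (u + v)) - g x)) @ 0^' -->
    'D_u g x + 'D_v g x.
  by split; [apply/cvg_ex; eexists; exact: H|exact: cvg_lim].
have -> : (fun h : R => h^-1 *: ((g \o shift x) (h *: (u + v)) - g x)) =
    (fun h : R => h^-1 *: ((g \o shift x) (h *: u) - g x)) +
    (fun h : R => h^-1 *: (g (x + h *: u + h *: v) - g (x + h *: u))).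
  apply/funext => h; rewrite [RHS]/=.
  rewrite -[RHS]/(h^-1 *: (g (h *: u + x) - g x) +
     h^-1 *: (g (x + h *: u + h *: v) - g (x + h *: u))) -scalerDr.
  congr (_ *: _); rewrite /= scalerDr (addrC (h *: u) x) -(addrA x).
  by rewrite (addrC x (_ + _)); ring.
apply: cvgD; first exact: du.
have [e e0 ve] : exists2 e : R, 0 < e & forall z, `|x - z| < e -> derivable g z v.
  by move/nbhs_ballP : dv => [e e0 ve]; exists e => // z xz; apply: ve; rewrite -ball_normE.
apply/cvgrPdist_le => /= eps eps0.
have /cvgrPdist_le/(_ _ eps0)/nbhs_ballP[e' e'0 ve'] := cv.
have N0 : 0 < `|u| + `|v| + 1 by rewrite ltr_wpDl ?addr_ge0.
near=> h.
have small t : 0 <= t <= 1 -> `|x - (x + h *: u + (t * h) *: v)| < Num.min e e'.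
  move=> /andP[t0 t1].
  rewrite -addrA opprD addrA subrr add0r normrN (le_lt_trans (ler_normD _ _))//.
  rewrite !normrZ (ger0_norm t0).
  rewrite (@le_lt_trans _ _ (`|h| * (`|u| + `|v| + 1)))//.
    rewrite !mulrDr mulr1 -addrA lerD2l ler_wpDr//.
    by rewrite -mulrA ler_piMl ?mulr_ge0.
  rewrite -ltr_pdivlMr//; near: h; apply: dnbhs0_lt.
  by rewrite divr_gt0// lt_min e0.
have [t t01|t t01 ->] := @MVT_line g (x + h *: u) v h.
  by apply: ve; have := small t t01; rewrite lt_min => /andP[].
have h0 : h != 0 by near: h; exact: nbhs_dnbhs_neq.
rewrite [_ *: _]mulrA mulVf// mul1r; apply: ve'.
by rewrite -ball_normE /=; have := small t t01; rewrite lt_min => /andP[].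
Unshelve. all: by end_near. Qed.

End LineCalculus.

Section SmoothFunctions.
Variables (R : realType).

Lemma Ck_eq (X Y : normedModType R) j (D : set X) (f g : X -> Y) : open D ->
  (forall x, D x -> f x = g x) -> Ck j D f -> Ck j D g.
Proof.
move=> oD; elim: j f g => [|j IH] f g fg /= [cf Hf]; have nfg x : D x ->
    \near x, f x = g x by move=> Dx; near do apply: fg; exact: open_nbhs_nbhs.
- split=> // x Dx; rewrite -[{for _, _}]/(g z @[z --> x] --> g x) -fg//.
  by apply: cvg_trans (cf x Dx); apply: near_eq_cvg; exact: nfg.
- split=> [x Dx|v].
    rewrite -[{for _, _}]/(g z @[z --> x] --> g x) -fg//.
    by apply: cvg_trans (cf x Dx); apply: near_eq_cvg; exact: nfg.
  have [df Cf] := Hf v; split=> [x Dx|].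
    exact: near_eq_derivable (nfg x Dx) (df x Dx).
  by apply: IH Cf => x Dx; exact: near_eq_derive (nfg x Dx).
Unshelve. all: by end_near. Qed.

Lemma smooth_continuous (X Y : normedModType R) (D : set X) (f : X -> Y) x :
  smooth_on D f -> D x -> {for x, continuous f}.
Proof. by move=> /(_ 0%N) [cf _]; exact: cf. Qed.

Lemma smooth_derivable (X Y : normedModType R) (D : set X) (f : X -> Y) x v :
  smooth_on D f -> D x -> derivable f x v.
Proof. by move=> /(_ 1%N) [_ /(_ v) [df _]]; exact: df. Qed.

Lemma smooth_derive (X Y : normedModType R) (D : set X) (f : X -> Y) v :
  smooth_on D f -> smooth_on D ('D_v f).
Proof. by move=> sf j; have [_ /(_ v) []] := sf j.+1. Qed.

Lemma smooth_coord (X : normedModType R) m n (D : set X) (f : X -> 'M[R]_(m, n)) i a :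
  open D -> smooth_on D f -> smooth_on D (fun x => f x i a).
Proof.
move=> oD sf j; elim: j f sf => [|j IH] f sf /=; split=> //.
- move=> x Dx; exact: (continuous_comp (smooth_continuous sf Dx)
    (@coord_continuous _ _ _ i a (f x))).
- move=> x Dx; exact: (continuous_comp (smooth_continuous sf Dx)
    (@coord_continuous _ _ _ i a (f x))).
- move=> v; split=> [x Dx|].
    by have /derivable_mxP := smooth_derivable (v := v) sf Dx; apply.
  apply: (Ck_eq oD _ (IH _ (smooth_derive v sf))) => x Dx.
  by rewrite derive_mx ?mxE//; exact: smooth_derivable sf Dx.
Qed.

Lemma derive_coord (X : normedModType R) m n (f : X -> 'M[R]_(m, n)) x v i j :
  derivable f x v -> 'D_v (fun z => f z i j) x = 'D_v f x i j.
Proof. by move=> df; rewrite derive_mx// mxE. Qed.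

Section Scalar.
Variables (X : normedModType R) (D : set X).
Hypothesis oD : open D.
Implicit Types g : X -> R.

Lemma smooth_deriveZ g x v c : smooth_on D g -> D x ->
  'D_(c *: v) g x = c * 'D_v g x.
Proof.
by move=> sg Dx; have [_] := is_derive_dirZ c (smooth_derivable (v := v) sg Dx).
Qed.

Lemma smooth_deriveD g x u v : smooth_on D g -> D x ->
  'D_(u + v) g x = 'D_u g x + 'D_v g x.
Proof.
move=> sg Dx; have dv : \forall z \near x, derivable g z v.
  near=> z; apply: smooth_derivable sg _; near: z; exact: open_nbhs_nbhs.
by have [_ ->] := is_derive_dirD (smooth_derivable (v := u) sg Dx) dv
  (smooth_continuous (smooth_derive v sg) Dx).
Unshelve. all: by end_near. Qed.

(** The second difference over the parallelogram spanned by [h a] and [h b] is symmetric in [a] and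
    [b]. Divided by [h ^+ 2] it tends to either mixed derivative, by two mean-value steps and
    continuity. *)
Lemma schwarz g x u v : smooth_on D g -> D x ->
  'D_u ('D_v g) x = 'D_v ('D_u g) x.
Proof.
move=> sg Dx.
have half a b eps : 0 < eps -> \forall h \near (0:R)^',
   `|'D_a ('D_b g) x - h^-1 * (h^-1 * (g (x + h *: a + h *: b) - g (x + h *: a) -
       (g (x + h *: b) - g x)))| <= eps.
  move=> eps0.
  have [e e0 De] : exists2 e : R, 0 < e & forall z, `|x - z| < e -> D z.
    have /nbhs_ballP[e e0 De] := open_nbhs_nbhs (conj oD Dx).
    by exists e => // z xz; apply: De; rewrite -ball_normE.
  have := smooth_continuous (smooth_derive a (smooth_derive b sg)) Dx.
  move=> /cvgrPdist_le/(_ _ eps0)/nbhs_ballP[e' e'0 ve'].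
  have N0 : 0 < `|a| + `|b| + 1 by rewrite ltr_wpDl ?addr_ge0.
  near=> h.
  have small s t : 0 <= s <= 1 -> 0 <= t <= 1 ->
      `|x - (x + (s * h) *: a + (t * h) *: b)| < Num.min e e'.
    move=> /andP[s0 s1] /andP[t0 t1].
    rewrite -addrA opprD addrA subrr add0r normrN (le_lt_trans (ler_normD _ _))//.
    rewrite !normrZ (ger0_norm t0) (ger0_norm s0).
    rewrite (@le_lt_trans _ _ (`|h| * (`|a| + `|b| + 1)))//.
      rewrite !mulrDr mulr1 ler_wpDr// lerD// -mulrA ler_piMl ?mulr_ge0//.
    rewrite -ltr_pdivlMr//; near: h; apply: dnbhs0_lt.
    by rewrite divr_gt0// lt_min e0.
  have inD s t : 0 <= s <= 1 -> 0 <= t <= 1 ->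
      D (x + (s * h) *: a + (t * h) *: b).
    by move=> s01 t01; apply: De; have := small s t s01 t01; rewrite lt_min => /andP[].
  have h0 : h != 0 by near: h; exact: nbhs_dnbhs_neq.
  have I1 : 0 <= (1:R) <= 1 by rewrite ler01 lexx.
  have I0 : 0 <= (0:R) <= 1 by rewrite ler01 lexx.
  have [t t01|t t01|t t01] := @MVT_line2 R X g (x + h *: a) x b h.
  - have := inD 1 t I1 t01; rewrite mul1r; exact: smooth_derivable.
  - have := inD 0 t I0 t01; rewrite mul0r scale0r addr0; exact: smooth_derivable.
  move=> kE; have [s s01|s s01 lE] := @MVT_line R X ('D_b g) (x + (t * h) *: b) a h.
    have := inD s t s01 t01; rewrite addrAC.
    exact: smooth_derivable (smooth_derive b sg).
  rewrite (addrAC x (h *: a) ((t * h) *: b)) lE in kE.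
  rewrite (_ : _ - _ - _ = h * (h * 'D_a ('D_b g) (x + (t * h) *: b + (s * h) *: a))).
    rewrite !mulKf//; apply: ve'; rewrite -ball_normE /= addrAC.
    by have := small s t s01 t01; rewrite lt_min => /andP[].
  by rewrite -kE; ring.
have close a b eps : 0 < eps -> `|'D_a ('D_b g) x - 'D_b ('D_a g) x| <= eps + eps.
  move=> eps0; near (0:R)^' => h.
  have Ha : `|'D_a ('D_b g) x - h^-1 * (h^-1 * (g (x + h *: a + h *: b) -
      g (x + h *: a) - (g (x + h *: b) - g x)))| <= eps by near: h; exact: half.
  have Hb : `|'D_b ('D_a g) x - h^-1 * (h^-1 * (g (x + h *: b + h *: a) -
      g (x + h *: b) - (g (x + h *: a) - g x)))| <= eps by near: h; exact: half.
  rewrite (addrAC x (h *: b) (h *: a)) in Hb.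
  rewrite (_ : _ - _ - (g (x + h *: a) - g x) = g (x + h *: a + h *: b) -
      g (x + h *: a) - (g (x + h *: b) - g x)) in Hb; last by ring.
  rewrite distrC in Hb.
  by rewrite (le_trans (ler_distD _ _ _) (lerD Ha Hb)).
apply/eqP; rewrite -subr_eq0 -normr_le0; apply/ler_addgt0Pr => e e0.
by rewrite add0r (splitr e) close// divr_gt0.
Unshelve. all: by end_near. Qed.
End Scalar.
End SmoothFunctions.

(** * Taylor estimates at the origin with explicit constants *)

Section TaylorBounds.
Variables (R : realType) (n : nat).
Local Notation X := 'rV[R]_n.
Implicit Types (g h : X -> R) (D : set X).

(** The norm is the sup norm of row vectors; bounds pass to the Euclidean norm through
    [norm_le_enorm]. *)
Definition bigO_at0 (p : nat) h := exists K r, [/\ 0 <= K, 0 < r &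
  forall y, `|y| < r -> `|h y| <= K * `|y| ^+ p].

Lemma bigO_at0_eq p h h' : (forall y, h y = h' y) -> bigO_at0 p h -> bigO_at0 p h'.
Proof. by move=> hh' [K [r [K0 r0 hK]]]; exists K, r; split=> // y; rewrite -hh'; exact: hK. Qed.

Lemma bigO_at0D p g h : bigO_at0 p g -> bigO_at0 p h -> bigO_at0 p (fun y => g y + h y).
Proof.
move=> [K [r [K0 r0 gK]]] [L [s [L0 s0 hL]]].
exists (K + L), (Num.min r s); split; rewrite ?addr_ge0 ?lt_min ?r0//.
move=> y; rewrite lt_min => /andP[yr ys].
by rewrite mulrDl (le_trans (ler_normD _ _))// lerD ?gK ?hL.
Qed.

Lemma bigO_at0_0 p : bigO_at0 p (fun=> 0).
Proof. by exists 0, 1; split=> // y _; rewrite normr0 mul0r. Qed.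

Lemma bigO_at0_sum p I (s : seq I) (h : I -> X -> R) :
  (forall i, bigO_at0 p (h i)) -> bigO_at0 p (fun y => \sum_(i <- s) h i y).
Proof.
move=> hO; elim: s => [|i s IH].
  by apply: bigO_at0_eq (bigO_at0_0 p) => y; rewrite big_nil.
by apply: bigO_at0_eq (bigO_at0D (hO i) IH) => y; rewrite big_cons.
Qed.

Lemma bigO_at0M p q g h : bigO_at0 p g -> bigO_at0 q h -> bigO_at0 (p + q) (fun y => g y * h y).
Proof.
move=> [K [r [K0 r0 gK]]] [L [s [L0 s0 hL]]].
exists (K * L), (Num.min r s); split; rewrite ?mulr_ge0 ?lt_min ?r0//.
move=> y; rewrite lt_min => /andP[yr ys].
by rewrite normrM exprD mulrACA ler_pM ?gK ?hL.
Qed.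

Lemma bigO_at0_le p q h : (p <= q)%N -> bigO_at0 q h -> bigO_at0 p h.
Proof.
move=> pq [K [r [K0 r0 hK]]]; exists K, (Num.min r 1).
split; rewrite ?lt_min ?r0//= => y; rewrite lt_min => /andP[yr y1].
by rewrite (le_trans (hK y yr))// ler_wpM2l// ler_wiXn2l// ltW.
Qed.

Lemma bigO_at0_continuous h : {for 0, continuous h} -> bigO_at0 0 h.
Proof.
move=> /cvgrPdist_le/(_ 1 ltr01)/nbhs_ballP[r r0 hr].
exists (`|h 0| + 1), r; split=> //.
move=> y yr; have := hr y; rewrite -ball_normE /= sub0r normrN => /(_ yr) h1.
rewrite expr0 mulr1 -[h y](subKr (h 0)) (le_trans (ler_normB _ _))//.
by rewrite lerD2l.
Qed.

Lemma bigO_at0_coord j : bigO_at0 1 (fun y : X => y 0 j).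
Proof. by exists 1, 1; split=> // y _; rewrite mul1r expr1 coord_le_norm. Qed.

Lemma bigO_at0N p h : bigO_at0 p h -> bigO_at0 p (fun y => h (- y)).
Proof.
by move=> [K [r [K0 r0 hK]]]; exists K, r; split=> // y yr; rewrite -(normrN y) hK ?normrN.
Qed.

Lemma bigO_at0Z p c h : bigO_at0 p h -> bigO_at0 p (fun y => c * h y).
Proof.
move=> [K [r [K0 r0 hK]]]; exists (`|c| * K), r; split; rewrite ?mulr_ge0//.
by move=> y yr; rewrite normrM -mulrA ler_wpM2l ?hK.
Qed.

(** The hypothesis on [g] is the shape that the mean value theorem gives along the segment from 0 to
    [y]; each use gains one order, and all the Taylor estimates below are obtained this way. *)
Lemma bigO_at0_segment p g (h : 'I_n -> X -> R) r : 0 < r ->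
  (forall y, `|y| < r -> exists2 t, 0 <= t <= 1 &
     g y = \sum_j y 0 j * h j (t *: y)) ->
  (forall j, bigO_at0 p (h j)) -> bigO_at0 p.+1 g.
Proof.
move=> r0 gE hO.
have [K [s [K0 s0 hK]]] : exists K s, [/\ 0 <= K, 0 < s &
    forall j y, `|y| < s -> `|h j y| <= K * `|y| ^+ p].
  suff : exists K s, [/\ 0 <= K, 0 < s &
    forall j y, j \in enum 'I_n -> `|y| < s -> `|h j y| <= K * `|y| ^+ p].
    by move=> [K [s [K0 s0 hK]]]; exists K, s; split=> // j y; apply: hK; rewrite mem_enum.
  elim: (enum 'I_n) => [|i l [K [s [K0 s0 hK]]]]; first by exists 0, 1.
  have [L [u [L0 u0 hL]]] := hO i.
  exists (K + L), (Num.min s u); split; rewrite ?addr_ge0 ?lt_min ?s0//.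
  move=> j y; rewrite inE lt_min => /orP[/eqP ->|jl] /andP[ys yu].
    by rewrite (le_trans (hL y yu))// ler_wpM2r ?exprn_ge0// lerDr.
  by rewrite (le_trans (hK j y jl ys))// ler_wpM2r ?exprn_ge0// lerDl.
exists (n%:R * K), (Num.min r s); split; rewrite ?mulr_ge0 ?lt_min ?r0//.
move=> y; rewrite lt_min => /andP[yr ys]; have [t /andP[t0 t1] ->] := gE y yr.
rewrite (le_trans (ler_norm_sum _ _ _))//.
have ty : `|t *: y| <= `|y| by rewrite normrZ ger0_norm// ler_piMl.
apply: (@le_trans _ _ (\sum_(j < n) K * `|y| ^+ p.+1)).
  apply: ler_sum => j _; rewrite normrM exprS mulrCA ler_pM ?coord_le_norm//.
  rewrite (le_trans (hK j _ (le_lt_trans ty ys)))// ler_wpM2l// lerXn2r ?nnegrE//.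
by rewrite sumr_const card_ord -mulrA mulr_natl.
Qed.

Section Smooth.
Variable D : set X.
Hypotheses (oD : open D) (D0 : D 0).

Lemma open_ball0 : exists2 r : R, 0 < r & forall y, `|y| < r -> D y.
Proof.
have /nbhs_ballP[e e0 De] := open_nbhs_nbhs (conj oD D0).
by exists e => // y ye; apply: De; rewrite -ball_normE /= sub0r normrN.
Qed.

Lemma derive_sum_coord g x v : smooth_on D g -> D x ->
  'D_v g x = \sum_j v 0 j * 'D_(coord_vec R j) g x.
Proof.
move=> sg Dx; rewrite [v in LHS]row_sum_delta.
elim/big_rec2: _ => [|j a b _ <-]; first by rewrite derive0.
by rewrite (smooth_deriveD oD)// (smooth_deriveZ _ _ sg).
Qed.

Lemma taylor1 g : smooth_on D g -> bigO_at0 1 (fun y => g y - g 0).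
Proof.
move=> sg; have [r r0 Dr] := open_ball0.
apply: (@bigO_at0_segment 0 _ (fun j => 'D_(coord_vec R j) g) r r0).
  move=> y yr.
  have Dt t : 0 <= t <= 1 -> D (t *: y).
    move=> /andP[t0 t1]; apply: Dr; rewrite normrZ ger0_norm//.
    by rewrite (le_lt_trans _ yr)// ler_piMl.
  have [t t01|t t01] := @MVT_line R X g 0 y 1.
    by rewrite add0r mulr1; apply: smooth_derivable sg (Dt t t01).
  rewrite !add0r scale1r mul1r mulr1 => ->; exists t => //.
  exact: derive_sum_coord sg (Dt t t01).
move=> j; apply: bigO_at0_continuous.
exact: smooth_continuous (smooth_derive _ sg) D0.
Qed.

Lemma taylor2 g : smooth_on D g -> g 0 = 0 ->
  (forall j, 'D_(coord_vec R j) g 0 = 0) -> bigO_at0 2 g.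
Proof.
move=> sg g0 dg0; have [r r0 Dr] := open_ball0.
apply: (@bigO_at0_segment 1 _ (fun j => 'D_(coord_vec R j) g) r r0).
  move=> y yr.
  have Dt t : 0 <= t <= 1 -> D (t *: y).
    move=> /andP[t0 t1]; apply: Dr; rewrite normrZ ger0_norm//.
    by rewrite (le_lt_trans _ yr)// ler_piMl.
  have [t t01|t t01] := @MVT_line R X g 0 y 1.
    by rewrite add0r mulr1; apply: smooth_derivable sg (Dt t t01).
  rewrite !add0r scale1r mul1r mulr1 g0 subr0 => ->; exists t => //.
  exact: derive_sum_coord sg (Dt t t01).
move=> j; apply: bigO_at0_eq (taylor1 (smooth_derive (coord_vec R j) sg)) => y.
by rewrite dg0 subr0.
Qed.

Lemma is_derive_ray g (y : X) (t c : R) : smooth_on D g -> D ((t * c) *: y) ->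
  is_derive t (1 : R) (fun t : R => g ((t * c) *: y)) (c * 'D_y g ((t * c) *: y)).
Proof.
move=> sg Dt; have := @is_derive_line_scale R X g 0 y c t.
rewrite add0r => /(_ (smooth_derivable sg Dt)).
by under eq_fun do rewrite add0r.
Qed.

(** Along the ray, the derivative of [g (t y) + g (- t y)] pairs [y] with the odd parts of the
    partial derivatives, which are of order 1. *)
Lemma taylor_even g : smooth_on D g ->
  bigO_at0 2 (fun y => g y + g (- y) - 2 * g 0).
Proof.
move=> sg; have [r r0 Dr] := open_ball0.
pose h j y := 'D_(coord_vec R j) g y - 'D_(coord_vec R j) g (- y).
apply: (@bigO_at0_segment 1 _ h r r0).
  move=> y yr.
  have Dt t : 0 <= t <= 1 -> D ((t * 1) *: y) /\ D ((t * -1) *: y).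
    move=> /andP[t0 t1]; split; apply: Dr; rewrite normrZ normrM ?normrN1 ?normr1 mulr1 ger0_norm//;
    by rewrite (le_lt_trans _ yr)// ler_piMl.
  have [t t01|t t01] := @MVT01 R (fun t => g ((t * 1) *: y) + g ((t * -1) *: y))
      (fun t => 1 * 'D_y g ((t * 1) *: y) + -1 * 'D_y g ((t * -1) *: y)).
    by have [D1 D2] := Dt t t01; apply: is_deriveD; exact: is_derive_ray.
  have [D1 D2] := Dt t t01; rewrite mulr1 in D1; rewrite mulrN1 in D2.
  rewrite !mul1r !mul0r !scale0r scale1r !mulr1 !mulrN1 scaleN1r !mulN1r.
  move=> gE; exists t => //; rewrite mulr2n mulrDl !mul1r gE.
  rewrite !(derive_sum_coord _ sg) // -sumrB; apply: eq_bigr => j _.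
  by rewrite /h -mulrBr scaleNr.
move=> j; have T1 := taylor1 (smooth_derive (coord_vec R j) sg).
by apply: bigO_at0_eq (bigO_at0D T1 (bigO_at0Z (-1) (bigO_at0N T1))) => y; rewrite /h; ring.
Qed.

(** Here the derivative along the ray involves the even parts of the partial derivatives. By
    [taylor_even] they are constant up to order 2, so the error jumps to order 3 without second
    derivatives appearing. *)
Lemma taylor_odd g : smooth_on D g ->
  bigO_at0 3 (fun y => g y - g (- y) - 2 * \sum_j y 0 j * 'D_(coord_vec R j) g 0).
Proof.
move=> sg; have [r r0 Dr] := open_ball0.
pose h j y := 'D_(coord_vec R j) g y + 'D_(coord_vec R j) g (- y)
   - 2 * 'D_(coord_vec R j) g 0.
apply: (@bigO_at0_segment 2 _ h r r0); last first.
  by move=> j; exact: taylor_even (smooth_derive _ sg).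
move=> y yr.
have Dt t : 0 <= t <= 1 -> D ((t * 1) *: y) /\ D ((t * -1) *: y).
  move=> /andP[t0 t1]; split; apply: Dr; rewrite normrZ normrM ?normrN1 ?normr1 mulr1 ger0_norm//;
  by rewrite (le_lt_trans _ yr)// ler_piMl.
have [t t01|t t01] := @MVT01 R (fun t => g ((t * 1) *: y) - g ((t * -1) *: y))
    (fun t => 1 * 'D_y g ((t * 1) *: y) - -1 * 'D_y g ((t * -1) *: y)).
  by have [D1 D2] := Dt t t01; apply: is_deriveB; exact: is_derive_ray.
have [D1 D2] := Dt t t01; rewrite mulr1 in D1; rewrite mulrN1 in D2.
rewrite !mul1r !mul0r !scale0r scale1r !mulr1 !mulrN1 scaleN1r !mulN1r subrr subr0 opprK.
move=> gE; exists t => //; rewrite gE.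
rewrite !(derive_sum_coord _ sg) // mulr_sumr -big_split -sumrB.
by apply: eq_bigr => j _; rewrite /h scaleNr /=; ring.
Qed.

End Smooth.
End TaylorBounds.

Section MatrixCalculus.
Variable R : realType.

Lemma near_eq_continuous (S S' : topologicalType) (g h : S -> S') x :
  (\forall z \near x, h z = g z) -> {for x, continuous g} -> {for x, continuous h}.
Proof.
move=> hg cg; rewrite /prop_for /continuous_at (nbhs_singleton hg).
by apply: cvg_trans cg; apply: near_eq_cvg; apply: filterS hg => z.
Qed.

Lemma continuous_mx (S : topologicalType) m n (h : S -> 'M[R]_(m, n)) x :
  (forall i j, {for x, continuous (fun z => h z i j)}) -> {for x, continuous h}.
Proof.
move=> ch A [P hP PA]; rewrite /nbhs /=.
apply: (filterS (P := fun z => forall i j, P i j (h z i j))); first by move=> z; exact: PA.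
apply: filter_forall => i; apply: filter_forall => j.
exact: ch (hP i j).
Qed.

Lemma continuous_det (S : topologicalType) n (h : S -> 'M[R]_n) x :
  (forall i j, {for x, continuous (fun z => h z i j)}) ->
  {for x, continuous (fun z => \det (h z))}.
Proof.
move=> ch; apply: continuous_sumr => s _.
apply: (cvgM (cvg_cst _)).
exact: continuous_prodr.
Qed.

Lemma continuous_invmx (S : topologicalType) n (h : S -> 'M[R]_n) x i j :
  (forall i j, {for x, continuous (fun z => h z i j)}) -> h x \in unitmx ->
  {for x, continuous (fun z => invmx (h z) i j)}.
Proof.
move=> ch ux; have d0 : \det (h x) != 0 by rewrite -unitfE -unitmxE.
have cd := continuous_det ch.
have ca : {for x, continuous (fun z => (\adj (h z)) i j)}.
  rewrite (_ : (fun z => _) = fun z => (-1) ^+ (j + i) *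
      \det (row' j (col' i (h z)))); last by apply/funext => z; rewrite mxE.
  have c' : {for x, continuous (fun z => \det (row' j (col' i (h z))))}.
    apply: continuous_det => i' j'.
    rewrite (_ : (fun z => _) = fun z => h z (lift j i') (lift i j'))//.
    by apply/funext => z; rewrite !mxE.
  exact: (cvgM (cvg_cst _) c').
have E : invmx (h x) i j = (\det (h x))^-1 * \adj (h x) i j.
  by rewrite /invmx ux mxE.
rewrite -[{for _, _}]/(invmx (h z) i j @[z --> x] --> invmx (h x) i j) E.
apply: cvg_trans (cvgM (cvgV d0 cd) ca); apply: near_eq_cvg.
near=> z; rewrite /= /invmx unitmxE unitfE ifT ?mxE//.
by near: z; apply: (cvgr_neq0 _ cd d0).
Unshelve. all: by end_near. Qed.

Lemma is_derive_mulmx (X : normedModType R) m n (h : X -> 'rV[R]_m)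
    (A : 'M[R]_(m, n)) x v d :
  is_derive x v h d -> is_derive x v (fun z => h z *m A) (d *m A).
Proof.
move=> [dh <-].
have H : (fun t : R => t^-1 *: (((fun z => h z *m A) \o shift x) (t *: v) - h x *m A))
    @ 0^' --> 'D_v h x *m A.
  rewrite (_ : (fun t => _) = (fun u => u *m A) \o
    (fun t : R => t^-1 *: ((h \o shift x) (t *: v) - h x))); last first.
    by apply/funext => t /=; rewrite -scalemxAl mulmxBl.
  have cA : {for 'D_v h x, continuous (fun u : 'rV[R]_m => u *m A)}.
    apply: continuous_mx => i j.
    by rewrite (ord1 i); exact: mulmx_coord_continuous.
  exact: (cvg_comp _ _ dh cA).
by split; [apply/cvg_ex; eexists; exact: H|exact: cvg_lim].
Qed.

Lemma is_derive_sumM (X : normedModType R) m (u w : 'I_m -> X -> R) x v :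
  (forall a, derivable (u a) x v) -> (forall a, derivable (w a) x v) ->
  is_derive x v (fun z => \sum_a u a z * w a z)
    (\sum_a (u a x * 'D_v (w a) x + w a x * 'D_v (u a) x)).
Proof.
move=> du dw; rewrite (_ : (fun z => _) = \sum_a (fun z => u a z * w a z)).
  apply: is_derive_sum => a; apply: is_deriveM; exact: derivableP.
by apply/funext => z; rewrite fct_sumE.
Qed.

(** At a zero of [w] continuity of [u] suffices, so the entries of the inverse metric never have to
    be differentiated. *)
Lemma is_deriveM0 (X : normedModType R) (u w : X -> R) x v :
  {for x, continuous u} -> derivable w x v -> w x = 0 ->
  is_derive x v (fun z => u z * w z) (u x * 'D_v w x).
Proof.
move=> cu dw w0.
have H : (fun t : R => t^-1 *: (((fun z => u z * w z) \o shift x) (t *: v) - u x * w x))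
    @ 0^' --> u x * 'D_v w x.
  rewrite (_ : (fun t => _) = fun t : R => (u (t *: v + x)) *
    (t^-1 *: ((w \o shift x) (t *: v) - w x))); last first.
    apply/funext => t /=; rewrite w0 mulr0 !subr0.
    by rewrite -[LHS]/(t^-1 * _) -[t^-1 *: _]/(t^-1 * _) mulrCA.
  apply: cvgM; last exact: dw.
  have c0 : (fun t : R => t *: v + x) @ 0^' --> x.
    apply: cvg_trans (cvg_app _ (@nbhs_dnbhs _ _)) _.
    rewrite -[X in _ --> X](add0r x) -[X in _ --> X + _](scale0r v).
    by apply: cvgD; [apply: cvgZr_tmp; exact: cvg_id|exact: cvg_cst].
  exact: (cvg_comp _ _ c0 cu).
by split; [apply/cvg_ex; eexists; exact: H|exact: cvg_lim].
Qed.

End MatrixCalculus.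

(** * Geometry of a graph chart *)

Lemma sum_delta (R : realType) n (c : 'I_n -> R) l :
  \sum_s (l == s)%:R * c s = c l.
Proof.
rewrite (bigD1 l)//= eqxx mul1r big1 ?addr0// => s sl.
by rewrite eq_sym (negbTE sl) mul0r.
Qed.

(** For symmetric [h a] each summand on the right is twice the second elementary symmetric function
    of the eigenvalues. This is the algebraic half of the traced Gauss equation. *)
Lemma sum_minors (R : realType) n k (h : 'I_k -> 'I_n -> 'I_n -> R) :
  \sum_j \sum_i \sum_a (h a i i * h a j j - h a i j ^+ 2) =
  \sum_a ((\sum_i h a i i) ^+ 2 - \sum_i \sum_j h a i j ^+ 2).
Proof.
rewrite (eq_bigr (fun j => \sum_a \sum_i (h a i i * h a j j - h a i j ^+ 2))).
  rewrite exchange_big/=; apply: eq_bigr => a _.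
  rewrite (eq_bigr (fun j => (\sum_i h a i i) * h a j j - \sum_i h a i j ^+ 2)).
    by rewrite sumrB -mulr_sumr -expr2 [X in _ - X = _]exchange_big.
  by move=> j _; rewrite sumrB mulr_suml.
by move=> j _; exact: exchange_big.
Qed.

Section FrameForm.
Variables (R : realType) (n m : nat) (E : 'M[R]_(n, m)).
Variables (B : 'rV[R]_m -> 'rV[R]_m -> R) (h : 'I_n -> 'I_n -> R).
Hypothesis EE : E *m E^T = 1%:M.
Hypothesis BE : forall x y, B x y =
  \sum_i \sum_j (x *m E^T) 0 i * (y *m E^T) 0 j * h i j.

Let cE (c : 'rV[R]_n) : c *m E *m E^T = c.
Proof. by rewrite -mulmxA EE mulmx1. Qed.

Let delta_diag (i : 'I_n) : (delta_mx 0 i : 'rV[R]_n) 0 i = 1.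
Proof. by rewrite mxE !eqxx. Qed.

Let delta_off (i j : 'I_n) : j != i -> (delta_mx 0 i : 'rV[R]_n) 0 j = 0.
Proof. by move=> ji; rewrite mxE (negbTE ji) andbF. Qed.

Lemma frame_form_row x (c : 'rV[R]_n) :
  B x (c *m E) = \sum_j c 0 j * B x (row j E).
Proof.
rewrite BE cE exchange_big; apply: eq_bigr => j _.
rewrite BE rowE cE mulr_sumr; apply: eq_bigr => i _; rewrite (bigD1 j)//= big1 ?addr0.
  by rewrite delta_diag; ring.
by move=> l lj; rewrite delta_off// mulr0 mul0r.
Qed.

Lemma frame_form_rows i j : B (row i E) (row j E) = h i j.
Proof.
rewrite BE !rowE !cE (bigD1 i)//= [X in _ + X]big1 ?addr0; last first.
  by move=> l li; rewrite big1// => b _; rewrite delta_off// !mul0r.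
rewrite (bigD1 j)//= [X in _ + X]big1 ?addr0; last first.
  by move=> l lj; rewrite (delta_off lj) mulr0 mul0r.
by rewrite !delta_diag !mul1r.
Qed.

End FrameForm.

Section GraphChartGeometry.
Variables (R : realType) (n k : nat).
Variables (M : set 'rV[R]_(n + k)) (p : 'rV[R]_(n + k)) (T : {vspace 'rV[R]_(n + k)}).
Variables (E : 'M[R]_(n, n + k)) (F : 'M[R]_(k, n + k)) (f : 'rV[R]_n -> 'rV[R]_k).
Variables (D : set 'rV[R]_n) (U : set 'rV[R]_(n + k)).
Hypothesis hgraph : graph_chart M p T E F f D U.

Let phi := graph_map p E F f.
Let oD : open D := gc_open_dom hgraph.
Let D0 : D 0 := gc_dom0 hgraph.
Local Notation e := (@coord_vec R n).

Definition component a (y : 'rV[R]_n) : R := f y 0 a.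

Let fc_smooth a : smooth_on D (component a).
Proof. exact: smooth_coord oD (gc_smooth hgraph). Qed.

Lemma derive_component y v a : D y -> 'D_v (component a) y = 'D_v f y 0 a.
Proof.
move=> Dy; apply: derive_coord; exact: smooth_derivable (gc_smooth hgraph) Dy.
Qed.

Lemma tangent_gram : E *m E^T = 1%:M.
Proof. by case: (gc_tangent_basis hgraph). Qed.

Lemma normal_gram : F *m F^T = 1%:M.
Proof. by case: (gc_normal_basis hgraph). Qed.

Lemma tangentP v : v \in T <-> v = v *m E^T *m E.
Proof.
have [EE TE] := gc_tangent_basis hgraph; split=> [/TE/submxP[c ->]|->].
  by rewrite -(mulmxA c) EE mulmx1.
by apply/TE; rewrite submxMl.
Qed.

Lemma normal_orthocomp (c : 'rV[R]_k) : orthocomp T (c *m F).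
Proof. by have [_ NF] := gc_normal_basis hgraph; apply/NF; rewrite submxMl. Qed.

Lemma tangent_mem (c : 'rV[R]_n) : c *m E \in T.
Proof. by apply/tangentP; rewrite -(mulmxA c) tangent_gram mulmx1. Qed.

Lemma normal_tangent_gram : F *m E^T = 0.
Proof.
apply/row_matrixP => i; rewrite row0 row_mul; apply/rowP => j; rewrite [RHS]mxE.
have H := normal_orthocomp (delta_mx 0 i) (tangent_mem (delta_mx 0 j)).
rewrite -!rowE dotE in H; rewrite -[RHS]H !mxE; apply: eq_bigr => l _.
by rewrite !mxE.
Qed.

Lemma tangent_normal_gram : E *m F^T = 0.
Proof. by rewrite -[LHS]trmxK trmx_mul trmxK normal_tangent_gram trmx0. Qed.

Lemma dot_frame (u u' : 'rV[R]_n) (w w' : 'rV[R]_k) :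
  dot (u *m E + w *m F) (u' *m E + w' *m F) = dot u u' + dot w w'.
Proof.
rewrite dotDl !dotDr !dot_mxl -!(mulmxA _ _ E^T) -!(mulmxA _ _ F^T).
rewrite tangent_gram normal_gram normal_tangent_gram tangent_normal_gram.
by rewrite !mulmx1 !mulmx0 !(dotC _ 0) !dot0l addr0 add0r.
Qed.

Lemma oproj_tangent q : oproj T q = q *m E^T *m E.
Proof.
apply: oprojP; first exact: tangent_mem.
move=> w /tangentP ->; rewrite dotC dot_mxl mulmxBl -!mulmxA tangent_gram mulmx1.
by rewrite subrr dotC dot0l.
Qed.

Lemma is_derive_phi y v : D y -> is_derive y v phi (v *m E + 'D_v f y *m F).
Proof.
move=> Dy; have df := derivableP (smooth_derivable (v := v) (gc_smooth hgraph) Dy).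
have := is_deriveD (is_deriveD (is_derive_cst p y v)
  (is_derive_mulmx E (is_derive_id y v))) (is_derive_mulmx F df).
by rewrite add0r.
Qed.

Lemma metric_graph y i j : D y -> metric phi y i j =
  (i == j)%:R + \sum_a 'D_(e i) (component a) y * 'D_(e j) (component a) y.
Proof.
move=> Dy; rewrite mxE; have [_ ->] := is_derive_phi (e i) Dy.
have [_ ->] := is_derive_phi (e j) Dy; rewrite dot_frame; congr (_ + _).
  rewrite dotE /coord_vec trmx_delta mul_delta_mx_cond.
  by case: (i == j); rewrite ?mulr1n ?mulr0n mxE ?eqxx.
by apply: eq_bigr => a _; rewrite !derive_component.
Qed.

Lemma D_near0 y : D y -> \forall z \near y, D z.
Proof. by move=> Dy; exact: open_nbhs_nbhs. Qed.

Lemma derive_metric y i j v : D y -> 'D_v (fun z => metric phi z i j) y =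
  \sum_a ('D_(e i) (component a) y * 'D_v ('D_(e j) (component a)) y +
          'D_(e j) (component a) y * 'D_v ('D_(e i) (component a)) y).
Proof.
move=> Dy; pose g z := (i == j)%:R +
  \sum_a 'D_(e i) (component a) z * 'D_(e j) (component a) z : R.
have -> : 'D_v (fun z => metric phi z i j) y = 'D_v g y.
  by apply: near_eq_derive; near do apply: metric_graph; exact: D_near0.
have dS := @is_derive_sumM R _ k (fun a => 'D_(e i) (component a))
  (fun a => 'D_(e j) (component a)) y v
  (fun a => smooth_derivable (smooth_derive _ (fc_smooth a)) Dy)
  (fun a => smooth_derivable (smooth_derive _ (fc_smooth a)) Dy).
have := is_deriveD (is_derive_cst ((i == j)%:R : R) y v) dS.
by rewrite add0r => -[_ <-].
Unshelve. all: by end_near. Qed.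

(** The metric is quadratic in the first derivatives of [f]. With mixed derivatives symmetric, the
    Koszul combination cancels down to twice the single term containing the derivative along [i] and
    [j]. *)
Lemma christoffel_graph l i j y : D y -> christoffel (metric phi) l i j y =
  \sum_s invmx (metric phi y) l s *
    \sum_a 'D_(e s) (component a) y * 'D_(e i) ('D_(e j) (component a)) y.
Proof.
move=> Dy; rewrite /christoffel mulr_sumr; apply: eq_bigr => s _.
rewrite mulrCA; congr (_ * _); rewrite !derive_metric// -big_split/= -sumrB mulr_sumr.
have koszul (W : 'I_n -> R) (H : 'I_n -> 'I_n -> R) : (forall i j, H i j = H j i) ->
    2^-1 * (W j * H i s + W s * H i j + (W i * H j s + W s * H j i)
      - (W i * H s j + W j * H s i)) = W s * H i j.
  by move=> Hsym; rewrite (Hsym j i) (Hsym s j) (Hsym s i); field.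
apply: eq_bigr => a _; exact: (koszul (fun i => 'D_(e i) (component a) y)
  (fun i j => 'D_(e i) ('D_(e j) (component a)) y)
  (fun i j => schwarz oD (e i) (e j) (fc_smooth a) Dy)).
Qed.

Lemma derive_component0 a v : 'D_v (component a) 0 = 0.
Proof. by rewrite derive_component// (gc_df0 hgraph) mxE. Qed.

Lemma metric0 : metric phi 0 = 1%:M.
Proof.
apply/matrixP => i j; rewrite metric_graph// mxE big1 ?addr0// => a _.
by rewrite derive_component0 mul0r.
Qed.

Lemma metric_continuous y i j : D y -> {for y, continuous (fun z => metric phi z i j)}.
Proof.
move=> Dy; have cS : {for y, continuous (fun z =>
   \sum_a 'D_(e i) (component a) z * 'D_(e j) (component a) z)}.
  apply: continuous_sumr => a _.
  exact: (cvgM (smooth_continuous (smooth_derive _ (fc_smooth a)) Dy)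
    (smooth_continuous (smooth_derive _ (fc_smooth a)) Dy)).
have c : {for y, continuous (fun z => (i == j)%:R +
   \sum_a 'D_(e i) (component a) z * 'D_(e j) (component a) z : R)}.
  exact: (cvgD (cvg_cst _) cS).
apply: near_eq_continuous c; near=> z; apply: metric_graph.
by near: z; exact: D_near0.
Unshelve. all: by end_near. Qed.

Lemma christoffel0 l i j : christoffel (metric phi) l i j 0 = 0.
Proof.
rewrite christoffel_graph// big1// => s _; rewrite big1 ?mulr0// => a _.
by rewrite derive_component0 mul0r.
Qed.

Definition hess a i j : R := 'D_(e i) ('D_(e j) (component a)) 0.

Lemma hess_sym a i j : hess a i j = hess a j i.
Proof. exact: (schwarz oD (e i) (e j) (fc_smooth a) D0). Qed.

(** The factor [w s] vanishes at 0, so the inverse metric enters only through its value there. Third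
    derivatives of [f] appear multiplied by first derivatives, which are zero at 0. *)
Lemma derive_christoffel0 l i j r :
  'D_(e r) (christoffel (metric phi) l i j) 0 = \sum_a hess a r l * hess a i j.
Proof.
pose u s z := invmx (metric phi z) l s.
pose w s z := \sum_a 'D_(e s) (component a) z * 'D_(e i) ('D_(e j) (component a)) z.
have -> : 'D_(e r) (christoffel (metric phi) l i j) 0 =
    'D_(e r) (\sum_s (fun z => u s z * w s z)) 0.
  apply: near_eq_derive; near=> z; rewrite fct_sumE; apply: christoffel_graph.
  by near: z; exact: D_near0.
have dw s : is_derive 0 (e r) (w s) (\sum_a hess a r s * hess a i j).
  have := @is_derive_sumM R _ k (fun a => 'D_(e s) (component a))
    (fun a => 'D_(e i) ('D_(e j) (component a))) 0 (e r)
    (fun a => smooth_derivable (smooth_derive _ (fc_smooth a)) D0)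
    (fun a => smooth_derivable (smooth_derive _ (smooth_derive _ (fc_smooth a))) D0).
  move=> H; apply: is_derive_eq H _; apply: eq_bigr => a _.
  cbv beta; rewrite [X in X * _ + _](derive_component0 a (e s)) mul0r add0r.
  exact: mulrC.
have w0 s : w s 0 = 0.
  by rewrite /w big1// => a _; rewrite derive_component0 mul0r.
have cu s : {for 0, continuous (u s)}.
  apply: continuous_invmx => [i' j'|]; first exact: metric_continuous.
  by rewrite metric0 unitmx1.
have duw s : is_derive 0 (e r) (fun z => u s z * w s z)
    ((l == s)%:R * \sum_a hess a r s * hess a i j).
  have [dws wsE] := dw s; have := is_deriveM0 (cu s) dws (w0 s).
  by rewrite wsE /u metric0 invmx1 mxE.
have [_ ->] := is_derive_sum duw.
exact: (sum_delta (fun s => \sum_a hess a r s * hess a i j) l).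
Unshelve. all: by end_near. Qed.

Lemma scalar_curvature_graph : scalar_curvature (metric phi) 0 =
  \sum_a ((\sum_i hess a i i) ^+ 2 - \sum_i \sum_j hess a i j ^+ 2).
Proof.
rewrite /scalar_curvature metric0 invmx1.
transitivity (\sum_j \sum_i \sum_a (hess a i i * hess a j j - hess a i j ^+ 2)).
  apply: eq_bigr => j _; rewrite (bigD1 j)//= mxE eqxx mul1r big1 ?addr0; last first.
    by move=> s sj; rewrite mxE eq_sym (negbTE sj) mul0r.
  rewrite /ricci; apply: eq_bigr => i _; rewrite /riemann !derive_christoffel0.
  rewrite [X in _ + X]big1 ?addr0; last first.
    by move=> r _; rewrite !christoffel0 !mul0r subrr.
  rewrite -sumrB; apply: eq_bigr => a _.
  by rewrite expr2 [X in _ - X * _ = _](hess_sym a j i).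
exact: (sum_minors hess).
Qed.

Let II := second_form T E phi.

(** The tangential part of the chart is affine, so its second derivative vanishes and the second
    derivative of [phi] is already normal. *)
Lemma second_form_graph x y :
  II x y = 'D_(x *m E^T) ('D_(y *m E^T) f) 0 *m F.
Proof.
rewrite /II /second_form.
have -> : 'D_(x *m E^T) ('D_(y *m E^T) phi) 0 =
    'D_(x *m E^T) ('D_(y *m E^T) f) 0 *m F.
  set v := y *m E^T.
  have -> : 'D_(x *m E^T) ('D_v phi) 0 = 'D_(x *m E^T) (fun z => v *m E + 'D_v f z *m F) 0.
    apply: near_eq_derive; near=> z.
    have Dz : D z by near: z; exact: D_near0.
    by have [_ ->] := is_derive_phi v Dz.
  have df := derivableP (smooth_derivable (v := x *m E^T)
    (smooth_derive v (gc_smooth hgraph)) D0).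
  have := is_deriveD (is_derive_cst (v *m E) 0 (x *m E^T)) (is_derive_mulmx F df).
  by rewrite add0r => -[_ <-].
by rewrite (oproj_sub_ortho (normal_orthocomp _)) subr0.
Unshelve. all: by end_near. Qed.

Lemma second_form_dot x y nu : dot (II x y) nu =
  \sum_i \sum_j (x *m E^T) 0 i * (y *m E^T) 0 j *
     \sum_a hess a i j * (nu *m F^T) 0 a.
Proof.
rewrite second_form_graph dot_mxl.
set u := x *m E^T; set v := y *m E^T.
have Da a : 'D_u ('D_v f) 0 0 a = \sum_i \sum_j u 0 i * v 0 j * hess a i j.
  have -> : 'D_u ('D_v f) 0 0 a = 'D_u ('D_v (component a)) 0.
    rewrite -derive_coord; last first.
      exact: smooth_derivable (smooth_derive v (gc_smooth hgraph)) D0.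
    apply: near_eq_derive; near=> z; apply/esym/derive_component.
    by near: z; exact: D_near0.
  rewrite (derive_sum_coord oD _ (smooth_derive v (fc_smooth a)) D0).
  apply: eq_bigr => i _; rewrite (schwarz oD _ _ (fc_smooth a) D0).
  rewrite (derive_sum_coord oD _ (smooth_derive (e i) (fc_smooth a)) D0).
  rewrite mulr_sumr; apply: eq_bigr => j _; rewrite mulrA.
  exact: (congr1 _ (schwarz oD (e j) (e i) (fc_smooth a) D0)).
rewrite /dot (eq_bigr (fun a => \sum_i \sum_j u 0 i * v 0 j * (hess a i j * (nu *m F^T) 0 a))).
  rewrite exchange_big; apply: eq_bigr => i _; rewrite exchange_big.
  by apply: eq_bigr => j _; rewrite mulr_sumr.
move=> a _; rewrite Da mulr_suml; apply: eq_bigr => i _.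
by rewrite mulr_suml; apply: eq_bigr => j _; rewrite !mulrA.
Unshelve. all: by end_near. Qed.

Lemma second_form_dot_row x (c : 'rV[R]_n) nu :
  dot (II x (c *m E)) nu = \sum_j c 0 j * dot (II x (row j E)) nu.
Proof.
exact: (frame_form_row tangent_gram (fun x y => second_form_dot x y nu)).
Qed.

(** Riesz representation in the frame [E]: the scalar product is nondegenerate on [T], so the value
    selected by [get] is this one. *)
Lemma weingartenE nu x :
  weingarten II T nu x = (\row_j dot (II x (row j E)) nu) *m E.
Proof.
rewrite /weingarten; set P := [set s | _]; set w := _ *m E.
have rE j : row j E *m E^T = delta_mx 0 j by rewrite -row_mul tangent_gram row1.
have Pw : P w.
  split; first exact: tangent_mem.
  move=> y /tangentP ->; rewrite /w dotC dot_mxl -(mulmxA _ E) tangent_gram mulmx1.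
  transitivity (\sum_j (y *m E^T) 0 j * dot (II x (row j E)) nu).
    by apply: eq_bigr => j _; congr (_ * _); rewrite mxE.
  exact: esym (second_form_dot_row x (y *m E^T) nu).
have [w'T w'E] := getI Pw; have [wT wE] := Pw.
apply/eqP; rewrite -subr_eq0; apply/eqP/dot_eq0.
have dT : get P - w \in T by rewrite rpredB.
by rewrite dotBl (w'E _ dT) (wE _ dT) subrr.
Qed.

Lemma tr_third_formE : tr_third_form II T E F =
  \sum_a \sum_i \sum_j hess a i j ^+ 2.
Proof.
rewrite /tr_third_form exchange_big; apply: eq_bigr => a _; apply: eq_bigr => i _.
rewrite /third_form weingartenE dot_mxl -mulmxA tangent_gram mulmx1.
have rF : row a F *m F^T = delta_mx 0 a by rewrite -row_mul normal_gram row1.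
apply: eq_bigr => j _; rewrite mxE -expr2; congr (_ ^+ 2).
rewrite (frame_form_rows tangent_gram (fun x y => second_form_dot x y (row a F))) rF.
rewrite -[RHS](sum_delta (fun b => hess b i j) a); apply: eq_bigr => b _.
by rewrite [X in _ * X = _]mxE eqxx mulrC eq_sym.
Qed.

Lemma mean_curvature_dot : dot (mean_curvature_vector II E) (mean_curvature_vector II E) =
  \sum_a (\sum_i hess a i i) ^+ 2.
Proof.
have rE j : row j E *m E^T = delta_mx 0 j by rewrite -row_mul tangent_gram row1.
have -> : mean_curvature_vector II E = (\row_a \sum_i hess a i i) *m F.
  rewrite /mean_curvature_vector.
  rewrite (_ : (\row_a _) = \sum_i \row_a hess a i i).
    rewrite mulmx_suml; apply: eq_bigr => i _; rewrite second_form_graph !rE.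
    congr (_ *m F); apply/rowP => a; rewrite mxE /hess.
    rewrite -derive_coord; last first.
      exact: smooth_derivable (smooth_derive _ (gc_smooth hgraph)) D0.
    apply: near_eq_derive; near=> z; apply/esym/derive_component.
    by near: z; exact: D_near0.
  by apply/rowP => a; rewrite mxE summxE; apply: eq_bigr => i _; rewrite mxE.
rewrite dot_mxl -mulmxA normal_gram mulmx1 /dot.
by apply: eq_bigr => a _; rewrite !mxE -expr2.
Unshelve. all: by end_near. Qed.

Lemma gauss_trace : tr_third_form II T E F =
  dot (mean_curvature_vector II E) (mean_curvature_vector II E)
  - scalar_curvature (metric phi) 0.
Proof.
rewrite tr_third_formE mean_curvature_dot scalar_curvature_graph -sumrB.
by apply: eq_bigr => a _; rewrite opprB addrC subrK.
Qed.

End GraphChartGeometry.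

Section MoreBounds.
Variables (R : realType) (n : nat).
Local Notation X := 'rV[R]_n.
Implicit Types (g h : X -> R).

Lemma bigO_at0B p g h : bigO_at0 p g -> bigO_at0 p h -> bigO_at0 p (fun y => g y - h y).
Proof.
move=> gO hO; apply: bigO_at0_eq (bigO_at0D gO (bigO_at0Z (-1) hO)) => y.
by rewrite mulN1r.
Qed.

Lemma bigO_at0_near p h h' r : 0 < r -> (forall y, `|y| < r -> `|h' y| <= `|h y|) ->
  bigO_at0 p h -> bigO_at0 p h'.
Proof.
move=> r0 hh' [K [s [K0 s0 hK]]]; exists K, (Num.min r s).
split; rewrite ?lt_min ?r0// => y; rewrite lt_min => /andP[yr ys].
exact: le_trans (hh' y yr) (hK y ys).
Qed.

Lemma enorm_le_sum m (u : 'rV[R]_m) : enorm u <= \sum_i `|u 0 i|.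
Proof.
have s0 : 0 <= \sum_i `|u 0 i| by exact: sumr_ge0.
rewrite enorm_le// expr2 mulr_suml /dot; apply: ler_sum => i _.
rewrite (le_trans (ler_norm _))// normrM ler_wpM2l// (bigD1 i)//= lerDl.
exact: sumr_ge0.
Qed.

Lemma bigO_at0_enorm m p (h : X -> 'rV[R]_m) :
  (forall i, bigO_at0 p (fun y => h y 0 i)) -> bigO_at0 p (fun y => enorm (h y)).
Proof.
move=> hO; apply: (@bigO_at0_near p (fun y => \sum_i `|h y 0 i|) _ 1) => //.
  by move=> y _; rewrite ger0_norm ?enorm_ge0// (le_trans (enorm_le_sum _))// ler_norm.
apply: bigO_at0_sum => i; apply: bigO_at0_near ltr01 _ (hO i) => y _.
by rewrite normr_id.
Qed.

Lemma bigO_at0_unif (I : finType) p (h : I -> X -> R) : (forall i, bigO_at0 p (h i)) ->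
  exists K r, [/\ 0 <= K, 0 < r &
    forall i y, `|y| < r -> `|h i y| <= K * `|y| ^+ p].
Proof.
move=> hO; have := @bigO_at0_sum R n p I (index_enum I) (fun i y => `|h i y|) _.
case=> [i|K [r [K0 r0 hK]]].
  by apply: bigO_at0_near ltr01 _ (hO i) => y _; rewrite normr_id.
exists K, r; split=> // i y yr; apply: le_trans (hK y yr).
rewrite [leRHS]ger0_norm ?sumr_ge0// (bigD1 i)//= lerDl.
exact: sumr_ge0.
Qed.

End MoreBounds.

(** * Expansion of the Riemannian density of a graph *)

Section Density.
Variables (R : realType) (n k : nat).
Variables (M : set 'rV[R]_(n + k)) (p : 'rV[R]_(n + k)) (T : {vspace 'rV[R]_(n + k)}).
Variables (E : 'M[R]_(n, n + k)) (F : 'M[R]_(k, n + k)) (f : 'rV[R]_n -> 'rV[R]_k).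
Variables (D : set 'rV[R]_n) (U : set 'rV[R]_(n + k)).
Hypothesis hgraph : graph_chart M p T E F f D U.

Let phi := graph_map p E F f.
Let oD : open D := gc_open_dom hgraph.
Let D0 : D 0 := gc_dom0 hgraph.
Local Notation e := (@coord_vec R n).

Definition density y := Num.sqrt (\det (metric phi y)).

Let w a i y := 'D_(e i) (component f a) y.
Let G y : 'M[R]_n := \matrix_(i, j) \sum_a w a i y * w a j y.

Let w_smooth a i : smooth_on D (w a i).
Proof.
have sa : smooth_on D (component f a) by exact: smooth_coord oD (gc_smooth hgraph).
exact: smooth_derive.
Qed.

Let w0 a i : w a i 0 = 0.
Proof. exact: (derive_component0 hgraph). Qed.

Let w_O1 a i : bigO_at0 1 (w a i).
Proof.
by apply: bigO_at0_eq (taylor1 oD D0 (w_smooth a i)) => y; rewrite w0 subr0.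
Qed.

Let metricE y : D y -> metric phi y = 1%:M + G y.
Proof. by move=> Dy; apply/matrixP => i j; rewrite (metric_graph hgraph)// !mxE. Qed.

Let G_O2 ij : bigO_at0 2 (fun y => G y ij.1 ij.2).
Proof.
apply: (@bigO_at0_eq _ _ 2 (fun y => \sum_a w a ij.1 y * w a ij.2 y)).
  by move=> y; rewrite mxE.
by apply: bigO_at0_sum => a; exact: (bigO_at0M (w_O1 _ _) (w_O1 _ _)).
Qed.

(** The metric is [1%:M + G] with [G] of order 2, so stopping at the linear terms of the determinant
    and of the root leaves errors quadratic in [G], of order 4. *)
Lemma density_expansion_trace :
  bigO_at0 4 (fun y => density y - 1 - (\sum_a \sum_i w a i y ^+ 2) / 2).
Proof.
have trE y : \tr (G y) = \sum_a \sum_i w a i y ^+ 2.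
  rewrite /mxtrace [RHS]exchange_big; apply: eq_bigr => i _; rewrite mxE.
  by apply: eq_bigr => a _; rewrite expr2.
have [r r0 Dr] := open_ball0 oD D0.
have [K [s [K0 s0 GK]]] := bigO_at0_unif G_O2.
have [C C0 detC] := @det_perturbation R n.
pose x y := \det (1%:M + G y) - 1.
have xtr : bigO_at0 4 (fun y => x y - \tr (G y)).
  (* The bounds by 1 and [(K + 1)^-1] give [K * |y| ^+ 2 <= 1], the range in which
     [det_perturbation] holds. *)
  pose u := Num.min s (Num.min 1 (K + 1)^-1).
  have K1 : 0 < K + 1 by rewrite ltr_wpDl.
  exists (C * K ^+ 2), u; split; rewrite ?mulr_ge0 ?sqr_ge0//.
    by rewrite !lt_min s0 ltr01 invr_gt0.
  move=> y; rewrite !lt_min => /and3P[ys y1 yK].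
  rewrite -mulrA -[4%N]/(2 * 2)%N exprM -exprMn; apply: detC.
    rewrite mulr_ge0//= expr2 mulrA mulr_ile1 ?mulr_ge0//; last exact: ltW.
    rewrite -[leRHS](@mulfV _ (K + 1)) ?gt_eqF//.
    by rewrite ler_pM// ?lerDl// ltW.
  by move=> i j; exact: (GK (i, j)).
have trO : bigO_at0 2 (fun y => \tr (G y)).
  by apply: bigO_at0_sum => i; exact: (G_O2 (i, i)).
have xO : bigO_at0 2 x.
  by apply: bigO_at0_eq (bigO_at0D (bigO_at0_le (isT : (2 <= 4)%N) xtr) trO) => y; rewrite subrK.
have [L [v [L0 v0 xL]]] := xO.
have L1 : 0 < L + 1 by rewrite ltr_wpDl.
(* The same device with [L] keeps the argument of the root nonnegative, as [sqrt_perturbation]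
   requires. *)
have x1 y : `|y| < Num.min v (Num.min 1 (L + 1)^-1) -> -1 <= x y.
  rewrite !lt_min => /and3P[yv y1 yL]; have := xL y yv.
  rewrite ler_norml => /andP[+ _]; apply: le_trans; rewrite lerN2.
  rewrite expr2 mulrA mulr_ile1 ?mulr_ge0//; last exact: ltW.
  rewrite -[leRHS](@mulfV _ (L + 1)) ?gt_eqF//.
  by rewrite ler_pM// ?lerDl// ltW.
have sO : bigO_at0 4 (fun y => density y - 1 - x y / 2).
  have x2O : bigO_at0 4 (fun y => x y ^+ 2).
    by apply: bigO_at0_eq (bigO_at0M xO xO) => y; rewrite expr2.
  apply: (@bigO_at0_near _ _ 4 (fun y => x y ^+ 2) _
    (Num.min r (Num.min v (Num.min 1 (L + 1)^-1)))) x2O.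
    by rewrite !lt_min r0 v0 ltr01 invr_gt0.
  move=> y; rewrite lt_min => /andP[/Dr Dy /x1 yx].
  rewrite [leRHS]ger0_norm ?sqr_ge0// (le_trans _ (sqrt_perturbation yx))//.
  by rewrite /density metricE// /x (addrC 1 (_ - 1)) subrK.
apply: bigO_at0_eq (bigO_at0D sO (bigO_at0Z 2^-1 xtr)) => y.
by rewrite trE; field.
Qed.

Lemma density_expansion1 : bigO_at0 2 (fun y => density y - 1).
Proof.
have wO : bigO_at0 2 (fun y => (\sum_a \sum_i w a i y ^+ 2) / 2).
  apply: bigO_at0_eq (bigO_at0Z 2^-1 (_ : bigO_at0 2 (fun y => \sum_a \sum_i w a i y ^+ 2))) => [y|].
    by rewrite mulrC.
  apply: bigO_at0_sum => a; apply: bigO_at0_sum => i.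
  by apply: bigO_at0_eq (bigO_at0M (w_O1 a i) (w_O1 a i)) => y; rewrite expr2.
apply: bigO_at0_eq (bigO_at0D (bigO_at0_le (isT : (2 <= 4)%N) density_expansion_trace) wO) => y.
by rewrite subrK.
Qed.

(** The gradient at 0 of the [i]-th partial derivative of [f_a]; its product with [y] is the linear
    part of [w a i]. *)
Definition hess_row a i : 'rV[R]_n := \row_j hess f a j i.

(** Write the sum of squares at [y] and [- y] as half the square of the sum plus half the square of
    the difference. The sum has order 2, so its square is negligible. The difference is
    [2 * dot y (hess_row a i)] up to order 3, and factoring the difference of the two squares gives
    order 4. *)
Lemma density_expansion_even : bigO_at0 4 (fun y => density y + density (- y) - 2 -
   \sum_a \sum_i dot y (hess_row a i) ^+ 2).
Proof.
have T1 := density_expansion_trace; have T2 := bigO_at0N T1.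
have sq a i : bigO_at0 4 (fun y => w a i y ^+ 2 + w a i (- y) ^+ 2 -
    2 * dot y (hess_row a i) ^+ 2).
  have H3 : bigO_at0 3 (fun y => w a i y - w a i (- y) - 2 * dot y (hess_row a i)).
    apply: bigO_at0_eq (taylor_odd oD D0 (w_smooth a i)) => y.
    by congr (_ - 2 * _); apply: eq_bigr => j _; rewrite mxE.
  have H2 : bigO_at0 2 (fun y => w a i y + w a i (- y)).
    by apply: bigO_at0_eq (taylor_even oD D0 (w_smooth a i)) => y; rewrite w0 mulr0 subr0.
  have lO : bigO_at0 1 (fun y : 'rV_n => dot y (hess_row a i)).
    apply: bigO_at0_sum => j; apply: bigO_at0_eq (bigO_at0Z (hess_row a i 0 j) (bigO_at0_coord R j)) => y.
    by rewrite mulrC.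
  have HO : bigO_at0 1 (fun y => w a i y - w a i (- y) + 2 * dot y (hess_row a i)).
    exact: (bigO_at0D (bigO_at0B (w_O1 a i) (bigO_at0N (w_O1 a i))) (bigO_at0Z 2 lO)).
  apply: bigO_at0_eq (bigO_at0D (bigO_at0Z 2^-1 (bigO_at0M H2 H2)) (bigO_at0Z 2^-1 (bigO_at0M H3 HO))) => y.
  by field.
have S4 := bigO_at0_sum (index_enum 'I_k) (fun a =>
  bigO_at0_sum (index_enum 'I_n) (fun i => sq a i)).
apply: bigO_at0_eq (bigO_at0D (bigO_at0D T1 T2) (bigO_at0Z 2^-1 S4)) => y.
have S4E : \sum_a \sum_i (w a i y ^+ 2 + w a i (- y) ^+ 2 - 2 * dot y (hess_row a i) ^+ 2)
    = \sum_a \sum_i w a i y ^+ 2 + \sum_a \sum_i w a i (- y) ^+ 2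
      - 2 * \sum_a \sum_i dot y (hess_row a i) ^+ 2.
  rewrite mulr_sumr -big_split -sumrB; apply: eq_bigr => a _.
  by rewrite mulr_sumr -big_split -sumrB.
have alg (d d' W W' C : R) : d - 1 - W / 2 + (d' - 1 - W' / 2)
    + 2^-1 * (W + W' - 2 * C) = d + d' - 2 - C by field.
exact: etrans (congr1 (fun s => density y - 1 - (\sum_a \sum_i w a i y ^+ 2) / 2 +
  (density (- y) - 1 - (\sum_a \sum_i w a i (- y) ^+ 2) / 2) + 2^-1 * s) S4E)
  (alg _ _ _ _ _).
Qed.

Lemma hess_row_trace : \sum_a \sum_i dot (hess_row a i) (hess_row a i) =
  tr_third_form (second_form T E phi) T E F.
Proof.
rewrite (tr_third_formE hgraph); apply: eq_bigr => a _.
rewrite [RHS]exchange_big; apply: eq_bigr => i _.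
by apply: eq_bigr => j _; rewrite !mxE -expr2.
Qed.

Lemma density_continuous y : D y -> {for y, continuous density}.
Proof.
move=> Dy; have cd := continuous_det (fun i j => metric_continuous hgraph (i := i) (j := j) Dy).
exact: (continuous_comp cd (@sqrt_continuous R _)).
Qed.

End Density.

(** * Volumes of cylindrical components *)

Section OpenMeasurable.
Variables (R : realType) (n : nat).
Local Notation mT := (measurableTypeR R).
Implicit Types (O D : set 'rV[R]_n).

(** The sigma-algebra on tuples is generated by coordinates, so an open set is written as the
    countable union of the rational boxes that it contains. *)
Lemma open_row_measurable O : open O -> measurable [set t | O (@row_of_tuple R n t)].
Proof.
move=> oO.
pose box (c : 'rV[rat]_n * rat) : set 'rV[R]_n :=
  [set y | forall i, `|y 0 i - ratr (c.1 0 i)| < ratr c.2].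
have mbox c : measurable [set t | box c (@row_of_tuple R n t)].
  rewrite (_ : mkset _ = \bigcap_(i in [set: 'I_n])
      [set t | `|row_of_tuple t 0 i - ratr (c.1 0 i)| < ratr c.2]); last first.
    by apply/seteqP; split=> t /= bt i; [move=> _; exact: bt|exact: bt].
  apply: fin_bigcap_measurable => // i _.
  have mb : measurable_fun setT (fun t : n.-tuple mT =>
      `|row_of_tuple t 0 i - ratr (c.1 0 i)| < ratr c.2 :> R).
    apply: measurable_fun_ltr => //; apply: measurableT_comp => //.
    by apply: measurable_funB => //; exact: row_measurable_coord.
  by have := mb measurableT [set true] I; rewrite setTI.
rewrite (_ : mkset _ = \bigcup_(c : 'rV[rat]_n * rat)
    [set t | box c `<=` O /\ box c (row_of_tuple t)]); last first.
  apply/seteqP; split=> t; last by move=> [c _ [cO ct]]; exact: cO.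
  rewrite /= => Ot; set y := row_of_tuple t in Ot *.
  have /nbhs_ballP[r r0 rO] := open_nbhs_nbhs (conj oO Ot).
  (* Two points of a box of half-width below [r / 2] differ by less than [r] in each coordinate, so
     the box around [y] stays inside the ball. *)
  have r2 : 0 < r / 2 by rewrite divr_gt0.
  have [q] := rat_in_itvoo r2; rewrite in_itv/= => /andP[q0 qr].
  have cP i : exists d : rat, `|y 0 i - ratr d| < ratr q.
    have [|d] := @rat_in_itvoo R (y 0 i - ratr q) (y 0 i + ratr q); first by lra.
    rewrite in_itv/= => /andP[d1 d2]; exists d; rewrite ltr_norml; apply/andP; split; lra.
  pose c : 'rV[rat]_n := \row_i xchoose (cP i).
  have yc i : `|y 0 i - ratr (c 0 i)| < ratr q.
    have -> : c 0 i = xchoose (cP i) by rewrite mxE.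
    exact: (xchooseP (cP i)).
  exists (c, q) => //; split=> // z zc; apply: rO; split=> // i j; rewrite (ord1 i).
  rewrite -ball_normE /=; have := zc j; have := yc j; rewrite /= !ltr_norml.
  by move=> /andP[? ?] /andP[? ?]; apply/andP; split; lra.
apply: countable_bigcupT_measurable => // c.
have [cO|cO] := pselect (box c `<=` O).
  by rewrite (_ : mkset _ = [set t | box c (row_of_tuple t)])//;
    apply/seteqP; split=> t /= => [[]|].
by rewrite (_ : mkset _ = set0)//; apply/seteqP; split=> t //= [].
Qed.

Lemma continuous_row_measurable D (h : 'rV[R]_n -> R) : open D ->
  (forall y, D y -> {for y, continuous h}) ->
  measurable_fun [set t | D (@row_of_tuple R n t)] (h \o @row_of_tuple R n : _ -> mT).
Proof.
move=> oD ch mD; apply: (measurability _ (RGenOInfty.measurableE R)) => //.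
move=> /= _ [_ [a ->] <-].
rewrite (_ : _ `&` _ = [set t | (D `&` [set y | a < h y]) (@row_of_tuple R n t)]).
  apply: open_row_measurable; rewrite openE => y [Dy ay]; rewrite /interior.
  near=> z; split; first by near: z; exact: open_nbhs_nbhs.
  by near: z; exact: (cvgr_gt _ (ch y Dy)).
by apply/seteqP; split=> t /=; rewrite in_itv/= andbT.
Unshelve. all: by end_near. Qed.

End OpenMeasurable.

Section DirectionalMoment.
Variable R : realType.
Local Notation mT := (measurableTypeR R).
Local Notation chi := (ereal_of_bool R).

Lemma row_intD n (G H : 'rV[R]_n -> \bar R) : row_measurable G -> row_measurable H ->
  (forall y, 0 <= G y)%E -> (forall y, 0 <= H y)%E ->
  row_int (fun y => G y + H y)%E = (row_int G + row_int H)%E.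
Proof. by move=> mG mH G0 H0; rewrite /row_int ge0_integralD. Qed.

Lemma row_int_sum n I (s : seq I) (G : I -> 'rV[R]_n -> \bar R) :
  (forall i, row_measurable (G i)) -> (forall i y, 0 <= G i y)%E ->
  row_int (fun y => \sum_(i <- s) G i y)%E = (\sum_(i <- s) row_int (G i))%E.
Proof. by move=> mG G0; rewrite /row_int ge0_integral_sum. Qed.

Lemma row_int_le n (G H : 'rV[R]_n -> \bar R) : row_measurable G -> row_measurable H ->
  (forall y, 0 <= G y)%E -> (forall y, G y <= H y)%E -> (row_int G <= row_int H)%E.
Proof.
by move=> mG mH G0 GH; apply: ge0_le_integral.
Qed.

Lemma row_int_linear n (A : 'M[R]_n) (G : 'rV[R]_n -> \bar R) : A \in unitmx ->
  row_measurable G -> (forall y, 0 <= G y)%E ->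
  row_int (fun y => G (y *m A)) = (`|\det A|^-1%:E * row_int G)%E.
Proof.
move=> uA mG G0; rewrite -(substitution_unit uA 0 mG G0).
by congr row_int; apply/funext => y; rewrite addr0.
Qed.

Lemma orthogonal_det n (A : 'M[R]_n) : A *m A^T = 1%:M -> `|\det A| = 1.
Proof.
move=> AA; have : `|\det A| ^+ 2 = 1.
  by rewrite -normrX expr2 -{2}det_tr -det_mulmx AA det1 normr1.
by move/eqP; rewrite sqrp_eq1// => /eqP.
Qed.

Lemma orthogonal_unit n (A : 'M[R]_n) : A *m A^T = 1%:M -> A \in unitmx.
Proof.
by move=> AA; rewrite unitmxE unitfE -normr_eq0 (orthogonal_det AA) oner_eq0.
Qed.

Lemma row_int_orthogonal n (A : 'M[R]_n) (G : 'rV[R]_n -> \bar R) : A *m A^T = 1%:M ->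
  row_measurable G -> (forall y, 0 <= G y)%E ->
  row_int (fun y => G (y *m A)) = row_int G.
Proof.
move=> AA mG G0; rewrite row_int_linear ?orthogonal_unit//.
by rewrite orthogonal_det// invr1 mul1e.
Qed.

Lemma row_measurable_linear_form n (h : 'rV[R]_n) :
  row_measurable (fun y : 'rV[R]_n => dot y h : mT).
Proof.
apply: measurable_sum => i.
by apply: measurable_funM => //; exact: row_measurable_coord.
Qed.

Lemma row_measurable_moment n (h : 'rV[R]_n) (e : R) :
  row_measurable (fun y : 'rV[R]_n => (dot y h ^+ 2)%:E * chi (enorm y <= e)%R)%E.
Proof.
apply: emeasurable_funM; last exact: row_measurable_ball.
by apply/measurable_EFinP; apply: measurable_funX; exact: row_measurable_linear_form.
Qed.

Let moment_ge0 n (h : 'rV[R]_n) (e : R) (y : 'rV[R]_n) :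
  (0 <= (dot y h ^+ 2)%:E * chi (enorm y <= e)%R)%E.
Proof. by rewrite mule_ge0 ?chi_ge0// lee_fin sqr_ge0. Qed.

Let Q n (h : 'rV[R]_n) :=
  row_int (fun y => (dot y h ^+ 2)%:E * chi (enorm y <= 1)%R)%E.

(** Rotation invariance of the ball: a Householder matrix carries [h] to the first axis. *)
Let Q_unit n (h : 'rV[R]_n.+1) : dot h h = 1 -> Q h = Q (delta_mx 0 0 : 'rV[R]_n.+1).
Proof.
move=> /householder[A [AA A0]].
have AtA : A^T *m A^T^T = 1%:M by rewrite trmxK; exact: mulmx1C.
have := row_int_orthogonal AtA (@row_measurable_moment n.+1 (delta_mx 0 0) 1)
  (moment_ge0 _ _).
move=> QE; rewrite /Q -QE; congr row_int; apply/funext => y /=.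
have -> : dot (y *m A^T) (delta_mx 0 0) = dot y h.
  by rewrite dot_mxl trmxK -rowE A0.
by rewrite {2}/enorm dot_mxl trmxK -mulmxA (mulmx1C AA) mulmx1.
Qed.

(** The coordinate moments are all equal by [Q_unit] and add up to the full second moment, so each
    one is that moment divided by the dimension. *)
Let Q_delta n : Q (delta_mx 0 0 : 'rV[R]_n.+1) =
  ((n.+1%:R + 2)^-1 * ball_volume n.+1 (1 : R))%:E.
Proof.
have := @ball_second_moment R n.+1.
rewrite (_ : (fun y => _) = fun y : 'rV[R]_n.+1 => (\sum_i
   ((dot y (delta_mx 0 i) ^+ 2)%:E * chi (enorm y <= 1)%R))%E); last first.
  apply/funext => y; rewrite -ge0_sume_distrl; last by move=> i _; rewrite lee_fin sqr_ge0.
  congr (_ * _)%E; rewrite sumEFin; congr EFin; apply: eq_bigr => i _.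
  by rewrite dotE trmx_delta -colE mxE expr2.
rewrite row_int_sum; [|by move=> i; exact: row_measurable_moment|by []].
rewrite (eq_bigr (fun=> Q (delta_mx 0 0 : 'rV[R]_n.+1))); last first.
  by move=> i _; apply: Q_unit; rewrite dotE trmx_delta mul_delta_mx mxE !eqxx.
have Q0 : (0 <= Q (delta_mx 0 0 : 'rV[R]_n.+1)%R)%E by apply: row_int_ge0.
move: Q0; case: (Q (delta_mx 0 0 : 'rV[R]_n.+1)) => [q| |] //.
- rewrite sumEFin sumr_const card_ord => _ [] qE; congr EFin.
  have n1 : n.+1%:R != 0 :> R by rewrite pnatr_eq0.
  have n3 : 1 + n%:R + 2 != 0 :> R by rewrite lt0r_neq0// addr_gt0// ltr_pwDl.
  by apply: (mulfI n1); rewrite mulr_natl qE; field.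
(* An infinite coordinate moment would make the known finite sum infinite. *)
- have s0 : (0 <= \sum_(i < n) +oo :> \bar R)%E by apply: sume_ge0.
  by move=> _; rewrite big_ord_recl addye// gt_eqF// (lt_le_trans _ s0).
Qed.

Lemma second_moment n (h : 'rV[R]_n) (e : R) : 0 < e ->
  row_int (fun y => (dot y h ^+ 2)%:E * chi (enorm y <= e)%R)%E =
  (dot h h * (e ^+ n.+2 / (n%:R + 2) * ball_volume n 1))%:E.
Proof.
move=> e0; case: n h => [|n] h.
  rewrite row_int0; [|exact: row_measurable_moment|exact: moment_ge0].
  by rewrite /dot !big_ord0 expr0n/= mul0e mul0r.
have [->|h0] := eqVneq h 0.
  rewrite dot0l mul0r (_ : (fun y => _) = fun=> 0%E); first by rewrite /row_int integral0.
  by apply/funext => y; rewrite dotC dot0l expr0n/= mul0e.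
have hh := dot_gt0 h0; pose c := Num.sqrt (dot h h).
have c0 : 0 < c by rewrite sqrtr_gt0.
have cc : c ^+ 2 = dot h h by rewrite sqr_sqrtr// ltW.
pose u := c^-1 *: h.
have u1 : dot u u = 1 by rewrite /u dotZl dotZr mulrA -expr2 exprVn cc mulVf ?gt_eqF.
rewrite (row_int_dilation e0)//; last exact: row_measurable_moment.
rewrite (_ : (fun y => _) = fun y : 'rV_n.+1 => ((dot h h * e ^+ 2)%:E *
    ((dot y u ^+ 2)%:E * chi (enorm y <= 1)%R))%E); last first.
  apply/funext => y; rewrite muleA -EFinM; congr (_%:E * chi _)%E.
    by rewrite /u dotZl dotZr -cc; field; rewrite gt_eqF.
  by rewrite enormZ gtr0_norm// ger_pMr.
rewrite (row_intZl (@row_measurable_moment n.+1 u 1) (moment_ge0 _ _)); last first.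
  by rewrite mulr_ge0 ?sqr_ge0 ?dot_ge0.
rewrite -/(Q u) Q_unit// Q_delta -!EFinM; congr EFin.
have n3 : 1 + n%:R + 2 != 0 :> R by rewrite lt0r_neq0// addr_gt0// ltr_pwDl.
by rewrite !exprS; field.
Qed.

End DirectionalMoment.

Section RowVolume.
Variables (R : realType) (n : nat).
Local Notation mT := (measurableTypeR R).
Local Notation chi := (ereal_of_bool R).
Implicit Types (S : set 'rV[R]_n) (rho : 'rV[R]_n -> R).

Lemma integral_row_set S rho :
  (\int[@lebesgue_Rn R n]_(t in [set t | S (row_of_tuple t)]) (rho (row_of_tuple t))%:E)%E =
  row_int (fun y => (rho y)%:E * chi (y \in S))%E.
Proof.
rewrite integral_mkcond; apply: eq_integral => t _; rewrite patchE.
have -> : (t \in [set t | S (row_of_tuple t)]) = (row_of_tuple t \in S) by [].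
by case: (_ \in S); rewrite ?mule1 ?mule0.
Qed.

Lemma row_measurable_on S rho : measurable [set t | S (@row_of_tuple R n t)] ->
  measurable_fun [set t | S (@row_of_tuple R n t)] (rho \o @row_of_tuple R n : _ -> mT) ->
  row_measurable (fun y => (rho y)%:E * chi (y \in S))%E.
Proof.
move=> mS mrho.
rewrite (_ : _ \o _ = (EFin \o (rho \o @row_of_tuple R n)) \_
    [set t | S (@row_of_tuple R n t)]).
  by apply/(measurable_restrictT _ mS)/measurable_EFinP.
apply/funext => t; rewrite patchE /=.
have -> : (t \in [set t | S (row_of_tuple t)]) = (row_of_tuple t \in S) by [].
by case: (_ \in S); rewrite ?mule1 ?mule0.
Qed.

Lemma bigO_at_right (r : R -> R) p : (exists K e0, [/\ 0 <= K, 0 < e0 &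
    forall e, 0 < e < e0 -> `|r e| <= K * e ^+ p]) -> r =O_ (0^'+) (fun e => e ^+ p).
Proof.
move=> [K [e0 [K0 e00 rK]]]; apply/eqO_exP; exists (K + 1); first by rewrite ltr_wpDl.
near=> e; have e_gt0 : 0 < e by near: e; exact: nbhs_right_gt.
have e_lt : e < e0 by near: e; exact: nbhs_right_lt.
rewrite (ger0_norm (exprn_ge0 _ (ltW e_gt0))).
apply: le_trans (rK e _) _; first by rewrite e_gt0.
by rewrite ler_wpM2r ?exprn_ge0 1?ltW// ltrDl.
Unshelve. all: by end_near. Qed.

Lemma measurable_ball_set (e : R) : measurable [set t | enorm (@row_of_tuple R n t) <= e].
Proof.
have mb : measurable_fun setT (fun t : n.-tuple mT => enorm (row_of_tuple t) <= e :> R).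
  by apply: measurable_fun_ler => //; exact: row_measurable_enorm.
by have := mb measurableT [set true] I; rewrite setTI.
Qed.

Section BallQuadratic.
Variables (I : finType) (h : I -> 'rV[R]_n) (c e : R).
Hypotheses (c0 : 0 <= c) (e0 : 0 < e).

Let split_quadratic :
  (fun y => (c + \sum_i dot y (h i) ^+ 2)%:E * chi (enorm y <= e)%R)%E =
  (fun y => c%:E * chi (enorm y <= e)%R +
     \sum_i ((dot y (h i) ^+ 2)%:E * chi (enorm y <= e)%R))%E.
Proof.
apply/funext => y; rewrite -ge0_sume_distrl; last by move=> i _; rewrite lee_fin sqr_ge0.
by rewrite sumEFin EFinD ge0_muleDl// lee_fin sumr_ge0// => i _; rewrite sqr_ge0.
Qed.

Let moment_ge0 i y : (0 <= (dot y (h i) ^+ 2)%:E * chi (enorm y <= e)%R)%E.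
Proof. by rewrite mule_ge0 ?chi_ge0// lee_fin sqr_ge0. Qed.

Lemma row_measurable_quadratic :
  row_measurable (fun y => (c + \sum_i dot y (h i) ^+ 2)%:E * chi (enorm y <= e)%R)%E.
Proof.
rewrite split_quadratic; apply: emeasurable_funD.
  by apply: emeasurable_funM; [exact: measurable_cst|exact: row_measurable_ball].
by apply: emeasurable_sum => i; exact: row_measurable_moment.
Qed.

Lemma row_int_quadratic :
  row_int (fun y => (c + \sum_i dot y (h i) ^+ 2)%:E * chi (enorm y <= e)%R)%E =
  ((c + (\sum_i dot (h i) (h i)) * e ^+ 2 / (n%:R + 2)) * ball_volume n e)%:E.
Proof.
rewrite split_quadratic row_intD.
- rewrite row_intZl//; [|exact: row_measurable_ball|by move=> y; exact: chi_ge0].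
  rewrite ball_measure// unit_ball_measureE row_int_sum//; last by move=> i; exact: row_measurable_moment.
  rewrite (eq_bigr _ (fun i _ => second_moment (h i) e0)) sumEFin -!EFinM -EFinD.
  rewrite -mulr_suml (ball_volumeE n e) !exprS; congr EFin.
  by field; rewrite gt_eqF// ltr_wpDl.
- by apply: emeasurable_funM; [exact: measurable_cst|exact: row_measurable_ball].
- by apply: emeasurable_sum => i; exact: row_measurable_moment.
- by move=> y; rewrite mule_ge0 ?chi_ge0// lee_fin.
- by move=> y; rewrite sume_ge0.
Qed.

End BallQuadratic.

End RowVolume.

Section GraphVolume.
Variables (R : realType) (n k : nat).
Variables (M : set 'rV[R]_(n + k)) (p : 'rV[R]_(n + k)) (T : {vspace 'rV[R]_(n + k)}).
Variables (E : 'M[R]_(n, n + k)) (F : 'M[R]_(k, n + k)) (f : 'rV[R]_n -> 'rV[R]_k).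
Variables (D : set 'rV[R]_n) (U : set 'rV[R]_(n + k)).
Hypothesis hgraph : graph_chart M p T E F f D U.

Local Notation mT := (measurableTypeR R).
Local Notation chi := (ereal_of_bool R).
Let phi := graph_map p E F f.
Let oD : open D := gc_open_dom hgraph.
Let D0 : D 0 := gc_dom0 hgraph.
Let rho := density p E F f.

Lemma density_ge0 y : 0 <= rho y.
Proof. exact: sqrtr_ge0. Qed.

Lemma graph_volume (A : set 'rV[R]_(n + k)) (S : set 'rV[R]_n) : (forall y, D y /\ A (phi y) <-> S y) ->
  riemannian_volume phi D A = row_int (fun y => (rho y)%:E * chi (y \in S))%E.
Proof.
move=> AS; rewrite /riemannian_volume.
rewrite (_ : mkset _ = [set t | S (@row_of_tuple R n t)]).
  exact: integral_row_set.
by apply/seteqP; split=> t /AS.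
Qed.

Lemma row_measurable_density (S : set 'rV[R]_n) : measurable [set t | S (@row_of_tuple R n t)] -> S `<=` D ->
  row_measurable (fun y => (rho y)%:E * chi (y \in S))%E.
Proof.
move=> mS SD; apply: row_measurable_on => //.
have mD := open_row_measurable oD.
apply: (measurable_funS mD _ (continuous_row_measurable oD (density_continuous hgraph))).
by move=> t; exact: SD.
Qed.

Lemma graph_continuous y : D y -> {for y, continuous phi}.
Proof.
move=> Dy; apply: continuous_mx => i j; rewrite (ord1 i).
have cf := smooth_continuous (gc_smooth hgraph) Dy.
have cF := continuous_comp cf (@mulmx_coord_continuous _ _ _ F j (f y)).
have cE := @mulmx_coord_continuous _ _ _ E j y.
have c := cvgD (cvgD (cvg_cst (p 0 j)) cE) cF.
rewrite (_ : (fun z => _) = fun z => p 0 j + (z *m E) 0 j + (f z *m F) 0 j); first exact: c.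
by apply/funext => z; rewrite /phi /graph_map [LHS]mxE [in LHS]mxE.
Qed.

Lemma graph0 : phi 0 = p.
Proof. by rewrite /phi /graph_map (gc_f0 hgraph) !mul0mx !addr0. Qed.

Lemma graph_sub y : phi y - p = y *m E + f y *m F.
Proof. by rewrite /phi /graph_map -[p + _ + _]addrA [LHS]addrC addKr. Qed.

Lemma graph_image y : D y -> M (phi y) /\ U (phi y).
Proof. by move=> Dy; suff : (M `&` U) (phi y) by []; rewrite (gc_graph hgraph); exists y. Qed.

Lemma open_graph_preimage W : open W -> open [set y | D y /\ W (phi y)].
Proof.
move=> oW; rewrite openE => y [Dy Wy]; rewrite /interior.
near=> z; split; near: z; first exact: open_nbhs_nbhs.
exact: (graph_continuous Dy (open_nbhs_nbhs (conj oW Wy))).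
Unshelve. all: by end_near. Qed.

Lemma graph_near0 W : open W -> W p -> exists2 r, 0 < r &
  forall y, `|y| < r -> D y /\ W (phi y).
Proof.
move=> oW Wp; apply: (open_ball0 (open_graph_preimage oW)).
by rewrite /mkset graph0.
Qed.

(** The normal part [f y *m F] projects to zero on [T], so the cylinder condition is [enorm y <= e].
    The radius [r] ensures that this whole ball lies in [D] with image in [W]. *)
Lemma tangent_cylinder_near W : open W -> W p -> exists2 r, 0 < r & forall e, 0 < e < r ->
  row_measurable (fun y => (rho y)%:E * chi (enorm y <= e)%R)%E /\
  riemannian_volume phi D (cyl M p T e `&` W) =
    row_int (fun y => (rho y)%:E * chi (enorm y <= e)%R)%E.
Proof.
move=> oW Wp; have [r r0 rDW] := graph_near0 oW Wp; exists r => // e /andP[e0 er].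
have ballD y : enorm y <= e -> D y /\ W (phi y).
  by move=> ye; apply: rDW; rewrite (le_lt_trans (norm_le_enorm y))// (le_lt_trans ye).
have chiE y : (enorm y <= e) = (y \in [set z : 'rV[R]_n | enorm z <= e]).
  by apply/idP/idP => [?|/set_mem//]; exact/mem_set.
rewrite (_ : (fun y => _) =
    fun y => ((rho y)%:E * chi (y \in [set z : 'rV[R]_n | (enorm z <= e)%R]))%E); last first.
  by apply/funext => y; rewrite -chiE.
split.
  apply: row_measurable_density; first exact: measurable_ball_set.
  by move=> y /ballD[].
apply: graph_volume => y; rewrite /cyl /mkset /=.
have -> : enorm (oproj T (phi y - p)) = enorm y.
  rewrite (oproj_tangent hgraph) graph_sub mulmxDl.
  rewrite -mulmxA (tangent_gram hgraph) -[f y *m F *m _]mulmxA (normal_tangent_gram hgraph).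
  rewrite mulmx1 mulmx0 addr0 /enorm; congr Num.sqrt.
  by have := dot_frame hgraph y y 0 0; rewrite !mul0mx !addr0 dot0l addr0.
split=> [[_ [[_ ye] _]] //|ye]; have [Dy Wy] := ballD y ye.
by have [My Uy] := graph_image Dy.
Qed.

End GraphVolume.

(** * Tangent cylinder: the even part of the density over a ball *)

Section TangentCylinder.
Variables (R : realType) (n k : nat).
Variables (M : set 'rV[R]_(n + k)) (p : 'rV[R]_(n + k)) (T : {vspace 'rV[R]_(n + k)}).
Variables (E : 'M[R]_(n, n + k)) (F : 'M[R]_(k, n + k)) (f : 'rV[R]_n -> 'rV[R]_k).
Variables (D : set 'rV[R]_n) (U : set 'rV[R]_(n + k)).
Hypothesis hgraph : graph_chart M p T E F f D U.

Local Notation chi := (ereal_of_bool R).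
Let phi := graph_map p E F f.
Let rho := density p E F f.
Let tau := tr_third_form (second_form T E phi) T E F.
Local Notation b := (ball_volume n).

Let chi_upper (a a' q c : R) (t : bool) : (t -> `|a + a' - 2 - q| <= c) ->
  (a%:E * chi t + a'%:E * chi t <= (2 + c + q)%:E * chi t)%E.
Proof.
case: t => [/(_ isT)|_]; last by rewrite !mule0 adde0.
by rewrite !mule1 -EFinD lee_fin => /ler_normlP[_]; lra.
Qed.

(** The error term stands on the larger side, so that all integrands remain nonnegative and no
    extended-real subtraction occurs. *)
Let chi_lower (a a' q c : R) (t : bool) : (t -> `|a + a' - 2 - q| <= c) ->
  ((2 + q)%:E * chi t <= a%:E * chi t + a'%:E * chi t + c%:E * chi t)%E.
Proof.
case: t => [/(_ isT)|_]; last by rewrite !mule0 !adde0.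
by rewrite !mule1 -!EFinD lee_fin => /ler_normlP[+ _]; lra.
Qed.

Lemma row_int_tangent_density : exists K r : R, [/\ 0 <= K, 0 < r & forall e : R, 0 < e < r ->
  row_measurable (fun y => (rho y)%:E * chi (enorm y <= e)%R)%E ->
  exists2 x, row_int (fun y => (rho y)%:E * chi (enorm y <= e)%R)%E = x%:E &
    `|x - b e * (1 + e ^+ 2 / (2 * (n%:R + 2)) * tau)| <= K * e ^+ 4 * b e].
Proof.
have [K [r [K0 r0 rhoK]]] := density_expansion_even hgraph.
(* The squeeze below bounds twice the integral, whence the half. *)
exists (K / 2), r; split=> //; first by rewrite divr_ge0.
move=> e /andP[e0 er] mG; set G := (fun y => _) in mG *.
have b0 : 0 < b e by rewrite (ball_volumeE n e) mulr_gt0 ?exprn_gt0 ?ball_volume_gt0.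
have G0 y : (0 <= G y)%E by rewrite mule_ge0 ?chi_ge0// lee_fin sqrtr_ge0.
(* The reflection [y |-> - y] is orthogonal, so it preserves the integral and
   [row_int G + row_int G] integrates [rho y + rho (- y)]. *)
have N1 : (- 1%:M : 'M[R]_n) *m (- 1%:M : 'M[R]_n)^T = 1%:M.
  by rewrite linearN /= trmx1 mulmxN mulmx1 opprK.
have Gsym := row_int_orthogonal N1 mG G0.
have GN y : G (y *m (- 1%:M)) = ((rho (- y))%:E * chi (enorm y <= e)%R)%E.
  by rewrite /G mulmxN mulmx1 -scaleN1r enormZ normrN1 mul1r.
have mGN : row_measurable (fun y => G (y *m (- 1%:M))).
  rewrite (_ : (fun y => _) = fun y => G (y *m (- 1%:M) + 0)).
    exact: (row_measurable_affine (- 1%:M) 0 mG).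
  by apply/funext => y; rewrite addr0.
set h := fun ai : 'I_k * 'I_n => hess_row f ai.1 ai.2.
have hE y : \sum_a \sum_i dot y (hess_row f a i) ^+ 2 = \sum_ai dot y (h ai) ^+ 2.
  by rewrite pair_big.
have tauE : \sum_ai dot (h ai) (h ai) = tau.
  apply: etrans (hess_row_trace hgraph); apply/esym.
  exact: (pair_bigA _ (fun a i => dot (hess_row f a i) (hess_row f a i))).
have bound y : enorm y <= e ->
    `|rho y + rho (- y) - 2 - \sum_ai dot y (h ai) ^+ 2| <= K * e ^+ 4.
  move=> ye; rewrite -hE; have yr := le_trans (norm_le_enorm y) ye.
  apply: le_trans (rhoK y (le_lt_trans yr er)) _.
  by rewrite ler_wpM2l// lerXn2r ?nnegrE// ltW.
have Ke : 0 <= K * e ^+ 4 by rewrite mulr_ge0// exprn_ge0// ltW.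
have c0 : 0 <= 2 + K * e ^+ 4 by rewrite addr_ge0.
have two : 0 <= 2 :> R by [].
have up : (row_int G + row_int G <=
    ((2 + K * e ^+ 4 + tau * e ^+ 2 / (n%:R + 2)) * b e)%:E)%E.
  rewrite -[X in (_ + X <= _)%E]Gsym -row_intD//.
  rewrite -tauE -(row_int_quadratic h c0 e0); apply: row_int_le.
  - exact: emeasurable_funD.
  - exact: row_measurable_quadratic.
  - by move=> y; rewrite adde_ge0.
  by move=> y; rewrite GN; exact: chi_upper (bound y).
have lo : (((2 + tau * e ^+ 2 / (n%:R + 2)) * b e)%:E <=
    row_int G + row_int G + (K * e ^+ 4 * b e)%:E)%E.
  have mK : row_measurable (fun y : 'rV[R]_n => (K * e ^+ 4)%:E * chi (enorm y <= e)%R)%E.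
    by apply: emeasurable_funM; [exact: measurable_cst|exact: row_measurable_ball].
  have K_ge0 (y : 'rV[R]_n) : (0 <= (K * e ^+ 4)%:E * chi (enorm y <= e)%R)%E.
    by rewrite mule_ge0 ?chi_ge0.
  have <- : row_int (fun y : 'rV[R]_n => (K * e ^+ 4)%:E * chi (enorm y <= e)%R)%E =
      (K * e ^+ 4 * b e)%:E.
    rewrite row_intZl//; [|exact: row_measurable_ball|by move=> y; exact: chi_ge0].
    by rewrite ball_measure// unit_ball_measureE -!EFinM -ball_volumeE.
  rewrite -[X in (_ + X + _)%E]Gsym -row_intD// -row_intD//; last 2 first.
  - exact: emeasurable_funD.
  - by move=> y; rewrite adde_ge0.
  rewrite -tauE -(row_int_quadratic h two e0); apply: row_int_le.
  - exact: row_measurable_quadratic.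
  - by apply: emeasurable_funD => //; exact: emeasurable_funD.
  - by move=> y; rewrite mule_ge0 ?chi_ge0// lee_fin addr_ge0// sumr_ge0// => i _; rewrite sqr_ge0.
  by move=> y; rewrite GN; exact: chi_lower (bound y).
(* The upper bound [up] excludes an infinite integral. *)
have := row_int_ge0 G0; move: up lo; case: (row_int G) => [x| |] //.
rewrite -!EFinD !lee_fin => up lo _; exists x => //.
have -> : e ^+ 2 / (2 * (n%:R + 2)) * tau = tau * e ^+ 2 / (n%:R + 2) / 2.
  by field; rewrite gt_eqF// ltr_wpDl.
move: up lo; set q := tau * e ^+ 2 / (n%:R + 2).
rewrite (_ : K / 2 * e ^+ 4 * b e = K * e ^+ 4 * b e / 2); last by field.
set B := b e; set KK := K * e ^+ 4; rewrite ler_norml => up lo.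
apply/andP; split; nra.
Qed.

Lemma tangent_cylinder_volume W : open W -> W p ->
  exists2 r : R -> R, r =O_ (0^'+) (fun e => e ^+ 4) &
    \forall e \near 0^'+, riemannian_volume phi D (cyl M p T e `&` W) =
      (b e * (1 + e ^+ 2 / (2 * (n%:R + 2)) * tau + r e))%:E.
Proof.
move=> oW Wp; have [s s0 sW] := tangent_cylinder_near hgraph oW Wp.
have [K [r [K0 r0 rK]]] := row_int_tangent_density.
pose v e := riemannian_volume phi D (cyl M p T e `&` W).
pose t e := e ^+ 2 / (2 * (n%:R + 2)) * tau.
have bP (e : R) : 0 < e -> 0 < b e.
  by move=> e0; rewrite (ball_volumeE n e) mulr_gt0 ?exprn_gt0 ?ball_volume_gt0.
have vE e : 0 < e < Num.min s r -> exists2 x, v e = x%:E &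
    `|x - b e * (1 + t e)| <= K * e ^+ 4 * b e.
  rewrite lt_min => /and3P[e0 es er].
  have [|mG vE] := sW e; first by rewrite e0.
  have [|//|x xE xb] := rK e; first by rewrite e0.
  by exists x => //; rewrite /v vE.
exists (fun e => fine (v e) / b e - (1 + t e)).
  apply: bigO_at_right; exists K, (Num.min s r); split; rewrite ?lt_min ?s0//.
  move=> e esr; have [x -> xb] := vE e esr; have e0 : 0 < e by case/andP: esr.
  rewrite /= -(ler_pM2r (bP e e0)); apply: le_trans xb.
  rewrite -[X in _ * X](gtr0_norm (bP e e0)) -normrM mulrBl divfK ?(gt_eqF (bP e e0))//.
  by rewrite (mulrC (1 + _)).
near=> e; have e0 : 0 < e by near: e; exact: nbhs_right_gt.
have [|x xE _] := vE e.
  by rewrite e0; near: e; apply: nbhs_right_lt; rewrite lt_min s0.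
rewrite -/(v e) xE /= -/(t e) addrC subrK mulrC divfK// gt_eqF// bP.
Unshelve. all: by end_near. Qed.

End TangentCylinder.

Lemma dot_row (R : realType) m n n' (A : 'M[R]_(n, m)) (C : 'M[R]_(n', m)) i j :
  dot (row i A) (row j C) = (A *m C^T) i j.
Proof. by rewrite [RHS]mxE; apply: eq_bigr => l _; rewrite !mxE. Qed.

(** * Semi-axes and volume of the intersection ellipsoid *)

Section EllipsoidVolume.
Variables (R : realType) (n m : nat) (T V : {vspace 'rV[R]_m}) (E : 'M[R]_(n, m)) (P : 'M[R]_m).
Hypothesis hE : orthonormal_basis E [set` T].
Hypothesis VP : forall q, [/\ oproj V q = q *m P, q *m P \in V & orthocomp V (q - q *m P)].
Hypothesis VT : orthocomp V `&` [set` T] = [set 0].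

Local Notation chi := (ereal_of_bool R).
Let B := E *m P.
Let EE : E *m E^T = 1%:M := hE.1.

Let frame_mem (c : 'rV[R]_n) : c *m E \in T.
Proof. by apply/hE.2; rewrite submxMl. Qed.

(** If [v *m B] vanishes, the tangent vector [v *m E] is orthogonal to [V]; this is where
    transversality enters. *)
Lemma proj_frame_free : row_free B.
Proof.
rewrite -kermx_eq0; apply/rowV0P => v /sub_kermxP vB.
have [_ _] := VP (v *m E); rewrite -mulmxA -/B vB subr0 => oV.
have : (orthocomp V `&` [set` T]) (v *m E) by split=> //=; exact: frame_mem.
by rewrite VT => /= v0; rewrite -[v]mulmx1 -EE mulmxA v0 mul0mx.
Qed.

Lemma ellipsoid_frame y e : ellipsoid T V e (y *m E) <-> enorm (y *m B) <= e.
Proof.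
have [oE _ _] := VP (y *m E); rewrite /ellipsoid /= oE -mulmxA.
by split=> [[]//|ye]; split.
Qed.

(** In the frame [E] the ellipsoid is a sublevel set of the form with Gram matrix [B *m B^T]. If [Q]
    diagonalises it with eigenvalues [d], the axes are the rows of [Q *m E], of lengths
    [e / Num.sqrt (d 0 i)]. *)
Lemma semiaxes_exist : exists l : R -> 'I_n -> R, forall e, 0 < e ->
  principal_semiaxes T (ellipsoid T V e) (l e).
Proof.
have Ssym : (B *m B^T)^T = B *m B^T by rewrite trmx_mul trmxK.
have [Q [d [QQ QS]]] := symmetric_diagonalization Ssym.
have QQ' := mulmx1C QQ.
have dE i : dot (row i Q *m B) (row i Q *m B) = d 0 i.
  have := congr1 (fun A : 'M[R]_n => A i i) QS; rewrite [diag_mx d i i]mxE eqxx mulr1n => <-.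
  by rewrite -!row_mul dot_row trmx_mul !mulmxA.
have d0 i : 0 < d 0 i.
  rewrite -dE dot_gt0//; apply/eqP => QB0.
  have : row i Q *m B = 0 *m B by rewrite mul0mx.
  move/(row_free_inj proj_frame_free) => Qi.
  have := dot_row Q Q i i; rewrite Qi dot0l QQ mxE eqxx => /eqP.
  by rewrite eq_sym oner_eq0.
have dot_coord c i : dot (c *m E) (row i (Q *m E)) = (c *m Q^T) 0 i.
  by rewrite -[c *m E](row_id 0) dot_row trmx_mul mulmxA -(mulmxA c) EE mulmx1.
have quadE c : dot (c *m B) (c *m B) = \sum_i d 0 i * (c *m Q^T) 0 i ^+ 2.
  have SE : B *m B^T = Q^T *m diag_mx d *m Q.
    by rewrite -QS !mulmxA QQ' mul1mx -mulmxA QQ' mulmx1.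
  rewrite dotE trmx_mul mulmxA -(mulmxA c) SE !mulmxA mul_mx_diag -mulmxA -{2}[Q]trmxK -trmx_mul.
  by rewrite mxE; apply: eq_bigr => i _; rewrite [X in _ * X]mxE [X in X * _]mxE mulrAC mulrC expr2.
exists (fun e i => e / Num.sqrt (d 0 i)) => e e0; exists (Q *m E); split.
- split; first by rewrite trmx_mul mulmxA -(mulmxA Q) EE mulmx1.
  have fQ : row_full Q by rewrite row_full_unit; exact: orthogonal_unit.
  by move=> v; rewrite (eqmxMfull _ fQ); exact: hE.2.
- by move=> i; rewrite divr_gt0 ?sqrtr_gt0.
have ellE c : ellipsoid T V e (c *m E) <->
    \sum_i (dot (c *m E) (row i (Q *m E)) / (e / Num.sqrt (d 0 i))) ^+ 2 <= 1.
  rewrite ellipsoid_frame enorm_le ?(ltW e0)// quadE.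
  rewrite [X in _ <-> is_true (X <= _)](_ : _ = (\sum_i d 0 i * (c *m Q^T) 0 i ^+ 2) / e ^+ 2); last first.
    rewrite mulr_suml; apply: eq_bigr => i _; rewrite dot_coord invf_div !exprMn.
    by rewrite sqr_sqrtr ?ltW// exprVn mulrCA mulrA.
  by rewrite ler_pdivrMr ?exprn_gt0// mul1r.
apply/seteqP; split=> v [vT]; have /hE.2/submxP[c vc] := vT; rewrite vc in vT *.
  by move=> ve; split=> //; apply/ellE; split.
by move=> /ellE.
Qed.

Section Semiaxes.
Variables (e : R) (l : 'I_n -> R).
Hypothesis hl : principal_semiaxes T (ellipsoid T V e) l.

(** Any given semi-axes turn the condition into [enorm (y *m A) <= 1], with [A] the orthogonal
    change of frame [O] followed by division by the lengths. The left side does not mention [l], so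
    the product of the semi-axes is independent of their choice. *)
Lemma semiaxes_volume : row_int (fun y => chi (enorm (y *m B) <= e)%R) =
  (ball_volume n 1 * \prod_i l i)%:E.
Proof.
have [u [[uu uT] l0 ellE]] := hl.
pose O := E *m u^T; have uE : E = O *m u.
  have /submxP[X XE] : (E <= u)%MS.
    apply/row_subP => i; apply/uT; rewrite rowE; exact: frame_mem.
  by rewrite /O {2}XE -(mulmxA X) uu mulmx1.
have OO : O *m O^T = 1%:M by rewrite {2}/O trmx_mul trmxK mulmxA -uE EE.
pose A := O *m diag_mx (\row_i (l i)^-1).
have detA : `|\det A|^-1 = \prod_i l i.
  rewrite det_mulmx normrM (orthogonal_det OO) mul1r det_diag.
  rewrite ger0_norm ?prodr_ge0//; last by move=> i _; rewrite mxE invr_ge0 ltW.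
  by rewrite -prodfV; apply: eq_bigr => i _; rewrite mxE invrK.
have uA : A \in unitmx.
  rewrite unitmxE unitfE -normr_eq0 -invr_eq0 detA.
  by apply/prodf_neq0 => i _; rewrite gt_eqF.
have AE y : (enorm (y *m B) <= e) = (enorm (y *m A) <= 1).
  rewrite [RHS]enorm_le// expr1n.
  have dA : dot (y *m A) (y *m A) = \sum_i (dot (y *m E) (row i u) / l i) ^+ 2.
    apply: eq_bigr => i _; rewrite -expr2 /A mulmxA mul_mx_diag mxE [X in _ * X]mxE.
    by rewrite /O mulmxA -dot_row row_id.
  rewrite dA; apply/idP/idP => [/ellipsoid_frame|yl].
    by rewrite ellE => -[].
  by apply/ellipsoid_frame; rewrite ellE.
rewrite (_ : (fun y => _) = fun y => chi (enorm (y *m A) <= 1)%R); last first.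
  by apply/funext => y; rewrite AE.
rewrite (row_int_linear (G := fun y => chi (enorm y <= 1)%R) uA (@row_measurable_ball R n 1)).
  by rewrite detA -/(unit_ball_measure R n) unit_ball_measureE mulrC.
by move=> y; exact: chi_ge0.
Qed.

Lemma ellipsoid_volume : riemannian_volume (fun y => y *m E) setT (ellipsoid T V e) =
  (ball_volume n 1 * \prod_i l i)%:E.
Proof.
rewrite -semiaxes_volume /riemannian_volume.
rewrite (_ : mkset _ = [set t | [set y | enorm (y *m B) <= e] (@row_of_tuple R n t)]); last first.
  by apply/seteqP; split=> t /=; rewrite ellipsoid_frame//; move=> [].
rewrite (integral_row_set _ (fun y => Num.sqrt (\det (metric (fun y => y *m E) y)))).
congr row_int; apply/funext => y.
have -> : metric (fun y => y *m E) y = 1%:M.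
  apply/matrixP => i j; rewrite mxE.
  have dE v := is_derive_mulmx E (is_derive_id y v).
  rewrite !(@derive_val _ _ _ _ _ _ _ (dE _)).
  by rewrite dotE trmx_mul mulmxA -(mulmxA _ E) EE mulmx1 /coord_vec trmx_delta -rowE !mxE eqxx andbT.
rewrite det1 sqrtr1 mul1e; congr chi; exact: asboolb.
Qed.

End Semiaxes.

End EllipsoidVolume.

Section EuclideanNorm.
Variable R : realType.

Lemma dot_le_enorm m (u v : 'rV[R]_m) : dot u v <= enorm u * enorm v.
Proof.
have [->|u0] := eqVneq u 0; first by rewrite dot0l mulr_ge0 ?enorm_ge0.
have [->|v0] := eqVneq v 0; first by rewrite dotC dot0l mulr_ge0 ?enorm_ge0.
have a0 : 0 < enorm u by rewrite sqrtr_gt0 dot_gt0.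
have b0 : 0 < enorm v by rewrite sqrtr_gt0 dot_gt0.
have := dot_ge0 (enorm v *: u - enorm u *: v).
rewrite dotDl !dotDr (dotC _ (- _)) !dotNl (dotC _ (- _)) dotNl !dotZl !(dotC _ (_ *: _)) !dotZl.
rewrite -!enorm_sqr ?(dotC v u); set a := enorm u in a0 *; set b := enorm v in b0 * => H.
have : 0 <= 2 * (a * b) * (a * b - dot u v) by apply: le_trans H _; rewrite le_eqVlt; apply/orP; left; apply/eqP; ring.
by rewrite pmulr_rge0 ?mulr_gt0// subr_ge0.
Qed.

Lemma enormD m (u v : 'rV[R]_m) : enorm (u + v) <= enorm u + enorm v.
Proof.
rewrite enorm_le ?addr_ge0 ?enorm_ge0// dotDl !dotDr sqrrD !enorm_sqr (dotC v u).
by have := dot_le_enorm u v; lra.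
Qed.

Lemma enormN m (u : 'rV[R]_m) : enorm (- u) = enorm u.
Proof. by rewrite -scaleN1r enormZ normrN1 mul1r. Qed.

Lemma mulmx_enorm_bound m m' (G : 'M[R]_(m, m')) : exists2 C, 0 < C &
  forall z, enorm (z *m G) <= C * enorm z.
Proof.
exists (1 + \sum_i \sum_j `|G j i|).
  by rewrite ltr_pwDl// sumr_ge0// => i _; rewrite sumr_ge0.
move=> z; apply: le_trans (enorm_le_sum _) _.
rewrite mulrDl mul1r ler_wpDl ?enorm_ge0// mulr_suml; apply: ler_sum => i _.
rewrite mxE mulr_suml; apply: le_trans (ler_norm_sum _ _ _) _; apply: ler_sum => j _.
by rewrite normrM mulrC ler_wpM2l// coord_le_enorm.
Qed.

(** A row-free matrix has a right inverse, and the inverse of a bound for the latter is the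
    constant. *)
Lemma row_free_enorm_bound m m' (B : 'M[R]_(m, m')) : row_free B ->
  exists2 c, 0 < c & forall y, c * enorm y <= enorm (y *m B).
Proof.
move=> /row_freeP[G BG]; have [C C0 CG] := mulmx_enorm_bound G.
exists C^-1; first by rewrite invr_gt0.
by move=> y; rewrite ler_pdivrMl//; have := CG (y *m B); rewrite -mulmxA BG mulmx1.
Qed.

Lemma bernoulli_up (x : R) n : 0 <= x <= 1 -> (1 + x) ^+ n <= 1 + 2 ^+ n * x.
Proof.
(* The induction is run with the chord of the convex function between 0 and 1, of slope
   [2 ^+ n - 1], which is sharper than the stated bound. *)
move=> /andP[x0 x1]; suff : (1 + x) ^+ n <= 1 + (2 ^+ n - 1) * x by lra.
elim: n => [|n IH]; first by rewrite !expr0 subrr mul0r addr0.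
rewrite exprS; apply: le_trans (ler_wpM2l _ IH) _; first by rewrite addr_ge0.
have : 1 <= 2 ^+ n :> R by rewrite exprn_ege1// ler1n.
rewrite exprS; set s := 2 ^+ n => s1.
have : 0 <= (s - 1) * x * (1 - x) by rewrite !mulr_ge0// subr_ge0.
lra.
Qed.

Lemma bernoulli_lo (x : R) n : 0 <= x <= 1 -> 1 - 2 ^+ n * x <= (1 - x) ^+ n.
Proof.
move=> /andP[x0 x1]; elim: n => [|n IH]; first by rewrite !expr0 mul1r gerBl.
rewrite [leRHS]exprS; apply: le_trans (ler_wpM2l _ IH); last by rewrite subr_ge0.
have : 1 <= 2 ^+ n :> R by rewrite exprn_ege1// ler1n.
rewrite exprS; set s := 2 ^+ n => s1.
have sx : 0 <= (s - 1) * x by rewrite mulr_ge0// subr_ge0.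
have sxx : 0 <= s * x ^+ 2 by rewrite mulr_ge0 ?sqr_ge0// (le_trans ler01).
lra.
Qed.

(* With a = |y|, b = |yB|, v = |N(y)|, d = density: the perturbation h is at
   most half of the linear part, whence |y| = O(e) on either set. *)
Lemma cylinder_comparison (c K1 K2 a b v h d e : R) :
  0 < c -> 0 <= K1 -> 0 <= K2 -> 0 <= a -> 0 < e <= 1 ->
  c * a <= b -> b <= v + h -> v <= b + h -> h <= K1 * a ^+ 2 ->
  2 * K1 * a <= c -> `|d - 1| <= K2 * a ^+ 2 ->
  let C := (K1 + K2) * (2 / c) ^+ 2 in
  (v <= e -> [/\ a <= 2 / c * e, b <= e * (1 + C * e) & d <= 1 + C * e]) /\
  (b <= e * (1 - C * e) -> [/\ a <= 2 / c * e, v <= e & 1 - C * e <= d]).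
Proof.
move=> c0 K10 K20 a0 /andP[e0 e1] cab bvh vbh hK Kc dK C.
have t0 : 0 < 2 / c by rewrite divr_gt0.
have C0 : 0 <= C by rewrite mulr_ge0 ?addr_ge0// exprn_ge0// ltW.
(* In [C] the part [K1] pays for the displacement [h] and [K2] for the density, both after inserting
   [a <= 2 / c * e] into [a ^+ 2]. *)
have key : a <= 2 / c * e -> h <= C * e * e /\ `|d - 1| <= C * e.
  move=> ae; have a2 : a ^+ 2 <= (2 / c) ^+ 2 * e ^+ 2.
    by rewrite -exprMn lerXn2r ?nnegrE// ltW// mulr_gt0.
  have s0 : 0 <= (2 / c) ^+ 2 by rewrite sqr_ge0.
  split.
    apply: le_trans hK _; apply: le_trans (ler_wpM2l K10 a2) _.
    rewrite /C -mulrA -expr2 mulrA ler_wpM2r ?sqr_ge0// ler_wpM2r// lerDl//.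
  apply: le_trans dK _; apply: le_trans (ler_wpM2l K20 a2) _.
  rewrite /C mulrA; apply: ler_pM; rewrite ?mulr_ge0 ?sqr_ge0 ?invr_ge0 ?(ltW c0) ?(ltW e0)//.
    by rewrite ler_wpM2r// lerDr.
  by rewrite expr2 ger_pMr.
split.
  move=> ve; have ae : a <= 2 / c * e.
    rewrite mulrAC ler_pdivlMr// mulrC.
    have : h <= c * a / 2 by apply: le_trans hK _; nra.
    lra.
  have [hC /ler_normlP[_ dC]] := key ae; split=> //; lra.
move=> be; have ae : a <= 2 / c * e.
  rewrite mulrAC ler_pdivlMr// mulrC.
  have : e * (1 - C * e) <= e by rewrite ger_pMr// gerBl mulr_ge0// ltW.
  lra.
have [hC /ler_normlP[dC _]] := key ae; split=> //; lra.
Qed.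

End EuclideanNorm.

(** * Tilted cylinder: a squeeze between two ellipsoids *)

Section TiltedCylinder.
Variables (R : realType) (n k : nat).
Variables (M : set 'rV[R]_(n + k)) (p : 'rV[R]_(n + k)) (T : {vspace 'rV[R]_(n + k)}).
Variables (E : 'M[R]_(n, n + k)) (F : 'M[R]_(k, n + k)) (f : 'rV[R]_n -> 'rV[R]_k).
Variables (D : set 'rV[R]_n) (U : set 'rV[R]_(n + k)).
Hypothesis hgraph : graph_chart M p T E F f D U.
Variables (V : {vspace 'rV[R]_(n + k)}) (P : 'M[R]_(n + k)).
Hypothesis VP : forall q, [/\ oproj V q = q *m P, q *m P \in V & orthocomp V (q - q *m P)].
Hypothesis VT : orthocomp V `&` [set` T] = [set 0].

Local Notation chi := (ereal_of_bool R).
Let phi := graph_map p E F f.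
Let rho := density p E F f.
Let oD : open D := gc_open_dom hgraph.
Let D0 : D 0 := gc_dom0 hgraph.
Let B := E *m P.
Let N y : R := enorm (oproj V (phi y - p)).
Let h y := f y *m (F *m P).

Let NE y : N y = enorm (y *m B + h y).
Proof.
by have [oE _ _] := VP (phi y - p); rewrite /N oE (graph_sub p E F f y) mulmxDl -!mulmxA.
Qed.

Let h_bigO : bigO_at0 2 (fun y => enorm (h y)).
Proof.
have fO a : bigO_at0 2 (component f a).
  apply: (taylor2 oD D0); first exact: smooth_coord oD (gc_smooth hgraph).
    by rewrite /component (gc_f0 hgraph) mxE.
  by move=> j; exact: (derive_component0 hgraph).
apply: bigO_at0_enorm => j.
have := bigO_at0_sum (index_enum 'I_k) (fun a => bigO_at0Z ((F *m P) a j) (fO a)).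
apply: bigO_at0_eq => y; rewrite [RHS]mxE; apply: eq_bigr => a _; exact: mulrC.
Qed.

Lemma tilted_bounds : exists t C r : R, [/\ 0 < t, 0 <= C, 0 < r,
  forall y, enorm y <= t * enorm (y *m B) &
  forall y e, enorm y < r -> 0 < e <= 1 ->
    (N y <= e -> [/\ enorm y <= t * e, enorm (y *m B) <= e * (1 + C * e) & rho y <= 1 + C * e]) /\
    (enorm (y *m B) <= e * (1 - C * e) -> [/\ enorm y <= t * e, N y <= e & 1 - C * e <= rho y])].
Proof.
have [c c0 cB] := row_free_enorm_bound (proj_frame_free (gc_tangent_basis hgraph) VP VT).
have [K1 [r1 [K10 r10 hK]]] := h_bigO.
have [K2 [r2 [K20 r20 rhoK]]] := density_expansion1 hgraph.
(* The bounds [r1] and [r2] validate the two expansions; [c / (2 * K1 + 1)] yields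
   [2 * K1 * a <= c], the smallness required by [cylinder_comparison]. *)
pose r := Num.min (Num.min r1 r2) (c / (2 * K1 + 1)).
have K1p : 0 < 2 * K1 + 1 by rewrite ltr_wpDl// mulr_ge0.
exists (2 / c), ((K1 + K2) * (2 / c) ^+ 2), r; split.
- by rewrite divr_gt0.
- by rewrite mulr_ge0 ?addr_ge0 ?sqr_ge0.
- by rewrite !lt_min r10 r20 divr_gt0.
- move=> y; rewrite mulrAC ler_pdivlMr// mulrC; apply: le_trans (cB y) _.
  by rewrite ler_peMl ?enorm_ge0 ?ler1n.
move=> y e; rewrite !lt_min => /andP[/andP[y1 y2] y3] e01.
have yn := norm_le_enorm y.
have y22 : `|y| ^+ 2 <= enorm y ^+ 2 by rewrite lerXn2r ?nnegrE ?enorm_ge0.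
apply: (@cylinder_comparison R c K1 K2 _ (enorm (y *m B)) (N y) (enorm (h y))) => //.
- exact: enorm_ge0.
- have -> : y *m B = y *m B + h y + - h y by rewrite addrK.
  by rewrite NE (le_trans (enormD _ _))// enormN.
- by rewrite NE enormD.
- have := hK y (le_lt_trans yn y1); rewrite ger0_norm ?enorm_ge0// => /le_trans; apply.
  by rewrite ler_wpM2l.
- move: y3; rewrite ltr_pdivlMr// => y3.
  by have := enorm_ge0 y; lra.
- have := rhoK y (le_lt_trans yn y2) => /le_trans; apply.
  by rewrite ler_wpM2l.
Qed.

Lemma row_measurable_slab e : row_measurable (fun y : 'rV[R]_n => chi (enorm (y *m B) <= e)%R).
Proof.
rewrite (_ : (fun y => _) = fun y : 'rV[R]_n => chi (enorm (y *m B + 0) <= e)%R).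
  exact: (row_measurable_affine B 0 (@row_measurable_ball R _ e)).
by apply/funext => y; rewrite addr0.
Qed.

Lemma slab_dilation e : 0 < e -> row_int (fun y : 'rV[R]_n => chi (enorm (y *m B) <= e)%R) =
  ((e ^+ n)%:E * row_int (fun y : 'rV[R]_n => chi (enorm (y *m B) <= 1)%R))%E.
Proof.
move=> e0; rewrite (row_int_dilation e0 (row_measurable_slab e)); last by move=> y; exact: chi_ge0.
congr (_ * _)%E; congr row_int; apply/funext => y.
by rewrite -scalemxAl enormZ gtr0_norm// ger_pMr.
Qed.

Let cyl_set W e : set 'rV[R]_n := [set y | (D y /\ W (phi y)) /\ N y <= e].

Let cyl_set_measurable W e : open W -> measurable [set t | cyl_set W e (@row_of_tuple R n t)].
Proof.
move=> oW; have oO := open_graph_preimage hgraph oW.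
have cN y : D y /\ W (phi y) -> {for y, continuous N}.
  move=> [Dy _].
  have c1 : {for y, continuous (fun z => phi z - p)}.
    exact: (cvgB (graph_continuous hgraph Dy) (cvg_cst p)).
  have c2 : {for phi y - p, continuous (fun q : 'rV[R]_(n + k) => q *m P)}.
    by apply: continuous_mx => i j; rewrite (ord1 i); exact: mulmx_coord_continuous.
  have c3 := continuous_comp (@dot_continuous R _ ((phi y - p) *m P)) (@sqrt_continuous R _).
  have c := continuous_comp (continuous_comp c1 c2) c3.
  rewrite (_ : N = fun z => Num.sqrt (dot ((phi z - p) *m P) ((phi z - p) *m P))); first exact: c.
  by apply/funext => z; have [oE _ _] := VP (phi z - p); rewrite /N oE.
have mO := open_row_measurable oO.
have := continuous_row_measurable oO cN mO (measurable_itv `]-oo, e]).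
congr measurable; apply/seteqP; split=> t /=; rewrite in_itv//=.
Qed.

Let v1 := row_int (fun y : 'rV[R]_n => chi (enorm (y *m B) <= 1)%R).

(** [U0] is the Euclidean ball of radius [r] around [p]. It bounds the parameter of every graph
    point in [W] independently of [e], so that the comparison applies to the whole cylinder and not
    only to its part near [p]. *)
Lemma tilted_cylinder_volume : v1 \is a fin_num -> exists2 U0, nbhs p U0 &
  forall W, open W -> W p -> W `<=` U0 -> exists K e0 : R, [/\ 0 <= K, 0 < e0 &
    forall e : R, 0 < e < e0 ->
      exists2 x, riemannian_volume phi D (cyl M p V e `&` W) = x%:E &
        `|x - e ^+ n * fine v1| <= K * e ^+ n.+1].
Proof.
move=> v1fin; have [t [C [r [t0 C0 r0 tB bnd]]]] := tilted_bounds.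
exists [set q | dot (q - p) (q - p) < r ^+ 2].
  have c1 : {for p, continuous (fun q : 'rV[R]_(n + k) => q - p)} by exact: (cvgB cvg_id (cvg_cst p)).
  have c := continuous_comp c1 (@dot_continuous R _ (p - p)).
  apply: (cvgr_lt _ c); rewrite /= subrr dot0l; exact: exprn_gt0.
move=> W oW Wp Wr; have [s s0 sW] := graph_near0 hgraph oW Wp.
have v10 : 0 <= fine v1 by rewrite fine_ge0// row_int_ge0// => y; exact: chi_ge0.
(* The power [n.+1] collects [n] factors [1 + C e] from dilating the slab and one from the density;
   Bernoulli turns it into [2 ^+ n.+1]. *)
exists (2 ^+ n.+1 * C * fine v1).
(* The bound [(C + 1)^-1] gives [C * e < 1], so the inner slab has positive width; [r / t] and
   [s / t] keep it within the range of the comparison and inside the chart and [W]. *)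
exists (Num.min (Num.min 1 (C + 1)^-1) (Num.min (r / t) (s / t))); split.
- by rewrite !mulr_ge0// exprn_ge0.
- by rewrite !lt_min ltr01 !divr_gt0// invr_gt0 ltr_wpDl.
move=> e /andP[e0]; rewrite !lt_min => /andP[/andP[e1 eC] /andP[er es]].
have e01 : 0 < e <= 1 by rewrite e0 ltW.
rewrite ltr_pdivlMr// mulrC in er; rewrite ltr_pdivlMr// mulrC in es.
have x01 : 0 <= C * e <= 1.
  rewrite mulr_ge0 ?(ltW e0)//=; apply: ltW.
  have Cp : 0 < C + 1 by rewrite ltr_wpDl.
  by move: eC; rewrite -[_^-1]mul1r ltr_pdivlMr//; lra.
have x1 : C * e < 1.
  have Cp : 0 < C + 1 by rewrite ltr_wpDl.
  by move: eC; rewrite -[_^-1]mul1r ltr_pdivlMr//; lra.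
pose S := cyl_set W e.
have volE : riemannian_volume phi D (cyl M p V e `&` W) =
    row_int (fun y => (rho y)%:E * chi (y \in S))%E.
  apply: graph_volume => y; rewrite /S /cyl_set /cyl /mkset /=; split.
    by move=> [Dy [[_ Ny] Wy]].
  by move=> [[Dy Wy] Ny]; have [My _] := graph_image hgraph Dy.
have mS := cyl_set_measurable e oW.
have SD : S `<=` D by move=> y [[]].
have mG := row_measurable_density hgraph mS SD.
have G0 y : (0 <= (rho y)%:E * chi (y \in S))%E by rewrite mule_ge0 ?chi_ge0// lee_fin density_ge0.
have slab_mul c d : 0 <= c -> 0 < d ->
    row_int (fun y : 'rV[R]_n => c%:E * chi (enorm (y *m B) <= d)%R)%E =
    (c * (d ^+ n * fine v1))%:E.
  move=> c0 d0; rewrite row_intZl//; [|exact: row_measurable_slab|by move=> y; exact: chi_ge0].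
  by rewrite slab_dilation// -/v1 -{1}(fineK v1fin) -!EFinM.
have mslab c d : row_measurable (fun y : 'rV[R]_n => c%:E * chi (enorm (y *m B) <= d)%R)%E.
  by apply: emeasurable_funM; [exact: measurable_cst|exact: row_measurable_slab].
have up : (row_int (fun y => (rho y)%:E * chi (y \in S)) <=
    ((1 + C * e) * ((e * (1 + C * e)) ^+ n * fine v1))%:E)%E.
  have Ce1 : 0 < 1 + C * e by rewrite ltr_pwDl//; case/andP: x01.
  rewrite -(slab_mul _ _ (ltW Ce1) (mulr_gt0 e0 Ce1)); apply: row_int_le => // y.
  case: (boolP (y \in S)) => [/set_mem[[Dy Wy] Ny]|_]; last first.
    by rewrite mule0 mule_ge0 ?chi_ge0// lee_fin ltW.
  (* The frame is orthonormal, so [enorm y] is at most the distance from [phi y] to [p], which is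
     below [r] in [U0]. *)
  have yr : enorm y < r.
    have := Wr _ Wy; rewrite /= (graph_sub p E F f y) (dot_frame hgraph) => dr.
    rewrite -(ltr_pXn2r (n := 2)) ?nnegrE ?enorm_ge0 ?(ltW r0)// enorm_sqr.
    by apply: le_lt_trans dr; rewrite lerDl dot_ge0.
  have [/(_ Ny)[_ yB yrho] _] := bnd y e yr e01.
  by rewrite yB !mule1 lee_fin.
have lo : (((1 - C * e) * ((e * (1 - C * e)) ^+ n * fine v1))%:E <=
    row_int (fun y => (rho y)%:E * chi (y \in S)))%E.
  have Ce1 : 0 < 1 - C * e by rewrite subr_gt0.
  rewrite -(slab_mul _ _ (ltW Ce1) (mulr_gt0 e0 Ce1)); apply: row_int_le => //.
    by move=> y; rewrite mule_ge0 ?chi_ge0// lee_fin ltW.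
  move=> y; case: (boolP (enorm (y *m B) <= e * (1 - C * e))) => yB; last by rewrite mule0.
  have yr : enorm y < r.
    apply: le_lt_trans (tB y) _; apply: le_lt_trans er; rewrite ler_pM2l//.
    by apply: le_trans yB _; rewrite ger_pMr// gerBl; case/andP: x01.
  have [_ /(_ yB)[ye Ny yrho]] := bnd y e yr e01.
  have [|Dy Wy] := sW y; first exact: (le_lt_trans (norm_le_enorm y) (le_lt_trans ye es)).
  have -> : y \in S by apply/mem_set; split.
  by rewrite !mule1 lee_fin.
rewrite volE; have := row_int_ge0 G0; move: up lo.
case: (row_int _) => [x| |] //; rewrite !lee_fin => up lo _; exists x => //.
have Eup : (1 + C * e) * ((e * (1 + C * e)) ^+ n * fine v1) =
   e ^+ n * fine v1 * (1 + C * e) ^+ n.+1 by rewrite exprMn exprS; ring.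
have Elo : (1 - C * e) * ((e * (1 - C * e)) ^+ n * fine v1) =
   e ^+ n * fine v1 * (1 - C * e) ^+ n.+1 by rewrite exprMn exprS; ring.
have w0 : 0 <= e ^+ n * fine v1 by rewrite mulr_ge0// exprn_ge0// ltW.
have bu := ler_wpM2l w0 (bernoulli_up n.+1 x01).
have bl := ler_wpM2l w0 (bernoulli_lo n.+1 x01).
rewrite -Eup in bu; rewrite -Elo in bl.
have -> : 2 ^+ n.+1 * C * fine v1 * e ^+ n.+1 = e ^+ n * fine v1 * (2 ^+ n.+1 * (C * e)).
  by rewrite (exprS e); ring.
move: (le_trans up bu) (le_trans bl lo); set w := e ^+ n * fine v1; set z := 2 ^+ n.+1 * _.
rewrite mulrDr mulrBr mulr1 => ? ?; rewrite ler_norml; apply/andP; split; lra.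
Qed.

End TiltedCylinder.

Theorem theorem4p2 (R : realType) (n k : nat)
    (M : set 'rV[R]_(n + k)) (p : 'rV[R]_(n + k))
    (T : {vspace 'rV[R]_(n + k)})
    (E : 'M[R]_(n, n + k)) (F : 'M[R]_(k, n + k))
    (f : 'rV[R]_n -> 'rV[R]_k) (D : set 'rV[R]_n) (U : set 'rV[R]_(n + k))
    (hM : embedded_submanifold n M) (hp : M p)
    (hT : is_tangent_space M p T)
    (hgraph : graph_chart M p T E F f D U) :
  let phi := graph_map p E F f in
  let vol := riemannian_volume phi D in
  let II := second_form T E phi in
  let H := mean_curvature_vector II E in
  let Scal := scalar_curvature (metric phi) 0 in
  let trIII := tr_third_form II T E F in
  [/\ forall V : {vspace 'rV[R]_(n + k)}, \dim V = n ->
        orthocomp V `&` [set` T] = [set 0] ->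
        let semiaxes (l : R -> 'I_n -> R) := forall e, 0 < e ->
          principal_semiaxes T (ellipsoid T V e) (l e) in
        [/\ exists l, semiaxes l,
            forall l, semiaxes l -> forall e, 0 < e ->
              riemannian_volume (fun y => y *m E) setT (ellipsoid T V e)
              = (ball_volume n 1 * \prod_i l e i)%:E
          & exists2 U0, nbhs p U0 &
              forall W, open W -> W p -> W `<=` U `&` U0 ->
              forall l, semiaxes l ->
              exists2 r : R -> R, r =O_ (0^'+) (fun e => e ^+ n.+1) &
                \forall e \near 0^'+,
                  vol (cyl M p V e `&` W)
                  = (ball_volume n 1 * \prod_i l e i + r e)%:E],
      forall W, open W -> W p -> W `<=` U ->
        exists2 r : R -> R, r =O_ (0^'+) (fun e => e ^+ 4) &
          \forall e \near 0^'+,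
            vol (cyl M p T e `&` W)
            = (ball_volume n e
               * (1 + e ^+ 2 / (2 * (n%:R + 2)) * trIII + r e))%:E
    & trIII = dot H H - Scal].
Proof.
move=> phi vol II H Scal trIII; split; last 1 first.
- exact: gauss_trace hgraph.
- move=> V _ VT semiaxes; have [P _ VP] := oproj_mx V.
  have hE := gc_tangent_basis hgraph.
  split.
  + exact: semiaxes_exist hE VP VT.
  + by move=> l hl e e0; exact: (ellipsoid_volume hE VP (hl e e0)).
  (* This particular family is used only at [e = 1], to see that [v1] is finite. *)
  have [l1 hl1] := semiaxes_exist hE VP VT.
  set v1 := row_int (fun y => ereal_of_bool R (enorm (y *m (E *m P)) <= 1)).
  have v1E : v1 = (ball_volume n 1 * \prod_i l1 1 i)%:E.
    exact: (semiaxes_volume hE VP (hl1 1 ltr01)).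
  have v1fin : v1 \is a fin_num by rewrite v1E.
  have [U0 pU0 tilted] := tilted_cylinder_volume hgraph VP VT v1fin.
  exists U0 => // W oW Wp WU l hl.
  have [|K [e1 [K0 e10 volE]]] := tilted W oW Wp; first by move=> q /WU[].
  pose w (e : R) := ball_volume n 1 * \prod_i l e i.
  (* The family [l] is arbitrary and need not scale with [e]; its product does, because it is the
     measure of the slab, which is homogeneous of degree [n]. *)
  have wE e : 0 < e -> w e = e ^+ n * fine v1.
    move=> e0; apply: EFin_inj; rewrite [RHS]EFinM fineK// /w.
    by rewrite -(semiaxes_volume hE VP (hl e e0)) slab_dilation.
  exists (fun e => fine (vol (cyl M p V e `&` W)) - w e).
    apply: bigO_at_right; exists K, e1; split=> // e ee1.
    have [x xE xK] := volE e ee1; have /andP[e0 _] := ee1.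
    by rewrite /= /vol xE wE.
  near=> e; have e0 : 0 < e by near: e; exact: nbhs_right_gt.
  have [|x xE _] := volE e; first by rewrite e0; near: e; exact: nbhs_right_lt.
  by rewrite -/(w e) /vol xE /= addrC subrK.
- by move=> W oW Wp _; exact: (tangent_cylinder_volume hgraph oW Wp).
Unshelve. all: by end_near. Qed.
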